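(* One has $54\le f(4,3)\le83$.
   Context: $f(w,k)$ denotes the maximum size of a finite family of distinct $w$-element sets (on an arbitrary finite ground set) containing no $k$-sunflower. A $k$-sunflower is a collection of $k$ distinct sets $A_1,\dots,A_k$ for which there is a set $C$ (the core, possibly empty) with $A_i\cap A_j=C$ for all $i\ne j$. *)

(* Defs.v *)
From mathcomp Require Import all_boot.
From Stdlib Require Import ClassicalEpsilon.

Set Implicit Arguments.
Unset Strict Implicit.
Unset Printing Implicit Defensive.

Definition sunflower (T : finType) (k : nat) (S : {set {set T}}) : Prop :=
  #|S| = k /\
  exists C : {set T},
    forall A B, A \in S -> B \in S -> A != B -> A :&: B = C.

Definition sunflower_free (T : finType) (k : nat) (F : {set {set T}}) : Prop :=
  forall S : {set {set T}}, S \subset F -> ~ sunflower k S.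

Definition uniform (T : finType) (w : nat) (F : {set {set T}}) : Prop :=
  forall A, A \in F -> #|A| = w.

Definition is_max_sunflower_free_size (w k m : nat) : Prop :=
  (exists (T : finType) (F : {set {set T}}),
      [/\ uniform w F, sunflower_free k F & #|F| = m]) /\
  (forall (T : finType) (F : {set {set T}}),
      uniform w F -> sunflower_free k F -> #|F| <= m).

(* The maximum exists for every k > 0 by the Erdos-Rado sunflower lemma; were
   there no maximum, epsilon would return an unspecified number, so a bound on
   [f w k] can only be established by first showing that the maximum exists. *)
Definition f (w k : nat) : nat :=
  epsilon (inhabits 0) (is_max_sunflower_free_size w k).

Lemma f_eq (w k m : nat) : is_max_sunflower_free_size w k m -> f w k = m.
Proof.
move=> maxm; have : is_max_sunflower_free_size w k (f w k).
  by apply: epsilon_spec; exists m.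
case: maxm => [[T [F [Fw Fk <-]]] leF] [[T' [F' [F'w F'k <-]]] leF'].
by apply/eqP; rewrite eqn_leq leF ?leF'.
Qed.

(* Main.v *)
(** Upper bound. Suppose a 3-sunflower-free family [F] of 4-sets has 84 members.
  For [A] in [F] and [x] in [A], the members meeting [A] in exactly [{x}] give
  an intersecting 3-sunflower-free family of triples, so there are [h <= 10] of
  them; those meeting [A] in [{x, y}] give an intersecting graph. Weighing these
  classes bounds the number of members meeting [A]. The exceptional case
  [h >= 9], where the triples live on six points and almost form a 2-(6,3,2)
  design, is excluded by exhibiting a member that meets too many others. Hence
  every member is disjoint from at least 35 others. Disjointness is a
  triangle-free relation (three disjoint sets form a sunflower), so by the
  argument of Andrasfai ([5 * 35 > 2 * 84] forbids 5-cycles) it is bipartite and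
  [F] has an intersecting subfamily of size 42; but an intersecting subfamily
  has at most [1 + 4 + 12 + 24 = 41] members, counted by the size of their
  intersection with a fixed one.

  Lower bound. Take two disjoint copies of the 27 sets on three groups of three
  points that consist of two points in each of two groups. *)

Require Import Defs.
From mathcomp Require Import all_boot.
From mathcomp Require Import zify.
From Stdlib Require Import Classical_Prop.

Set Implicit Arguments.
Unset Strict Implicit.
Unset Printing Implicit Defensive.

(** The weights 6, 3 + 3 and 2 + 2 + 2 spread a member meeting [A] evenly over its points on [A]. If
    each of the four points receives at most 73, then [6 * 84 - 6 <= 6 * n + 4 * 73] yields
    [n >= 35] members disjoint from [A]. The obstacle is a point whose class [h] is 9 or 10: its
    weight is only bounded by 84, which leaves [n >= 27]. Such points are removed by a bootstrap.
    The nearly complete design on six points forces some member to be disjoint from few others; this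
    contradicts the lower bound on [n] known so far unless the weight is smaller, and the smaller
    weight raises the bound again until nothing is left. The exclusion is used twice. In an
    intersecting family the classes meeting a fixed member in two points may reach 18 rather than
    12, and the bound 8 on the classes of single points helps to show that any excess is paid for by
    the members meeting it in one point. Most case distinctions rest on one fact: a free graph has
    no vertex of degree 3 and no three disjoint edges, so an intersecting one with three edges is a
    triangle. *)

Ltac mem_rw :=
  repeat match goal with
  | H : is_true (?x \in ?T) |- context [?x \in ?T] => rewrite H
  | H : is_true (?x \notin ?T) |- context [?x \in ?T] => rewrite (negbTE H)
  | H : is_true (?x != ?y) |- context [?x == ?y] => rewrite (negbTE H)
  | H : is_true (?x != ?y) |- context [?y == ?x] =>
      rewrite [y == x]eq_sym (negbTE H)
  | |- context [?x == ?x] => rewrite eqxx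
  end.

Ltac mem_simp := rewrite ?inE; mem_rw; rewrite ?orbT ?orbF ?andbT ?andbF /=.

(* Decides a pointwise statement about [v]: split on the named points. *)
Ltac pointwise v :=
  mem_simp;
  repeat match goal with
  | |- context [v == ?a] => case: (eqVneq v a) => [?|?]; [subst v|]; mem_simp
  end; try done.

(** * Links and graphs *)

Section Families.

Variable V : finType.
Implicit Types (F G H L X Y : {set {set V}}) (A B C Q R S T W e : {set V}).
Implicit Types (a b c d p q u v w x y z : V).

(** Three sets form a sunflower exactly when no point lies in exactly two of them. Asking for such a
    point turns the exclusion of a sunflower into a Boolean check at one point. *)
Definition sf F := forall A B C, A \in F -> B \in F -> C \in F ->
  A != B -> A != C -> B != C -> exists v, (v \in A) + (v \in B) + (v \in C) = 2.

Definition crossing F G :=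
  forall A B, A \in F -> B \in G -> exists2 v, v \in A & v \in B.
Definition intersecting F := crossing F F.

Definition over F S := [set A in F | S \subset A].
Definition link F S := [set B : {set V} | [disjoint B & S] && (S :|: B \in F)].

Lemma sfP F A B C : sf F -> A \in F -> B \in F -> C \in F ->
  A != B -> A != C -> B != C ->
  (forall v, (v \in A) + (v \in B) + (v \in C) != 2) -> False.
Proof. by move=> sfF AF BF CF AB AC BC N; have [v /eqP] := sfF _ _ _ AF BF CF AB AC BC; apply/negP. Qed.

Lemma sfS F G : G \subset F -> sf F -> sf G.
Proof. by move=> /subsetP GF sfF A B C AG BG CG; apply: sfF; apply: GF. Qed.

Lemma uniformS n F G : G \subset F -> uniform n F -> uniform n G.
Proof. by move=> /subsetP GF uF A AG; apply: uF; apply: GF. Qed.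

Lemma setI_filter_sub F (P : pred {set V}) : [set A in F | P A] \subset F.
Proof. by apply/subsetP => A; rewrite inE => /andP[]. Qed.

Lemma sf_filter F (P : pred {set V}) : sf F -> sf [set A in F | P A].
Proof. exact/sfS/setI_filter_sub. Qed.

Lemma uniform_filter n F (P : pred {set V}) : uniform n F -> uniform n [set A in F | P A].
Proof. exact/uniformS/setI_filter_sub. Qed.

Lemma neqP A B : reflect (exists v, v \in A != (v \in B)) (A != B).
Proof.
apply: (iffP idP) => [|[v vAB]]; last by apply: contraNneq vAB => ->.
move=> AB; apply/existsP; apply: contraR AB; rewrite negb_exists => /forallP E.
by apply/eqP/setP => v; apply/eqP; move: (E v); rewrite negbK.
Qed.

Lemma meets A B : reflect (exists2 v, v \in A & v \in B) (~~ [disjoint A & B]).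
Proof.
apply: (iffP idP) => [/pred0Pn[v /= /andP[vA vB]]|[v vA vB]]; first by exists v.
by apply/pred0Pn; exists v; rewrite /= vA vB.
Qed.

Lemma card2E T : #|T| = 2 -> exists a b, a != b /\ T = [set a; b].
Proof. by move/eqP/cards2P. Qed.

Lemma card3E T : #|T| = 3 ->
  exists a b c, [/\ a != b, a != c, b != c & T = [set a; b; c]].
Proof.
move=> T3; have /set0Pn[a aT]: T != set0 by rewrite -card_gt0 T3.
have /card2E[b [c [bc E]]]: #|T :\ a| = 2 by move: T3; rewrite (cardsD1 a) aT; lia.
have bT: b \in T :\ a by rewrite E !inE eqxx.
have cT: c \in T :\ a by rewrite E !inE eqxx orbT.
move: bT cT; rewrite !inE => /andP[ba _] /andP[ca _].
exists a, b, c; split; rewrite // 1?eq_sym //.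
by rewrite -(setD1K aT) E setUA.
Qed.

Lemma card3E1 T a : #|T| = 3 -> a \in T ->
  exists b c, [/\ a != b, a != c, b != c & T = [set a; b; c]].
Proof.
move=> T3 aT.
have /card2E[b [c [bc E]]]: #|T :\ a| = 2 by move: T3; rewrite (cardsD1 a) aT; lia.
have bT: b \in T :\ a by rewrite E !inE eqxx.
have cT: c \in T :\ a by rewrite E !inE eqxx orbT.
move: bT cT; rewrite !inE => /andP[ba _] /andP[ca _].
exists b, c; split; rewrite // 1?eq_sym //.
by rewrite -(setD1K aT) E setUA.
Qed.

Lemma card3E2 T a b : #|T| = 3 -> a \in T -> b \in T -> a != b ->
  exists c, [/\ a != c, b != c & T = [set a; b; c]].
Proof.
move=> T3 aT bT ab; have [p [q [ap aq pq E]]] := card3E1 T3 aT.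
move: bT; rewrite E !inE (eq_sym b a) (negbTE ab) /= => /orP[]/eqP->.
  by exists q.
exists p; split=> //; first by rewrite eq_sym.
by apply/setP => v; rewrite !inE orbAC.
Qed.

Lemma card3E3 T a b c : #|T| = 3 -> a \in T -> b \in T -> c \in T ->
  a != b -> a != c -> b != c -> T = [set a; b; c].
Proof.
move=> T3 aT bT cT ab ac bc; have [d [ad bd E]] := card3E2 T3 aT bT ab.
by move: cT; rewrite E !inE ![c == _]eq_sym (negbTE ac) (negbTE bc) /= eq_sym => /eqP->.
Qed.

Lemma card2E1 T a : #|T| = 2 -> a \in T -> exists b, a != b /\ T = [set a; b].
Proof.
move=> T2 aT; have /cards1P[b E]: #|T :\ a| == 1 by move: T2; rewrite (cardsD1 a) aT; lia.
have: b \in T :\ a by rewrite E !inE.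
rewrite !inE eq_sym => /andP[ab bT]; exists b; split=> //.
by rewrite -(setD1K aT) E.
Qed.

Lemma card2E2 T a b : #|T| = 2 -> a \in T -> b \in T -> a != b -> T = [set a; b].
Proof.
move=> T2 aT bT ab; have [c [ac E]] := card2E1 T2 aT.
by move: bT; rewrite E !inE eq_sym (negbTE ab) /= => /eqP->.
Qed.

Lemma cards3 a b c : a != b -> a != c -> b != c -> #|[set a; b; c]| = 3.
Proof.
move=> ab ac bc; rewrite setUC cardsU1 cards2 ab !inE.
by rewrite negb_or ![c == _]eq_sym ac bc.
Qed.

Lemma mem_over F S A : (A \in over F S) = (A \in F) && (S \subset A).
Proof. by rewrite inE. Qed.

Lemma card_link F S : #|link F S| = #|over F S|.
Proof.
have <-: [set S :|: B | B in link F S] = over F S.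
  apply/setP => A; apply/imsetP/idP => [[B]|]; rewrite !inE.
    by case/andP=> _ ? ->; rewrite subsetUl andbT.
  case/andP=> AF SA; exists (A :\: S).
    rewrite inE disjoint_sym disjoints_subset setDE setUIr setUCr setIT (setUidPr SA) AF andbT.
    by apply/subsetP => v vS; rewrite !inE vS andbF.
  by rewrite setDE setUIr setUCr setIT; apply/esym/setUidPr.
rewrite card_in_imset //.
move=> A B; rewrite !inE => /andP[dA _] /andP[dB _] E.
apply/setP => v; move/setP/(_ v): E; rewrite !inE.
case: (boolP (v \in S)) => //= vS _.
by rewrite (disjointFl dA vS) (disjointFl dB vS).
Qed.

Lemma cardU2 F X Y : F \subset X :|: Y -> #|F| <= #|X| + #|Y|.
Proof. by move=> /subset_leq_card FXY; apply: leq_trans FXY (leq_card_setU _ _). Qed.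

Lemma card_cover2 F (P Q : pred {set V}) :
  (forall A, A \in F -> P A || Q A) ->
  #|F| <= #|[set A in F | P A]| + #|[set A in F | Q A]|.
Proof. by move=> PQ; apply: cardU2; apply/subsetP => A AF; rewrite !inE AF PQ. Qed.

Lemma card_split F (P : pred {set V}) :
  #|F| = #|[set A in F | P A]| + #|[set A in F | ~~ P A]|.
Proof.
rewrite -cardsUI [_ :&: _](_ : _ = set0) ?cards0 ?addn0.
  by apply: eq_card => A; rewrite !inE; case: (A \in F) => //=; rewrite orbN.
by apply/setP => A; rewrite !inE; case: (A \in F) => //=; rewrite andbN.
Qed.

Lemma leq_filter F (P Q : pred {set V}) : (forall A, A \in F -> P A -> Q A) ->
  #|[set A in F | P A]| <= #|[set A in F | Q A]|.
Proof.
move=> PQ; apply/subset_leq_card/subsetP => A; rewrite !inE => /andP[AF PA].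
by rewrite AF PQ.
Qed.

Lemma over_eq A B S v : #|A| = #|S|.+1 -> #|B| = #|S|.+1 ->
  S \subset A -> S \subset B -> v \notin S -> v \in A -> v \in B -> A = B.
Proof.
move=> cA cB SA SB vS vA vB.
have E C : #|C| = #|S|.+1 -> S \subset C -> v \in C -> v |: S = C.
  move=> cC SC vC; apply/eqP; rewrite eqEcard cC cardsU1 vS leqnn andbT.
  by apply/subsetP => u; rewrite !inE => /orP[/eqP->|/(subsetP SC)].
by rewrite -(E A) ?(E B).
Qed.

(** Distinct members containing [S] exceed it by distinct single points, so three of them form a
    sunflower with core [S]. *)
Lemma over_le2 k F S : sf F -> uniform k F -> #|S|.+1 = k -> #|over F S| <= 2.
Proof.
move=> sfF uF Sk; rewrite leqNgt; apply/card_gt2P => -[A [B [C [[]]]]].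
rewrite !inE => /andP[AF SA] /andP[BF SB] /andP[CF SC] [AB BC CA].
apply: (sfP sfF AF BF CF AB _ BC); first by rewrite eq_sym.
move=> v; case: (boolP (v \in S)) => vS.
  by rewrite (subsetP SA) ?(subsetP SB) ?(subsetP SC).
have [cA cB cC] : [/\ #|A| = #|S|.+1, #|B| = #|S|.+1 & #|C| = #|S|.+1].
  by rewrite Sk !uF.
case vA: (v \in A); case vB: (v \in B); case vC: (v \in C) => //.
- by rewrite (over_eq cA cB SA SB vS vA vB) eqxx in AB.
- by rewrite (over_eq cC cA SC SA vS vC vA) eqxx in CA.
- by rewrite (over_eq cB cC SB SC vS vB vC) eqxx in BC.
Qed.

Lemma in_link F S B : (B \in link F S) = [disjoint B & S] && (S :|: B \in F).
Proof. by rewrite inE. Qed.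

Lemma link_uniform k F S : uniform k F -> uniform (k - #|S|) (link F S).
Proof.
move=> uF B; rewrite in_link => /andP[dB /uF <-].
by rewrite cardsU disjoint_setI0 1?disjoint_sym // cards0; lia.
Qed.

Lemma link_inj F S A B : A \in link F S -> B \in link F S -> S :|: A = S :|: B -> A = B.
Proof.
rewrite !in_link => /andP[dA _] /andP[dB _] E.
apply/setP => v; move/setP/(_ v): E; rewrite !inE.
case: (boolP (v \in S)) => //= vS _.
by rewrite (disjointFl dA vS) (disjointFl dB vS).
Qed.

Lemma link_sf F S : sf F -> sf (link F S).
Proof.
move=> sfF A B C Al Bl Cl AB AC BC.
move: (Al) (Bl) (Cl); rewrite !in_link => /andP[dA AF] /andP[dB BF] /andP[dC CF].
have [||| v] := sfF _ _ _ AF BF CF.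
- by apply: contraNneq AB => /(link_inj Al Bl)->.
- by apply: contraNneq AC => /(link_inj Al Cl)->.
- by apply: contraNneq BC => /(link_inj Bl Cl)->.
by rewrite !inE; case: (boolP (v \in S)) => //= _ E; exists v.
Qed.

Lemma graph_star G v : sf G -> uniform 2 G -> #|[set A in G | v \in A]| <= 2.
Proof.
move=> sfG uG; have := over_le2 (S := [set v]) sfG uG; rewrite cards1 => /(_ erefl).
by rewrite (_ : over _ _ = [set A in G | v \in A]) //; apply/setP => A; rewrite !inE sub1set.
Qed.

(** Three concurrent edges form a sunflower, so three edges meeting pairwise form a triangle. A
    further edge would meet all three sides, hence contain two corners. *)
Lemma graph_intersecting G : sf G -> uniform 2 G -> intersecting G -> 2 < #|G| ->
  exists a b c, [/\ a != b, a != c, b != c & G = [set [set a; b]; [set b; c]; [set a; c]]].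
Proof.
move=> sfG uG iG /card_gt2P[A [B [C [[AG BG CG] [AB BC CA]]]]].
have [a aA aC] := iG _ _ AG CG.
have [b [ab EA]] := card2E1 (uG _ AG) aA.
have [c [ac EC]] := card2E1 (uG _ CG) aC.
have bc : b != c by apply: contraNneq CA => bc; rewrite EC EA bc.
have aB : a \notin B.
  apply/negP => aB; apply: (sfP sfG AG BG CG AB _ BC) => [|v]; first by rewrite eq_sym.
  have [d [ad EB]] := card2E1 (uG _ BG) aB.
  have bd : b != d by apply: contraNneq AB => bd; rewrite EA EB bd.
  have cd : c != d by apply: contraNneq BC => cd; rewrite EC EB cd.
  by rewrite EA EB EC; pointwise v.
have bB : b \in B.
  have [v vA vB] := iG _ _ AG BG.
  by move: vA vB; rewrite EA !inE => /orP[]/eqP->; rewrite ?(negbTE aB).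
have cB : c \in B.
  have [v vA vB] := iG _ _ CG BG.
  by move: vA vB; rewrite EC !inE => /orP[]/eqP->; rewrite ?(negbTE aB).
have EB := card2E2 (uG _ BG) bB cB bc.
exists a, b, c; split=> //; apply/eqP; rewrite eq_sym eqEsubset; apply/andP; split.
  by apply/subsetP => D; rewrite !inE -orbA => /or3P[]/eqP->; rewrite -?EA -?EB -?EC.
apply/subsetP => D DG; rewrite !inE -EA -EB -EC.
have [u uA uD] := iG _ _ AG DG; have [v vB vD] := iG _ _ BG DG.
have [w wC wD] := iG _ _ CG DG.
have D2 x y : x \in D -> y \in D -> x != y -> D = [set x; y] by apply: card2E2; apply: uG.
move: uA vB wC uD vD wD; rewrite EA EB EC !inE.
case/orP=> /eqP->; case/orP=> /eqP->; case/orP=> /eqP-> uD vD wD.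
all: try by rewrite (D2 a b) ?eqxx.
all: try by rewrite (D2 b c) ?eqxx ?orbT.
all: try by rewrite (D2 a c) ?eqxx ?orbT.
Qed.

Lemma graph_intersecting_le3 G : sf G -> uniform 2 G -> intersecting G -> #|G| <= 3.
Proof.
move=> sfG uG iG; rewrite leqNgt; apply/negP => G3.
have [|a [b [c [_ _ _ E]]]] := graph_intersecting sfG uG iG; first exact: ltnW.
move: G3; rewrite E ltnNge => /negP; apply.
apply: leq_trans (leq_card_setU _ _) _; rewrite cards1 addn1 ltnS.
by rewrite cards2; case: (_ != _).
Qed.

Lemma sub2 a b T : ([set a; b] \subset T) = (a \in T) && (b \in T).
Proof. by rewrite subUset !sub1set. Qed.

Lemma not_intersecting G : uniform 2 G -> ~ intersecting G ->
  exists a b c d, [/\ [set a; b] \in G, [set c; d] \in G &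
    [/\ a != b, a != c, a != d, b != c & b != d /\ c != d]].
Proof.
move=> uG nG; case: (pickP (fun p : {set V} * {set V} =>
    [&& p.1 \in G, p.2 \in G & [disjoint p.1 & p.2]])) => [[A B] /= /and3P[AG BG D]|N].
  have [a [b [ab EA]]] := card2E (uG _ AG); have [c [d [cd EB]]] := card2E (uG _ BG).
  have N x y : x \in A -> y \in B -> x != y.
    by move=> xA yB; apply: contraTneq yB => <-; rewrite (disjointFr D).
  exists a, b, c, d; rewrite -EA -EB; split=> //.
  by repeat split=> //; apply: N; rewrite ?EA ?EB !inE eqxx ?orbT.
case: nG => A B AG BG; apply/meets; apply: negbT.
by move: (N (A, B)); rewrite /= AG BG.
Qed.

Lemma no_matching3 G (e1 e2 e3 : {set V}) : sf G -> uniform 2 G -> e1 \in G -> e2 \in G -> e3 \in G ->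
  [disjoint e1 & e2] -> [disjoint e1 & e3] -> [disjoint e2 & e3] -> False.
Proof.
move=> sfG uG G1 G2 G3 D12 D13 D23.
have N (e f : {set V}) : e \in G -> [disjoint e & f] -> e != f.
  move=> /uG e2' D; apply: contra_eq_neq e2' => E; move: D; rewrite -E -setI_eq0 setIid => /eqP->.
  by rewrite cards0.
apply: (sfP sfG G1 G2 G3 (N _ _ G1 D12) (N _ _ G1 D13) (N _ _ G2 D23)) => v.
case: (boolP (v \in e1)) => v1; first by rewrite (disjointFr D12 v1) (disjointFr D13 v1).
by case: (boolP (v \in e2)) => v2; rewrite ?(disjointFr D23 v2) //; case: (v \in e3).
Qed.

(** If two edges are disjoint, every edge meets one of them, as three disjoint edges form a
    sunflower. Degrees are at most 2, so each of the two meets at most three edges, itself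
    included. *)
Lemma graph_le6 G : sf G -> uniform 2 G -> #|G| <= 6.
Proof.
move=> sfG uG; case: (leqP #|G| 3) => [/leq_trans->//|G3].
have [|a [b [c [d [abG cdG [ab ac ad bc [bd cd]]]]]]] := not_intersecting uG.
  by move=> iG; move: (graph_intersecting_le3 sfG uG iG); rewrite leqNgt G3.
have D2 : [disjoint [set a; b] & [set c; d]].
  by rewrite disjoints_subset sub2 !inE !negb_or ac ad bc bd.
have m1 x e : e \in G -> x \in e -> #|[set f in G | x \in f] :\ e| <= 1.
  by move=> eG xe; have := graph_star x sfG uG; rewrite (cardsD1 e) inE eG xe.
have le2 x y : [set x; y] \in G -> #|[set e in G | (x \in e) || (y \in e)] :\ [set x; y]| <= 2.
  move=> xyG; apply: leq_trans (_ : #|[set e in G | x \in e] :\ [set x; y]| + #|[set e in G | y \in e] :\ [set x; y]| <= _).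
    by apply: cardU2; apply/subsetP => e; rewrite !inE -andb_orr => /andP[-> /andP[-> ->]].
  by apply: (@leq_add _ _ 1 1); apply: m1; rewrite // !inE eqxx ?orbT.
have le3 x y : [set x; y] \in G -> #|[set e in G | (x \in e) || (y \in e)]| <= 3.
  by move=> xyG; rewrite (cardsD1 [set x; y]) inE xyG !inE eqxx; apply: le2.
apply: leq_trans (card_cover2 (P := fun e => (a \in e) || (b \in e)) (Q := fun e => (c \in e) || (d \in e)) _) _.
  move=> e eG; apply: contraT; rewrite !negb_or => /andP[/andP[ae be] /andP[ce de]]; exfalso.
  by apply: (no_matching3 sfG uG abG cdG eG D2); rewrite disjoints_subset sub2 !inE ?ae ?be ?ce ?de.
exact: leq_add (le3 _ _ abG) (le3 _ _ cdG).
Qed.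

Lemma over_le6 k F S : sf F -> uniform k F -> #|S| + 2 = k -> #|over F S| <= 6.
Proof.
move=> sfF uF Sk; rewrite -card_link; apply: graph_le6; first exact: link_sf.
by move=> A /(link_uniform uF); rewrite -Sk addKn.
Qed.

(** * Trace classes and stars of triples *)

Definition cls F A S := [set C in F | C :&: A == S].

Lemma over_disj2 k F S X Y : sf F -> uniform k F -> #|S|.+1 = k ->
  X \subset over F S -> Y \subset over F S -> [disjoint X & Y] -> #|X| + #|Y| <= 2.
Proof.
move=> sfF uF Sk XF YF D; apply: leq_trans (over_le2 sfF uF Sk).
rewrite -cardsUI disjoint_setI0 // cards0 addn0; apply: subset_leq_card.
by rewrite subUset XF.
Qed.

Lemma over_disj6 k F S X Y : sf F -> uniform k F -> #|S| + 2 = k ->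
  X \subset over F S -> Y \subset over F S -> [disjoint X & Y] -> #|X| + #|Y| <= 6.
Proof.
move=> sfF uF Sk XF YF D; apply: leq_trans (over_le6 sfF uF Sk).
rewrite -cardsUI disjoint_setI0 // cards0 addn0; apply: subset_leq_card.
by rewrite subUset XF.
Qed.

Lemma sub3 a b c T : ([set a; b; c] \subset T) = [&& a \in T, b \in T & c \in T].
Proof. by rewrite !subUset !sub1set andbA. Qed.

(* The link of the pair [{a, b}] in a triple system has at most two points; one of them is used up by [Q]. *)
Lemma pair_le1 L a b Q X : sf L -> uniform 3 L -> a != b ->
  Q \in L -> a \in Q -> b \in Q ->
  (forall T, T \in X -> [/\ T \in L, a \in T, b \in T & T != Q]) -> #|X| <= 1.
Proof.
move=> sfL uL ab QL aQ bQ XP.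
suff: #|X| + #|[set Q]| <= 2 by rewrite cards1; lia.
apply: (over_disj2 (S := [set a; b]) sfL uL); rewrite ?cards2 ?ab //.
- by apply/subsetP => T /XP[TL aT bT _]; rewrite inE TL sub2 aT.
- by rewrite sub1set inE QL sub2 aQ.
- by rewrite disjoint_sym disjoints1; apply/negP => /XP[_ _ _]; rewrite eqxx.
Qed.

Lemma pair_le0 L a b Q1 Q2 T : sf L -> uniform 3 L -> a != b -> Q1 \in L -> Q2 \in L ->
  Q1 != Q2 -> a \in Q1 -> b \in Q1 -> a \in Q2 -> b \in Q2 ->
  T \in L -> a \in T -> b \in T -> T = Q1 \/ T = Q2.
Proof.
move=> sfL uL ab Q1L Q2L Q12 aQ1 bQ1 aQ2 bQ2 TL aT bT.
case: (eqVneq T Q1) => [->|TQ1]; first by left.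
case: (eqVneq T Q2) => [->|TQ2]; first by right.
have: #|[set Q2; T]| <= 1.
  apply: (pair_le1 sfL uL ab Q1L) => // R; rewrite !inE => /orP[]/eqP->; split=> //.
  by rewrite eq_sym.
by rewrite cards2 eq_sym TQ2.
Qed.

(** The point in exactly two of [Q], [T], [T'] is not [a], which lies in all three, nor another
    point of [Q], which lies in [Q] only. *)
Lemma star_petal L Q T T' a : sf L -> Q \in L -> T \in L -> T' \in L ->
  Q != T -> Q != T' -> T != T' ->
  (forall v, v \in Q -> v != a -> (v \notin T) && (v \notin T')) ->
  a \in Q -> a \in T -> a \in T' -> exists2 u, u != a & (u \in T) && (u \in T').
Proof.
move=> sfL QL TL T'L QT QT' TT' N aQ aT aT'.
have [v E] := sfL _ _ _ QL TL T'L QT QT' TT'.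
have va : v != a by apply: contra_eq_neq E => ->; rewrite aQ aT aT'.
exists v => //; case vQ: (v \in Q) E; last by case: (v \in T) (v \in T') => [] [].
by have /andP[/negbTE-> /negbTE->] := N v vQ va.
Qed.

Lemma star_intersecting H a : sf H -> uniform 3 H -> (forall T, T \in H -> a \in T) ->
  (forall T T', T \in H -> T' \in H -> T != T' -> exists2 u, u != a & (u \in T) && (u \in T')) ->
  intersecting (link H [set a]).
Proof.
move=> sfH uH aH iH A B Al Bl; have uA := link_uniform uH Al.
rewrite cards1 subSS subn0 in uA.
move: (Al) (Bl); rewrite !in_link => /andP[dA AH] /andP[dB BH].
case: (eqVneq A B) => [<-|AB].
  by have [x [y [_ ->]]] := card2E uA; exists x; rewrite !inE eqxx.
have [|u ua] := iH _ _ AH BH; first by apply: contraNneq AB => /(link_inj Al Bl)->.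
by rewrite !inE (negbTE ua) => /andP[]; exists u.
Qed.

Lemma card_star H a : (forall T, T \in H -> a \in T) -> #|H| = #|link H [set a]|.
Proof.
move=> aH; rewrite card_link; apply: eq_card => T; rewrite inE sub1set.
by case TH: (T \in H) => //=; rewrite aH.
Qed.

Lemma star_le3 H a : sf H -> uniform 3 H -> (forall T, T \in H -> a \in T) ->
  (forall T T', T \in H -> T' \in H -> T != T' -> exists2 u, u != a & (u \in T) && (u \in T')) ->
  #|H| <= 3.
Proof.
move=> sfH uH aH iH; rewrite (card_star aH); apply: graph_intersecting_le3.
- exact: link_sf.
- by move=> e /(link_uniform uH); rewrite cards1.
- exact: star_intersecting.
Qed.

Lemma star_triangle H a : sf H -> uniform 3 H -> (forall T, T \in H -> a \in T) ->
  (forall T T', T \in H -> T' \in H -> T != T' -> exists2 u, u != a & (u \in T) && (u \in T')) ->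
  2 < #|H| -> exists x y z,
  [/\ x != y, x != z, y != z & [/\ a != x, a != y & a != z]] /\
  [/\ [set a; x; y] \in H, [set a; y; z] \in H & [set a; x; z] \in H].
Proof.
move=> sfH uH aH iH; rewrite (card_star aH) => H3.
have [|||x [y [z [xy xz yz E]]]] := graph_intersecting _ _ _ H3.
- exact: link_sf.
- by move=> e /(link_uniform uH); rewrite cards1.
- exact: star_intersecting.
have l u v : [set u; v] \in link H [set a] -> [/\ a != u, a != v & [set a; u; v] \in H].
  rewrite in_link setUA => /andP[D ->].
  by rewrite !(eq_sym a) -!in_set1 !(disjointFr D) ?inE ?eqxx ?orbT.
have [|ax ay xyH] := l x y; first by rewrite E !inE eqxx.
have [|_ az yzH] := l y z; first by rewrite E !inE eqxx ?orbT.
have [|_ _ xzH] := l x z; first by rewrite E !inE eqxx ?orbT.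
by exists x, y, z.
Qed.

Lemma star_pair H a : sf H -> uniform 3 H -> (forall T, T \in H -> a \in T) ->
  (forall T T', T \in H -> T' \in H -> T != T' -> exists2 u, u != a & (u \in T) && (u \in T')) ->
  1 < #|H| -> exists x y z,
  [/\ x != y, x != z, y != z & [/\ a != x, a != y & a != z]] /\
  [set a; x; y] \in H /\ [set a; x; z] \in H.
Proof.
move=> sfH uH aH iH /card_gt1P[T [T' [TH T'H TT']]].
have [x xa /andP[xT xT']] := iH _ _ TH T'H TT'; rewrite eq_sym in xa.
have [y [ay xy ET]] := card3E2 (uH _ TH) (aH _ TH) xT xa.
have [z [az xz ET']] := card3E2 (uH _ T'H) (aH _ T'H) xT' xa.
exists x, y, z; rewrite -ET -ET'; split=> //; split=> //.
by apply: contraNneq TT' => yz; rewrite ET ET' yz.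
Qed.

(** A member missing [a] meets all three sides of the triangle [xyz], so it contains a side. A side
    lies in at most two members, one of which goes through [a]. *)
Lemma triangle_hit H a x y z : sf H -> uniform 3 H -> intersecting H ->
  x != y -> x != z -> y != z -> a != x -> a != y -> a != z ->
  [set a; x; y] \in H -> [set a; y; z] \in H -> [set a; x; z] \in H ->
  #|[set T in H | a \notin T]| <= 3.
Proof.
move=> sfH uH iH xy xz yz ax ay az h1 h2 h3.
have P u v : [set a; u; v] \in H -> u != v ->
    #|[set T in H | [&& a \notin T, u \in T & v \in T]]| <= 1.
  move=> uvH uv; apply: (pair_le1 sfH uH uv uvH); rewrite ?inE ?eqxx ?orbT // => T.
  rewrite !inE => /and4P[TH aT uT vT]; split=> //.
  by apply: contraNneq aT => ->; rewrite !inE eqxx.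
apply: leq_trans (_ : #|[set T in H | [&& a \notin T, x \in T & y \in T]]| +
  (#|[set T in H | [&& a \notin T, y \in T & z \in T]]| +
   #|[set T in H | [&& a \notin T, x \in T & z \in T]]|) <= 3); last first.
  by have := P _ _ h1 xy; have := P _ _ h2 yz; have := P _ _ h3 xz; lia.
apply: leq_trans (cardU2 (X := [set T in H | [&& a \notin T, x \in T & y \in T]])
  (Y := [set T in H | [&& a \notin T, y \in T & z \in T]] :|:
        [set T in H | [&& a \notin T, x \in T & z \in T]]) _) _; last first.
  by rewrite leq_add2l; apply: cardU2.
apply/subsetP => T; rewrite !inE => /andP[TH aT].
have [u] := iH _ _ h1 TH; have [v] := iH _ _ h2 TH; have [w] := iH _ _ h3 TH.
rewrite !inE TH aT /= -!orbA => wo wT vo vT uo uT.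
case/or3P: uo => /eqP Eu; move: uT; rewrite Eu ?(negbTE aT) // => uT.
all: case/or3P: vo => /eqP Ev; move: vT; rewrite Ev ?(negbTE aT) // => vT.
all: case/or3P: wo => /eqP Ew; move: wT; rewrite Ew ?(negbTE aT) // => wT.
all: by rewrite ?uT ?vT ?wT ?orbT.
Qed.

(** The edges missing [a], [y] and [z] meet pairwise, since two disjoint ones and [ay] would be a
    matching of three. If there are at least two of them, no edge missing [a] contains [y] or [z];
    otherwise the count is 1 + 1 + 1. *)
Lemma graph_path_le3 G a y z : sf G -> uniform 2 G -> a != y -> a != z -> y != z ->
  [set a; y] \in G -> [set a; z] \in G -> [set y; z] \notin G ->
  #|[set e in G | a \notin e]| <= 3.
Proof.
move=> sfG uG ay az yz ayG azG yzG; set X := [set e in G | [&& a \notin e, y \notin e & z \notin e]].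
have XP e : e \in X -> [/\ e \in G, a \notin e, y \notin e & z \notin e] by rewrite inE => /and4P[].
have D u e : a \notin e -> u \notin e -> [disjoint [set a; u] & e].
  by move=> ae ue; rewrite disjoints_subset sub2 !inE ae.
have hit u e f : [set a; u] \in G -> e \in G -> f \in G -> a \notin e -> u \notin e -> a \notin f -> u \notin f ->
    exists2 v, v \in e & v \in f.
  move=> auG eG fG ae ue af uf; apply/meets/negP => ef.
  exact: (no_matching3 sfG uG auG eG fG (D _ _ ae ue) (D _ _ af uf) ef).
have X3 : #|X| <= 3.
  apply: graph_intersecting_le3; [exact: sf_filter sfG|exact: uniform_filter uG|].
  by move=> e f /XP[eG ae ye _] /XP[fG af yf _]; apply: hit ayG eG fG ae ye af yf.
pose Y u := [set e in G | (a \notin e) && (u \in e)].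
have deg1 u : [set a; u] \in G -> #|Y u| <= 1.
  move=> auG; have := graph_star u sfG uG.
  rewrite (cardsD1 [set a; u]) !inE auG eqxx orbT /= add1n ltnS; apply: leq_trans.
  apply/subset_leq_card/subsetP => e; rewrite !inE => /and3P[eG ae ->]; rewrite eG !andbT.
  by apply: contraNneq ae => ->; rewrite !inE eqxx.
(* An edge [uw] missing [a] is disjoint from [au'], so it meets every edge of [X], necessarily in
   [w]; then [w] has degree 3. *)
have none u u' : 1 < #|X| -> u != u' -> [set a; u'] \in G -> [set u; u'] \notin G ->
    (forall e, e \in X -> (u \notin e) && (u' \notin e)) -> Y u = set0.
  move=> /card_gt1P[f1 [f2 [f1X f2X f12]]] uu' au'G uu'G XN; apply/setP => e; rewrite !inE.
  apply/negP => /and3P[eG ae ue]; have [w [uw Ee]] := card2E1 (uG _ eG) ue.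
  have u'e : u' \notin e.
    by apply: contraNN uu'G => u'e; rewrite -(card2E2 (uG _ eG) ue u'e uu').
  have wX f : f \in X -> (w \in f) && (f != e).
    move=> fX; have /andP[uf u'f] := XN f fX; have [fG af _ _] := XP f fX.
    have [v] := hit u' e f au'G eG fG ae u'e af u'f.
    rewrite {1}Ee !inE => /orP[]/eqP-> vf; first by rewrite vf in uf.
    by rewrite vf; apply: contraNneq uf => ->.
  have := graph_star w sfG uG; rewrite leqNgt => /negP; apply; apply/card_gt2P; exists e, f1, f2.
  have [[/andP[w1 n1] /andP[w2 n2]] [[G1 _ _ _] [G2 _ _ _]]] := ((wX _ f1X, wX _ f2X), (XP _ f1X, XP _ f2X)).
  by rewrite !inE {2}Ee !inE eqxx orbT eG G1 G2 w1 w2; split=> //; split; rewrite // eq_sym.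
apply: leq_trans (_ : #|X| + (#|Y y| + #|Y z|) <= 3).
  apply: leq_trans (cardU2 (X := X) (Y := Y y :|: Y z) _) _; last by rewrite leq_add2l; apply: cardU2.
  by apply/subsetP => e; rewrite !inE => /andP[-> ->] /=; case: (y \in e); case: (z \in e).
case: (leqP #|X| 1) => X1; first by move: X1 (deg1 y ayG) (deg1 z azG); clear; lia.
rewrite (none y z) // ?(none z y) // ?cards0 1?eq_sym // ?addn0 //.
- by rewrite setUC.
- by move=> e /XP[_ _ -> ->].
- by move=> e /XP[_ _ -> ->].
Qed.

Lemma set3C a b c : [set a; b; c] = [set b; a; c].
Proof. by rewrite [[set a; b]]setUC. Qed.

Lemma set3AC a b c : [set a; b; c] = [set a; c; b].
Proof. by rewrite setUAC. Qed.

Lemma card_link_avoid H x a : a != x ->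
  #|[set T in H | (x \in T) && (a \notin T)]| = #|[set e in link H [set x] | a \notin e]|.
Proof.
move=> ax; pose H' := [set T in H | a \notin T].
have -> : [set T in H | (x \in T) && (a \notin T)] = over H' [set x].
  by apply/setP => T; rewrite !inE sub1set; case: (T \in H); rewrite //= andbC.
rewrite -card_link; apply: eq_card => e; rewrite !inE negb_or.
by rewrite ax; case: [disjoint _ & _].
Qed.

Lemma link1_set2 H x u v : [set x; u; v] \in H -> x != u -> x != v ->
  [set u; v] \in link H [set x].
Proof.
move=> xH xu xv; rewrite in_link setUA xH andbT disjoint_sym disjoints1.
by rewrite !inE negb_or xu.
Qed.

Lemma link1_set2P H x u v : [set u; v] \in link H [set x] -> [set x; u; v] \in H.
Proof. by rewrite in_link setUA => /andP[]. Qed.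

(** By [star_petal] with [{q, a, b}], the members through [a] but not [b] meet pairwise off [a], so
    there are at most three. Only one member contains both [a] and [b], since [{q, a, b}] takes the
    other place over this pair. *)
Lemma half_star_le8 L H q a b : sf L -> uniform 3 L -> H \subset L -> intersecting H ->
  [set q; a; b] \in L -> q != a -> q != b -> a != b -> (forall T, T \in H -> q \notin T) ->
  1 < #|[set T in H | (a \in T) && (b \notin T)]| -> #|H| <= 8.
Proof.
move=> sfL uL HL iH QL qa qb ab qH; set S := [set _ in _ | _] => S1.
have sfH := sfS HL sfL; have uH := uniformS HL uL.
have QN T : T \in H -> [set q; a; b] != T.
  by move=> /qH; apply: contraNneq => <-; rewrite !inE eqxx.
have SH : S \subset H by apply: setI_filter_sub.
have sfS' := sfS SH sfH; have uS := uniformS SH uH.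
have aS T : T \in S -> a \in T by rewrite !inE => /and3P[].
have SP T : T \in S -> [/\ T \in H, T \in L, a \in T & b \notin T].
  by rewrite !inE => /and3P[TH aT bT]; rewrite (subsetP HL).
have pS T T' : T \in S -> T' \in S -> T != T' -> exists2 u, u != a & (u \in T) && (u \in T').
  move=> /SP[TH TL aT bT] /SP[TH' TL' aT' bT'] TT'.
  apply: (star_petal sfL QL TL TL' (QN _ TH) (QN _ TH') TT') => //; last by rewrite !inE eqxx orbT.
  move=> v; have qT := qH _ TH; have qT' := qH _ TH'.
  by rewrite !inE -orbA => /or3P[]/eqP->; rewrite ?eqxx // ?qT ?qT' ?bT ?bT'.
have Pab : #|[set T in H | (a \in T) && (b \in T)]| <= 1.
  apply: (pair_le1 sfL uL ab QL); rewrite ?inE ?eqxx ?orbT // => T.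
  rewrite !inE => /and3P[TH aT bT]; rewrite (subsetP HL) //; split=> //.
  by rewrite eq_sym QN.
have Pa : #|[set T in H | a \in T]| <= #|S| + 1.
  apply: leq_trans (_ : _ <= #|S| + #|[set T in H | (a \in T) && (b \in T)]|) _; last by rewrite leq_add2l.
  apply: cardU2; apply/subsetP => T; rewrite !inE => /andP[-> ->] /=.
  by case: (b \in T).
rewrite (card_split H (fun T => a \in T)).
(* Three members of [S] form a triangle in the link of [a]; then at most 4 members contain [a] and
   at most 3 miss it. *)
case: (leqP #|S| 2) => S2; last first.
  have [x [y [z [[xy xz yz [ax ay az]] [h1 h2 h3]]]]] := star_triangle sfS' uS aS pS S2.
  have := star_le3 sfS' uS aS pS.
  have := triangle_hit sfH uH iH xy xz yz ax ay az (subsetP SH _ h1) (subsetP SH _ h2) (subsetP SH _ h3).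
  by move: Pa; clear; lia.
(* Now [S] consists of [axy] and [axz], and at most 3 members contain [a]. A member missing [a] and
   [x] contains [y] and [z]. Whether [xyz] is a member decides if the remaining 5 places split as 4
   + 1 or as 3 + 2. *)
have [x [y [z [[xy xz yz [ax ay az]] [h1 h2]]]]] := star_pair sfS' uS aS pS S1.
move: (subsetP SH _ h1) (subsetP SH _ h2) => {}h1 {}h2.
rewrite (card_split [set T in H | a \notin T] (fun T => x \in T)).
have -> : [set T in [set T in H | a \notin T] | x \in T] =
    [set T in H | (x \in T) && (a \notin T)].
  by apply/setP => T; rewrite !inE -andbA; case: (T \in H); rewrite //= andbC.
set X1 := [set T in H | (x \in T) && _]; set X2 := [set T in [set T in _ | _] | _].
have X2P T : T \in X2 -> [/\ T \in H, x \notin T, y \in T & z \in T].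
  rewrite !inE => /andP[/andP[TH aT] xT]; split=> //.
    have [u] := iH _ _ TH h1; rewrite !inE -orbA => uT /or3P[]/eqP Eu; move: uT; rewrite Eu //.
      by rewrite (negbTE aT).
    by rewrite (negbTE xT).
  have [u] := iH _ _ TH h2; rewrite !inE -orbA => uT /or3P[]/eqP Eu; move: uT; rewrite Eu //.
    by rewrite (negbTE aT).
  by rewrite (negbTE xT).
have sub T : T \in H -> T \in L by apply/subsetP.
case: (boolP ([set x; y; z] \in H)) => xyzH.
  have X2le : #|X2| <= 1.
    apply: (pair_le1 sfH uH yz xyzH); rewrite ?inE ?eqxx ?orbT // => T /X2P[TH xT yT zT].
    by split=> //; apply: contraNneq xT => ->; rewrite !inE eqxx.
  have : #|X1| + #|[set [set a; x; y]; [set a; x; z]]| <= 6.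
    apply: (over_disj6 (S := [set x]) sfH uH); rewrite ?cards1 //.
    - by apply/subsetP => T; rewrite !inE sub1set => /and3P[-> ->].
    - by apply/subsetP => T; rewrite !inE sub1set => /orP[]/eqP->; rewrite ?h1 ?h2 !inE eqxx orbT.
    - apply/pred0P => T /=; apply/negP; rewrite !inE => /andP[/and3P[_ _ aT]].
      by case/orP=> /eqP ET; rewrite ET !inE eqxx in aT.
  have d : [set a; x; y] != [set a; x; z].
    by apply/neqP; exists y; mem_simp.
  by rewrite cards2 d; move: X2le Pa S2; clear; lia.
have X2le : #|X2| <= 2.
  apply: leq_trans (over_le2 (S := [set y; z]) sfH uH _); last by rewrite cards2 yz.
  by apply/subset_leq_card/subsetP => T /X2P[TH _ yT zT]; rewrite inE TH sub2 yT.
have X1le : #|X1| <= 3.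
  rewrite /X1 card_link_avoid //; apply: graph_path_le3 ay az yz _ _ _.
  - exact: link_sf.
  - by move=> e /(link_uniform uH); rewrite cards1.
  - by apply: link1_set2 => //; rewrite 1?set3C // eq_sym.
  - by apply: link1_set2 => //; rewrite 1?set3C // eq_sym.
  - by apply: contra xyzH => /link1_set2P.
by move: X1le X2le Pa S2; clear; lia.
Qed.

(** A member missing [q1], [q2] and the other four points would form three disjoint sets with [Q1]
    and [Q2]. If each of the four half-stars has at most one member, these and the two pairs cover 4
    + 2 members; otherwise [half_star_le8] applies. *)
Lemma disjoint_pair_le8 L H Q1 Q2 q1 q2 : sf L -> uniform 3 L -> H \subset L -> intersecting H ->
  Q1 \in L -> Q2 \in L -> [disjoint Q1 & Q2] -> q1 \in Q1 -> q2 \in Q2 ->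
  (forall T, T \in H -> q1 \notin T) -> (forall T, T \in H -> q2 \notin T) -> #|H| <= 8.
Proof.
move=> sfL uL HL iH Q1L Q2L D q1Q q2Q q1H q2H.
have [a [b [q1a q1b ab E1]]] := card3E1 (uL _ Q1L) q1Q.
have [c [d [q2c q2d cd E2]]] := card3E1 (uL _ Q2L) q2Q.
have hit T : T \in H -> [|| a \in T, b \in T, c \in T | d \in T].
  move=> TH; apply: contraT; rewrite !negb_or => /and4P[aT bT cT dT].
  have q1T := q1H _ TH; have q2T := q2H _ TH.
  exfalso; apply: (sfP sfL Q1L Q2L (subsetP HL _ TH)).
  - by apply/neqP; exists q1; rewrite q1Q (disjointFr D q1Q).
  - by apply/neqP; exists q1; rewrite q1Q (negbTE q1T).
  - by apply/neqP; exists q2; rewrite q2Q (negbTE q2T).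
  move=> v; case: (boolP (v \in Q1)) => vQ1.
    rewrite (disjointFr D vQ1); move: vQ1; rewrite E1 !inE -orbA.
    by case/or3P=> /eqP->; rewrite ?(negbTE q1T) ?(negbTE aT) ?(negbTE bT).
  case: (boolP (v \in Q2)) => vQ2; last by case: (v \in T).
  move: vQ2; rewrite E2 !inE -orbA.
  by case/or3P=> /eqP->; rewrite ?(negbTE q2T) ?(negbTE cT) ?(negbTE dT).
have Q1L' : [set q1; b; a] \in L by rewrite setUAC -E1.
have Q2L' : [set q2; d; c] \in L by rewrite setUAC -E2.
rewrite E1 in Q1L; rewrite E2 in Q2L.
case: (leqP #|[set T in H | (a \in T) && (b \notin T)]| 1) => [Sa|]; last first.
  exact: half_star_le8 sfL uL HL iH Q1L q1a q1b ab q1H.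
case: (leqP #|[set T in H | (b \in T) && (a \notin T)]| 1) => [Sb|]; last first.
  by have ba : b != a; [rewrite eq_sym|exact: half_star_le8 sfL uL HL iH Q1L' q1b q1a ba q1H].
case: (leqP #|[set T in H | (c \in T) && (d \notin T)]| 1) => [Sc|]; last first.
  exact: half_star_le8 sfL uL HL iH Q2L q2c q2d cd q2H.
case: (leqP #|[set T in H | (d \in T) && (c \notin T)]| 1) => [Sd|]; last first.
  by have dc : d != c; [rewrite eq_sym|exact: half_star_le8 sfL uL HL iH Q2L' q2d q2c dc q2H].
have pair q u v : [set q; u; v] \in L -> u != v -> (forall T, T \in H -> q \notin T) ->
    #|[set T in H | (u \in T) && (v \in T)]| <= 1.
  move=> QL uv qH; apply: (pair_le1 sfL uL uv QL); rewrite ?inE ?eqxx ?orbT // => T.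
  rewrite !inE => /and3P[TH uT vT]; rewrite (subsetP HL) //; split=> //.
  by apply: contraNneq (qH _ TH) => ->; rewrite !inE eqxx.
have := pair _ _ _ Q1L ab q1H; have := pair _ _ _ Q2L cd q2H.
set P1 := [set T in H | _ && (d \in T)]; set P2 := [set T in H | _ && (b \in T)].
move=> P1le P2le.
have : #|H| <= (#|[set T in H | (a \in T) && (b \notin T)]| +
  #|[set T in H | (b \in T) && (a \notin T)]| + #|P2|) +
  (#|[set T in H | (c \in T) && (d \notin T)]| +
  #|[set T in H | (d \in T) && (c \notin T)]| + #|P1|).
  apply: leq_trans (cardU2 (X := [set T in H | (a \in T) || (b \in T)])
     (Y := [set T in H | (c \in T) || (d \in T)]) _) _.
    by apply/subsetP => T TH; rewrite !inE TH /= -orbA hit.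
  have cov u v : #|[set T in H | (u \in T) || (v \in T)]| <=
     #|[set T in H | (u \in T) && (v \notin T)]| + #|[set T in H | (v \in T) && (u \notin T)]|
     + #|[set T in H | (u \in T) && (v \in T)]|.
    apply: leq_trans (cardU2 (X := [set T in H | (u \in T) && (v \notin T)] :|:
       [set T in H | (v \in T) && (u \notin T)])
      (Y := [set T in H | (u \in T) && (v \in T)]) _) _.
      apply/subsetP => T; rewrite !inE; case: (T \in H) => //=.
      by case: (u \in T); case: (v \in T).
    by rewrite leq_add2r; apply: cardU2.
  by apply: leq_add; apply: cov.
by move: Sa Sb Sc Sd P1le P2le; clear; lia.
Qed.

(** * Families of triples *)

Lemma card_le_cls F T (s : seq {set V}) : (forall C, C \in F -> C :&: T \in s) ->
  #|F| <= \sum_(S <- s) #|cls F T S|.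
Proof.
elim: s F => [|S s IH] F Fs.
  by rewrite big_nil leqn0 cards_eq0; apply/eqP/setP => C; rewrite inE; apply/negP => /Fs.
rewrite big_cons (card_split F (fun C => C :&: T == S)) leq_add2l.
apply: leq_trans (IH [set C in F | C :&: T != S] _) _.
  by move=> C; rewrite inE => /andP[/Fs]; rewrite inE => /orP[->|].
apply: leq_sum => R _; apply/subset_leq_card/subsetP => C.
by rewrite !inE => /andP[/andP[-> _]].
Qed.

(** For [S] inside [A]: the parts outside [A] of the members with trace [S]. *)
Definition tr F A S := [set B in link F S | [disjoint B & A]].

Lemma card_tr F A S : S \subset A -> #|tr F A S| = #|cls F A S|.
Proof.
move=> SA; have -> : cls F A S = over (cls F A S) S.
  apply/setP => C; rewrite !inE; case: (C \in F) => //=.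
  by case: eqP => //= <-; rewrite subsetIl.
rewrite -card_link; apply: eq_card => B; rewrite !inE -!andbA; case: (boolP [disjoint B & S]) => //= dB.
case: (S :|: B \in F) => //=.
rewrite setIUl (setIidPl SA) -setI_eq0; apply/eqP/eqP => [->|E]; first by rewrite setU0.
apply/setP => v; move/setP/(_ v): E; rewrite !inE.
by case: (boolP (v \in B)) => //= vB; rewrite (disjointFr dB vB).
Qed.

Lemma tr_sub F A S : tr F A S \subset link F S.
Proof. exact: setI_filter_sub. Qed.

Lemma tr_sf F A S : sf F -> sf (tr F A S).
Proof. by move=> sfF; apply: sfS (tr_sub F A S) (link_sf _). Qed.

Lemma tr_uniform k F A S : uniform k F -> uniform (k - #|S|) (tr F A S).
Proof. by move=> uF; apply: uniformS (tr_sub F A S) (link_uniform uF). Qed.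

Lemma in_tr F A S B : (B \in tr F A S) = [&& [disjoint B & S], S :|: B \in F & [disjoint B & A]].
Proof. by rewrite !inE andbA. Qed.

(** Disjoint parts [B], [B'] would give the sunflower [A], [S :|: B], [S :|: B'] with core [S]. *)
Lemma tr_intersecting k F A S : sf F -> uniform k F -> A \in F -> S \proper A ->
  intersecting (tr F A S).
Proof.
move=> sfF uF AF SA B B' Bt B't; have SsubA := proper_sub SA.
case: (eqVneq B B') => [<-|BB'].
  have : 0 < #|B| by rewrite (tr_uniform uF Bt) subn_gt0 -(uF _ AF) proper_card.
  by case/card_gt0P => v vB; exists v.
apply/meets/negP => D; move: (Bt) (B't); rewrite !in_tr => /and3P[dS SB dA] /and3P[dS' SB' dA'].
have [a aA aS] : exists2 a, a \in A & a \notin S by case/properP: SA.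
have nA (Z : {set V}) : [disjoint Z & A] -> A != S :|: Z.
  by move=> dX; apply/neqP; exists a; rewrite aA inE (negbTE aS) (disjointFl dX aA).
apply: (sfP sfF AF SB SB' (nA _ dA) (nA _ dA')).
  apply: contraNneq BB' => E; apply/eqP.
  by apply: (link_inj (F := F) (S := S)) E; rewrite in_link ?dS ?dS'.
move=> v; rewrite !inE; case: (boolP (v \in S)) => vS; first by rewrite (subsetP SsubA).
case: (boolP (v \in A)) => vA; first by rewrite (disjointFl dA vA) (disjointFl dA' vA).
by case: (boolP (v \in B)) => vB; rewrite ?(disjointFr D vB) //; case: (v \in B').
Qed.

Lemma card_cls3 F a b c : a != b -> a != c -> b != c -> #|F| <= #|cls F [set a; b; c] set0| +
  (#|cls F [set a; b; c] [set a]| + #|cls F [set a; b; c] [set b]| + #|cls F [set a; b; c] [set c]|) +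
  (#|cls F [set a; b; c] [set a; b]| + #|cls F [set a; b; c] [set a; c]| + #|cls F [set a; b; c] [set b; c]|) +
  #|cls F [set a; b; c] [set a; b; c]|.
Proof.
move=> ab ac bc; set T := [set a; b; c].
apply: leq_trans (card_le_cls (T := T)
  (s := [:: set0; [set a]; [set b]; [set c]; [set a; b]; [set a; c]; [set b; c]; T]) _) _.
  move=> C _; rewrite !inE /T.
  have E S : (forall v, (v \in C) && (v \in T) = (v \in S)) -> C :&: T == S.
    by move=> P; apply/eqP/setP => v; rewrite inE P.
  have M (x y z : bool) : (x, y, z) = (a \in C, b \in C, c \in C) -> forall v,
    (v \in C) && (v \in T) = [|| x && (v == a), y && (v == b) | z && (v == c)].
    move=> [-> -> ->] v; rewrite !inE.
    pointwise v; rewrite ?andbT ?andbF ?orbF //.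
  case aC: (a \in C) M; case bC: (b \in C); case cC: (c \in C) => /(_ _ _ _ erefl) M.
  - by rewrite (E T) ?orbT // => v; rewrite M !inE orbA.
  - by rewrite (E [set a; b]) ?orbT // => v; rewrite M !inE /= ?orbF.
  - by rewrite (E [set a; c]) ?orbT // => v; rewrite M !inE /= ?orbF.
  - by rewrite (E [set a]) ?orbT // => v; rewrite M !inE /= ?orbF.
  - by rewrite (E [set b; c]) ?orbT // => v; rewrite M !inE /= ?orbF.
  - by rewrite (E [set b]) ?orbT // => v; rewrite M !inE /= ?orbF.
  - by rewrite (E [set c]) ?orbT // => v; rewrite M !inE /= ?orbF.
  - by rewrite (E set0) // => v; rewrite M !inE /= ?orbF.
rewrite !big_cons big_nil addn0 !addnA; lia.
Qed.

Lemma cls_full k F A : uniform k F -> A \in F -> #|cls F A A| <= 1.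
Proof.
move=> uF AF; rewrite -(cards1 A); apply/subset_leq_card/subsetP => C.
rewrite !inE => /andP[CF /eqP/setIidPr AC].
by rewrite eq_sym eqEcard AC (uF _ AF) (uF _ CF) leqnn.
Qed.

Lemma mem_cls F A S C : (C \in cls F A S) = (C \in F) && (C :&: A == S).
Proof. by rewrite inE. Qed.

Lemma clsE F A S C v : C \in cls F A S -> v \in A -> (v \in C) = (v \in S).
Proof. by rewrite inE => /andP[_ /eqP<-] vA; rewrite inE vA andbT. Qed.

Lemma triangle_edge a b c e : #|e| = 2 -> (exists2 v, v \in [set a; b] & v \in e) ->
  (exists2 v, v \in [set b; c] & v \in e) -> (exists2 v, v \in [set a; c] & v \in e) ->
  a != b -> a != c -> b != c -> [\/ e = [set a; b], e = [set b; c] | e = [set a; c]].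
Proof.
move=> e2 [u uA ue] [v vB ve] [w wC we] ab ac bc.
have D x y : x \in e -> y \in e -> x != y -> e = [set x; y] by apply: card2E2.
move: uA vB wC ue ve we; rewrite !inE.
case/orP=> /eqP->; case/orP=> /eqP->; case/orP=> /eqP-> ue ve we.
all: try by constructor 1; apply: D.
all: try by constructor 2; apply: D.
all: by constructor 3; apply: D.
Qed.

Lemma cross_triangle G G' : sf G -> uniform 2 G -> intersecting G -> uniform 2 G' -> 2 < #|G| ->
  crossing G G' -> G' \subset G.
Proof.
move=> sfG uG iG uG' G3 cr.
have [a [b [c [ab ac bc E]]]] := graph_intersecting sfG uG iG G3.
apply/subsetP => e eG'; have X e' : e' \in G -> exists2 v, v \in e' & v \in e by move/cr; apply.
have m x y : [set x; y] \in [set [set a; b]; [set b; c]; [set a; c]] -> [set x; y] \in G by rewrite E.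
have [m1 m2 m3] : [/\ [set a; b] \in G, [set b; c] \in G & [set a; c] \in G].
  by split; apply: m; rewrite !inE eqxx ?orbT.
by have [->|->|->] := triangle_edge (uG' _ eG') (X _ m1) (X _ m2) (X _ m3) ab ac bc.
Qed.

Lemma three_graphs_le6_aux G1 G2 G3 : sf G1 -> uniform 2 G1 -> uniform 2 G2 -> uniform 2 G3 ->
  intersecting G1 -> crossing G1 G2 ->
  crossing G1 G3 ->
  (forall e, e \in G1 -> e \in G2 -> e \in G3 -> False) -> 2 < #|G1| -> #|G1| + #|G2| + #|G3| <= 6.
Proof.
move=> sf1 u1 u2 u3 i1 c12 c13 N G1_3.
have S2 := cross_triangle sf1 u1 i1 u2 G1_3 c12.
have S3 := cross_triangle sf1 u1 i1 u3 G1_3 c13.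
have := graph_intersecting_le3 sf1 u1 i1.
have : #|G2| + #|G3| <= #|G1|; last by clear; lia.
rewrite -cardsUI disjoint_setI0 ?cards0 ?addn0; first by apply: subset_leq_card; rewrite subUset S2.
apply/pred0P => e /=; apply/negP => /andP[e2 e3]; exact: N (subsetP S2 _ e2) e2 e3.
Qed.

(** If one graph has three edges, it is a triangle containing the other two; these share no edge, so
    together they add at most three. Otherwise every graph has at most two edges. *)
Lemma three_graphs_le6 G1 G2 G3 : sf G1 -> sf G2 -> sf G3 ->
  uniform 2 G1 -> uniform 2 G2 -> uniform 2 G3 ->
  intersecting G1 -> intersecting G2 -> intersecting G3 ->
  crossing G1 G2 ->
  crossing G1 G3 ->
  crossing G2 G3 ->
  (forall e, e \in G1 -> e \in G2 -> e \in G3 -> False) -> #|G1| + #|G2| + #|G3| <= 6.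
Proof.
move=> sf1 sf2 sf3 u1 u2 u3 i1 i2 i3 c12 c13 c23 N.
have sw G G' : crossing G G' -> crossing G' G.
  by move=> cr e e' eG e'G; have [v] := cr _ _ e'G eG; exists v.
case: (leqP #|G1| 2) => [l1|]; last exact: three_graphs_le6_aux.
case: (leqP #|G2| 2) => [l2|]; last first.
  rewrite [#|G1| + _]addnC; apply: three_graphs_le6_aux => //; first exact: sw.
  by move=> e e2 e1; apply: N.
case: (leqP #|G3| 2) => [l3|]; last first.
  rewrite addnC addnA; apply: three_graphs_le6_aux => //; try exact: sw.
  by move=> e e3 e1 e2; apply: N e3.
by move: l1 l2 l3; clear; lia.
Qed.

Lemma pair_cls_le1 L T u v : sf L -> uniform 3 L -> T \in L -> u != v -> u \in T -> v \in T ->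
  [set u; v] \proper T -> #|cls L T [set u; v]| <= 1.
Proof.
move=> sfL uL TL uv uT vT P; apply: (pair_le1 sfL uL uv TL uT vT) => C Cc.
rewrite (clsE Cc uT) (clsE Cc vT) !inE !eqxx orbT; split=> //; first by move: Cc; rewrite inE => /andP[].
by apply: contraTneq Cc => ->; rewrite inE setIid negb_and; apply/orP; right; rewrite eq_sym (proper_neq P).
Qed.

Lemma tr1P F A a e : e \in tr F A [set a] -> a |: e \in F /\ [disjoint e & A].
Proof. by rewrite in_tr => /and3P[]. Qed.

Lemma intersecting_cross H A a b : intersecting H -> a != b -> a \in A -> b \in A ->
  crossing (tr H A [set a]) (tr H A [set b]).
Proof.
move=> iH ab aA bA e e' /tr1P[eH dA] /tr1P[e'H dA'].
have [v] := iH _ _ eH e'H; rewrite !inE.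
case: (eqVneq v a) => [->|va] /=; first by rewrite (negbTE ab) (disjointFl dA' aA).
move=> ve; case: (eqVneq v b) => [E|_] /=; last by exists v.
by move: ve; rewrite E (disjointFl dA bA).
Qed.

(** The outer parts at two points of [T] cross because the triples meet and cannot do so on [T]. An
    edge common to all three graphs would be a pair lying in three members. *)
Lemma around3 H a b c : sf H -> uniform 3 H -> intersecting H ->
  a != b -> a != c -> b != c -> [set a; b; c] \in H ->
  #|cls H [set a; b; c] [set a]| + #|cls H [set a; b; c] [set b]| + #|cls H [set a; b; c] [set c]| <= 6.
Proof.
move=> sfH uH iH ab ac bc TH; set T := [set a; b; c] in TH *.
have [aT bT cT] : [/\ a \in T, b \in T & c \in T] by rewrite !inE !eqxx !orbT.
rewrite -!card_tr ?sub1set //.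
have pr v : v \in T -> [set v] \proper T.
  by move=> vT; rewrite properEcard sub1set vT cards1 cards3.
have u v : uniform 2 (tr H T [set v]) by move=> e /(tr_uniform uH); rewrite cards1.
apply: three_graphs_le6; try exact: tr_sf; try exact: u;
  try (by apply: tr_intersecting sfH uH TH (pr _ _)); try exact: intersecting_cross.
move=> e ea eb ec.
have [v [w [vw E]]] := card2E (u _ _ ea).
move: ea eb ec => /tr1P[ea D] /tr1P[eb _] /tr1P[ec _].
have n x y : x \in T -> y \in T -> x != y -> x |: e != y |: e.
  by move=> xT yT xy; apply/neqP; exists x; rewrite !inE eqxx (negbTE xy) (disjointFl D xT).
have [v_e w_e] : v \in e /\ w \in e by rewrite E !inE !eqxx orbT.
have m x : (v \in x |: e) && (w \in x |: e) by rewrite !inE v_e w_e !orbT.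
have [[/andP[va wa] /andP[vb wb]] /andP[vc wc]] := (m a, m b, m c).
have [E1|E1] := pair_le0 sfH uH vw ea eb (n _ _ aT bT ab) va wa vb wb ec vc wc.
  by have := n _ _ aT cT ac; rewrite E1 eqxx.
by have := n _ _ bT cT bc; rewrite E1 eqxx.
Qed.

Lemma intersecting_le10_aux H a b c : sf H -> uniform 3 H -> intersecting H ->
  a != b -> a != c -> b != c -> [set a; b; c] \in H ->
  #|H| <= 1 + (#|cls H [set a; b; c] [set a]| + #|cls H [set a; b; c] [set b]| + #|cls H [set a; b; c] [set c]|) +
  (#|cls H [set a; b; c] [set a; b]| + #|cls H [set a; b; c] [set a; c]| + #|cls H [set a; b; c] [set b; c]|) /\
  [/\ #|cls H [set a; b; c] [set a; b]| <= 1, #|cls H [set a; b; c] [set a; c]| <= 1 &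
    #|cls H [set a; b; c] [set b; c]| <= 1].
Proof.
move=> sfH uH iH ab ac bc TH; have := card_cls3 H ab ac bc.
set T := [set a; b; c] in TH *.
have [aT bT cT] : [/\ a \in T, b \in T & c \in T] by rewrite !inE !eqxx !orbT.
have := cls_full uH TH.
have -> : #|cls H T set0| = 0.
  apply/eqP; rewrite cards_eq0; apply/eqP/setP => C; rewrite !inE; apply/negP => /andP[CH /eqP E].
  have [v vC vT] := iH _ _ CH TH; have: v \in C :&: T by rewrite inE vC.
  by rewrite E inE.
have pr u v : u \in T -> v \in T -> [set u; v] \proper T.
  by move=> uT vT; rewrite properEcard sub2 uT vT cards3 // cards2; case: (_ != _).
move=> f1 f2; split; first by move: f1 f2; clear; lia.
by split; apply: pair_cls_le1; rewrite ?pr.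
Qed.

(** Sorted by the trace on one member, the count is 1 for the member itself, 6 for single points by
    [around3] and 3 for the pairs. *)
Lemma intersecting_le10 H : sf H -> uniform 3 H -> intersecting H -> #|H| <= 10.
Proof.
move=> sfH uH iH; case: (set_0Vmem H) => [->|[T TH]]; first by rewrite cards0.
have [a [b [c [ab ac bc E]]]] := card3E (uH _ TH); rewrite E in TH.
have := around3 sfH uH iH ab ac bc TH.
have [f1 [f2 f3 f4]] := intersecting_le10_aux sfH uH iH ab ac bc TH.
by move: f1 f2 f3 f4; clear; lia.
Qed.

(* The graph has a vertex cover of size two, as in Konig's theorem. *)
Lemma bipartite_le4 G T : sf G -> uniform 2 G -> (forall e, e \in G -> #|e :&: T| = 1) -> #|G| <= 4.
Proof.
move=> sfG uG bG; pose E p q := [&& p \in T, q \notin T & [set p; q] \in G].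
have ends e : e \in G -> exists p q, E p q /\ e = [set p; q].
  move=> eG; have /eqP/cards1P[p Ep] := bG _ eG.
  have : p \in e :&: T by rewrite Ep set11.
  rewrite inE => /andP[pe pT]; have [q [pq e_pq]] := card2E1 (uG _ eG) pe.
  exists p, q; split=> //; rewrite /E pT -e_pq eG andbT; apply/negP => qT.
  have : q \in e :&: T by rewrite inE qT e_pq !inE eqxx orbT.
  by rewrite Ep inE eq_sym (negbTE pq).
have cover u v : (forall e, e \in G -> (u \in e) || (v \in e)) -> #|G| <= 4.
  move=> /card_cover2/leq_trans; apply.
  by apply: (@leq_add _ _ 2 2); apply: graph_star.
have D p q r s : E p q -> E r s -> p != r -> q != s -> [disjoint [set p; q] & [set r; s]].
  move=> /and3P[pT qT _] /and3P[rT sT _] pr qs; rewrite disjoints_subset sub2 !inE !negb_or pr qs andbT /=.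
  by apply/andP; split; [apply: contraNneq sT => <-|apply: contraNneq qT => ->].
have M p q r s u v : E p q -> E r s -> E u v -> p != r -> p != u -> r != u -> q != s -> q != v -> s != v -> False.
  move=> e1 e2 e3 pr pu ru qs qv sv; have [/and3P[_ _ G1] /and3P[_ _ G2] /and3P[_ _ G3]] := And3 e1 e2 e3.
  by apply: (no_matching3 sfG uG G1 G2 G3); apply: D.
have uncovered u v : #|G| <= 4 \/ exists p q, [/\ E p q, u != p, u != q, v != p & v != q].
  case: (boolP [forall e in G, (u \in e) || (v \in e)]) => [/forall_inP/cover|]; first by left.
  rewrite negb_forall_in => /exists_inP[e /ends[p [q [Epq ->]]]].
  by rewrite !inE !negb_or => /andP[/andP[up uq] /andP[vp vq]]; right; exists p, q.
(* An edge missed by the cover [{b, d}] must start at [a], or it extends [ab] and one of [cd], [pd]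
   to a matching. With this second edge at [a], an edge missed by the cover [{a, d}] always
   completes a matching of three. *)
have main a b c d p : E a b -> E c d -> E p d -> a != c -> b != d -> a != p -> c != p -> #|G| <= 4.
  move=> ab cd pd ac bd ap cp; case: (uncovered b d) => [//|[a' [q [a'q _ bq _ dq]]]].
  have [ca db] : c != a /\ d != b by rewrite !(eq_sym _ a) !(eq_sym _ b).
  have Ea : a = a'.
    apply/eqP/negPn/negP => aa'; case: (eqVneq c a') => [E'|ca']; last exact: (M _ _ _ _ _ _ ab cd a'q).
    by rewrite -E' in a'q; apply: (M _ _ _ _ _ _ ab pd a'q); rewrite // eq_sym.
  rewrite -Ea in a'q; case: (uncovered a d) => [//|[r [s [rs ar _ _ ds]]]]; exfalso.
  case: (eqVneq c r) => [E'|cr]; case: (eqVneq b s) => [E''|bs]; rewrite -?E' -?E'' in rs.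
  - by apply: (M _ _ _ _ _ _ a'q pd rs); rewrite // eq_sym.
  - by apply: (M _ _ _ _ _ _ ab pd rs); rewrite // eq_sym.
  - by apply: (M _ _ _ _ _ _ a'q cd rs); rewrite // eq_sym.
  - exact: (M _ _ _ _ _ _ ab cd rs).
case: (set_0Vmem G) => [->|[e /ends[a [b [ab _]]]]]; first by rewrite cards0.
case: (uncovered a b) => [//|[c [d [cd ac _ _ bd]]]].
case: (uncovered a c) => [//|[p [q [pq ap _ cp _]]]].
case: (eqVneq b q) => [E'|bq]; first by rewrite -E' in pq; apply: (main c d a b p); rewrite // eq_sym.
case: (eqVneq d q) => [E'|dq]; first by rewrite -E' in pq; apply: (main a b c d p).
by case: (M _ _ _ _ _ _ ab cd pq).
Qed.

Lemma cls_disjoint F A S S' : S != S' -> [disjoint cls F A S & cls F A S'].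
Proof.
move=> SS'; apply/pred0P => C /=; apply/negP; rewrite !inE => /andP[/andP[_ /eqP->] /andP[_]].
by rewrite (negbTE SS').
Qed.

Lemma clsD F A S C : C \in cls F A S -> C :\: A \in tr F A S.
Proof.
rewrite inE => /andP[CF /eqP E]; rewrite in_tr -E setID CF /=.
apply/andP; split; apply/pred0P => v /=; rewrite !inE;
  by case: (v \in A); rewrite /= ?andbF.
Qed.

Lemma star_or_triangle G : uniform 2 G -> intersecting G -> G != set0 ->
  (exists w, forall e, e \in G -> w \in e) \/
  exists a b c, [/\ a != b, a != c, b != c & G = [set [set a; b]; [set b; c]; [set a; c]]].
Proof.
move=> uG iG /set0Pn[e1 e1G].
have [a [b [ab E1]]] := card2E (uG _ e1G).
have nall v : (forall e, e \in G -> v \in e) \/ exists2 e, e \in G & v \notin e.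
  case: (set_0Vmem [set e in G | v \notin e]) => [E|[e]]; last by rewrite inE => /andP[]; right; exists e.
  by left=> e eG; move/setP/(_ e): E; rewrite !inE eG /= => /negbFE.
case: (nall a) => [|[e2 e2G ae2]]; first by left; exists a.
case: (nall b) => [|[e3 e3G be3]]; first by left; exists b.
have be2 : b \in e2.
  by have [v] := iG _ _ e1G e2G; rewrite E1 !inE => /orP[]/eqP->; rewrite ?(negbTE ae2).
have ae3 : a \in e3.
  by have [v] := iG _ _ e1G e3G; rewrite E1 !inE => /orP[]/eqP->; rewrite ?(negbTE be3).
have [c [bc E2]] := card2E1 (uG _ e2G) be2.
have ac : a != c by apply: contraNneq ae2 => ->; rewrite E2 !inE eqxx orbT.
have ce3 : c \in e3.
  by have [v] := iG _ _ e2G e3G; rewrite E2 !inE => /orP[]/eqP->; rewrite ?(negbTE be3).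
have E3 := card2E2 (uG _ e3G) ae3 ce3 ac.
right; exists a, b, c; split=> //; apply/eqP; rewrite eqEsubset -E1 -E2 -E3; apply/andP; split; last first.
  by apply/subsetP => e; rewrite !inE -orbA => /or3P[]/eqP->.
apply/subsetP => e eG; rewrite E1 in e1G; rewrite E2 in e2G; rewrite E3 in e3G.
have := triangle_edge (uG _ eG) (iG _ _ e1G eG) (iG _ _ e2G eG) (iG _ _ e3G eG) ab ac bc.
by rewrite E1 E2 E3 !inE => -[]->; rewrite eqxx ?orbT.
Qed.

(** Fix a member [T]. The outer parts of the members meeting [T] in one point form an intersecting
    graph. A star leaves too few members, so it is a triangle, and its corners together with [T]
    carry everything. *)
Lemma intersecting_ge9_support H : sf H -> uniform 3 H -> intersecting H -> 9 <= #|H| ->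
  exists2 W : {set V}, #|W| = 6 & forall T, T \in H -> T \subset W.
Proof.
move=> sfH uH iH H9.
have [T TH] : exists T : {set V}, T \in H by apply/set0Pn; rewrite -card_gt0; apply: leq_trans H9.
have T3 := uH _ TH; have [a [b [c [ab ac bc ET]]]] := card3E T3.
have [aT bT cT] : [/\ a \in T, b \in T & c \in T] by rewrite ET !inE !eqxx !orbT.
have TH' := TH; rewrite ET in TH'.
have E6 := around3 sfH uH iH ab ac bc TH'.
have [H10 [pab pac pbc]] := intersecting_le10_aux sfH uH iH ab ac bc TH'.
rewrite -ET in E6 H10 pab pac pbc.
rewrite -!(card_tr H (S := [set _])) ?sub1set // in E6 H10.
have pr v : v \in T -> [set v] \proper T.
  by move=> vT; rewrite properEcard sub1set vT cards1 T3.
have u v : uniform 2 (tr H T [set v]) by move=> e /(tr_uniform uH); rewrite cards1.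
have iv v : v \in T -> intersecting (tr H T [set v]) by move=> vT; apply: tr_intersecting sfH uH TH (pr _ _).
have e3 v : v \in T -> #|tr H T [set v]| <= 3.
  by move=> vT; apply: graph_intersecting_le3; [exact: tr_sf|exact: u|exact: iv].
set U := tr H T [set a] :|: tr H T [set b] :|: tr H T [set c].
have UP e : e \in U -> exists2 v, v \in T & e \in tr H T [set v].
  by rewrite !in_setU => /orP[/orP[]|] ev; [exists a|exists b|exists c].
have uU : uniform 2 U by move=> e /UP[v _]; apply: u.
have iU : intersecting U.
  move=> e f /UP[v vT ev] /UP[w wT fw]; case: (eqVneq v w) => [E|vw].
    by rewrite -E in fw; apply: iv fw.
  exact: intersecting_cross iH vw vT wT _ _ ev fw.
have U0 : U != set0.
  apply: contraTneq H10 => E; have z v : v \in [set a; b; c] -> #|tr H T [set v]| = 0.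
    move=> vabc; apply/eqP; rewrite cards_eq0 -subset0 -E.
    by move: vabc; rewrite !inE -orbA => /or3P[]/eqP->; apply/subsetP => e ev; rewrite !in_setU ev ?orbT //.
  rewrite !z ?inE ?eqxx ?orbT // -ltnNge; move: H9 pab pac pbc; clear; lia.
have Ule v : v \in T -> tr H T [set v] \subset U.
  rewrite ET !inE -orbA -ET => /or3P[]/eqP->; apply/subsetP => e ev; rewrite !in_setU ev ?orbT //.
have [[w wU]|[x [y [z [xy xz yz EU]]]]] := star_or_triangle uU iU U0.
  (* In the star case these edges with one end in [T] form a bipartite graph, so at most 4 members
     meet [T] in one point and [H] has at most 1 + 4 + 3 members. *)
  exfalso; pose G := [set e in link H [set w] | #|e :&: T| == 1].
  have sfG : sf G by apply: (sfS _ (link_sf sfH)); apply: setI_filter_sub.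
  have uG : uniform 2 G by move=> e; rewrite inE => /andP[/(link_uniform uH)]; rewrite cards1.
  have G4 : #|G| <= 4 by apply: (bipartite_le4 sfG uG (T := T)) => e; rewrite inE => /andP[_ /eqP].
  pose X := cls H T [set a] :|: (cls H T [set b] :|: cls H T [set c]).
  have XP C : C \in X -> exists2 v, v \in T & C \in cls H T [set v].
    by rewrite !in_setU => /or3P[] Cc; [exists a|exists b|exists c].
  have wT : w \notin T.
    have /set0Pn[e eU] := U0; have [v vT /tr1P[_ D]] := UP _ eU.
    by rewrite (disjointFr D (wU _ eU)).
  have wX C : C \in X -> w \in C.
    move=> /XP[v vT /clsD Ct]; have := wU _ (subsetP (Ule v vT) _ Ct).
    by rewrite inE => /andP[].
  have cX : #|X| = #|tr H T [set a]| + #|tr H T [set b]| + #|tr H T [set c]|.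
    rewrite !card_tr ?sub1set // /X !cardsU.
    have n p q : p != q -> cls H T [set p] :&: cls H T [set q] = set0.
      move=> pq; apply: disjoint_setI0; apply: cls_disjoint; apply/neqP; exists p.
      by rewrite !inE eqxx (negbTE pq).
    by rewrite setIUr !n // set0U cards0 !subn0 addnA.
  have : #|X| <= #|G|.
    have -> : X = over X [set w].
      by apply/setP => C; rewrite mem_over sub1set; case CX: (C \in X) => //=; rewrite wX.
    rewrite -card_link; apply/subset_leq_card/subsetP => e; rewrite in_link => /andP[D].
    move=> /XP[v vT]; rewrite mem_cls => /andP[eH /eqP E]; rewrite inE in_link D eH /=.
    suff -> : e :&: T = [set v] by rewrite cards1.
    rewrite -E setIUl (_ : [set w] :&: T = set0) ?set0U //.
    by apply/setP => r; rewrite !inE; case: eqP => [->|//]; rewrite (negbTE wT).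
  by rewrite cX; move: H10 H9 G4 pab pac pbc; clear; lia.
set t := [set x; y; z].
have Ut e : e \in U -> e \subset t.
  by rewrite EU !inE -orbA => /or3P[]/eqP->; apply/subsetP => r; rewrite !inE => /orP[]->; rewrite ?orbT.
have tT : [disjoint t & T].
  have m r : r \in t -> exists2 e, e \in U & r \in e.
    rewrite EU !inE -orbA => /or3P[]/eqP->.
    - by exists [set x; y]; rewrite !inE eqxx.
    - by exists [set x; y]; rewrite !inE eqxx ?orbT.
    - by exists [set y; z]; rewrite !inE eqxx ?orbT.
  apply/pred0P => r /=; apply/negP => /andP[/m[e /UP[v _ /tr1P[_ D]] re]].
  by rewrite (disjointFr D re).
(* The third point [s] of a member over [{q, r}] is the only place where it can meet the members
   with trace [{p}]. Hence [s] lies on all their outer edges, which is impossible for three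
   edges. *)
have third p q r C : T = [set p; q; r] -> p != q -> p != r -> q != r -> C \in cls H T [set q; r] ->
    exists s, [/\ s \notin T, C = [set q; r; s] & forall e, e \in tr H T [set p] -> s \in e].
  move=> Tpqr pq pr_ qr Cc; have [pT qT rT] : [/\ p \in T, q \in T & r \in T] by rewrite Tpqr !inE !eqxx !orbT.
  have CH : C \in H by move: Cc; rewrite inE => /andP[].
  have pC : p \notin C by rewrite (clsE Cc pT) !inE negb_or pq pr_.
  have qC : q \in C by rewrite (clsE Cc qT) !inE eqxx.
  have rC : r \in C by rewrite (clsE Cc rT) !inE eqxx orbT.
  have [s [qs rs EC]] := card3E2 (uH _ CH) qC rC qr.
  have sC : s \in C by rewrite EC !inE eqxx orbT.
  have sT : s \notin T.
    by apply/negP => sT; move: sC; rewrite (clsE Cc sT) !inE ![s == _]eq_sym (negbTE qs) (negbTE rs).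
  exists s; split=> // e /tr1P[eH D].
  have [v] := iH _ _ eH CH; rewrite EC !inE => /orP[/eqP->|ve].
    by rewrite (negbTE pq) (negbTE pr_) /= => /eqP ps; rewrite -ps pT in sT.
  rewrite -orbA => /or3P[]/eqP E; move: ve; rewrite E //.
    by rewrite (disjointFl D qT).
  by rewrite (disjointFl D rT).
have Pz p q r : T = [set p; q; r] -> p != q -> p != r -> q != r -> 2 < #|tr H T [set p]| ->
    #|cls H T [set q; r]| = 0.
  move=> Tpqr pq pr_ qr E3; apply/eqP; rewrite cards_eq0; apply/eqP/setP => C; rewrite [RHS]inE.
  apply/negP => Cc; have [s [_ _ sE]] := third p q r C Tpqr pq pr_ qr Cc.
  have := graph_star s (tr_sf sfH) (u p); rewrite leqNgt => /negP; apply.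
  by apply: leq_trans E3 _; apply/subset_leq_card/subsetP => e ev; rewrite inE ev sE.
have T2 : T = [set b; a; c] by rewrite ET set3C.
have T4 : T = [set c; a; b] by rewrite ET set3AC set3C.
have [ba ca cb] : [/\ b != a, c != a & c != b] by rewrite (eq_sym b) (eq_sym c) (eq_sym c).
have na := Pz _ _ _ ET ab ac bc; have nb := Pz _ _ _ T2 ba bc ac; have nc := Pz _ _ _ T4 ca cb ab.
(* With one graph empty, each graph of three edges suppresses the class of a pair, so at most 8
   members would remain. *)
have [Ea [Eb Ec]] : 0 < #|tr H T [set a]| /\ 0 < #|tr H T [set b]| /\ 0 < #|tr H T [set c]|.
  move: (e3 _ aT) (e3 _ bT) (e3 _ cT) na nb nc H10 H9 pab pac pbc E6; clear; lia.
have pairW p q r C : T = [set p; q; r] -> p != q -> p != r -> q != r -> 0 < #|tr H T [set p]| ->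
    C \in cls H T [set q; r] -> C \subset T :|: t.
  move=> Tpqr pq pr_ qr /card_gt0P[e ep] Cc; have [s [_ -> sE]] := third p q r C Tpqr pq pr_ qr Cc.
  have pT : p \in T by rewrite Tpqr !inE eqxx.
  rewrite sub3 !in_setU Tpqr !inE !eqxx ?orbT /= .
  by have /subsetP/(_ _ (sE _ ep)) := Ut _ (subsetP (Ule _ pT) _ ep); rewrite !inE => ->; rewrite orbT.
exists (T :|: t) => [|C CH].
  by rewrite cardsU setIC (disjoint_setI0 tT) cards0 T3 cards3.
have sing v : v \in T -> C \in cls H T [set v] -> C \subset T :|: t.
  move=> vT Cc; have := Ut _ (subsetP (Ule _ vT) _ (clsD Cc)) => /subsetP Ct.
  apply/subsetP => r rC; rewrite inE; case: (boolP (r \in T)) => //= rT.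
  by apply: Ct; rewrite inE rT.
have inC S : C :&: T = S -> C \in cls H T S by move=> E; rewrite mem_cls CH E eqxx.
have E0 p : p \in T -> 0 < #|tr H T [set p]| by rewrite {1}ET !inE -orbA => /or3P[]/eqP->.
have := subset_leq_card (subsetIr C T); rewrite T3 leq_eqVlt => /orP[C3|].
  have CT : C :&: T = T by apply/eqP; rewrite eqEcard subsetIr T3 (eqP C3).
  apply: subset_trans (subsetUl _ _); apply/setIidPl/eqP.
  by rewrite eqEcard subsetIl CT T3 uH.
have [v vC vT] := iH _ _ CH TH; have : 0 < #|C :&: T| by apply/card_gt0P; exists v; rewrite inE vC.
case cI: #|C :&: T| => [|[|[|n]]] // _ _.
  have /cards1P[w E] : #|C :&: T| == 1 by rewrite cI.
  by apply: (sing w); [move: (set11 w); rewrite -E inE => /andP[]|apply: inC].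
have [q [r [qr E]]] := card2E cI.
have [/setIP[_ qT] /setIP[_ rT]] : q \in C :&: T /\ r \in C :&: T by rewrite E !inE !eqxx orbT.
have [p [qp rp Tqrp]] := card3E2 T3 qT rT qr.
have pT : p \in T by rewrite Tqrp !inE eqxx orbT.
apply: (pairW p q r C) (E0 _ pT) (inC _ E); rewrite // 1?eq_sym //.
by rewrite Tqrp set3AC set3C.
Qed.

(** * Two triangles of edges against an intersecting triple system *)

Lemma cover_sum (I : finType) F (K : {pred I}) (r : I -> pred {set V}) :
  (forall A, A \in F -> exists2 i, i \in K & r i A) -> #|F| <= \sum_(i in K) #|[set A in F | r i A]|.
Proof.
move=> hit; rewrite -sum1_card.
under [X in _ <= X]eq_bigr => v _ do rewrite -sum1_card.
rewrite (exchange_big_dep (fun A => A \in F)) /=; last by move=> v A _; rewrite inE => /andP[].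
apply: leq_sum => A AF; have [i iK riA] := hit A AF.
by rewrite (bigD1 i) //= inE AF riA iK.
Qed.

Lemma card_setU_le X Y : #|X :|: Y| <= #|X| + #|Y|.
Proof. exact: cardU2. Qed.

(** The conclusion of [sf] for three given sets, which may mix edges and triples. *)
Definition split3 A B C := exists v, (v \in A) + (v \in B) + (v \in C) = 2.

(** If [e] lies in both [T] and [T'], a point in exactly two of the three sets is the third point of
    both triples, so they coincide. *)
Lemma over_le1_split H e : uniform 3 H -> #|e| = 2 ->
  (forall T T', T \in H -> T' \in H -> T != T' -> split3 e T T') -> #|over H e| <= 1.
Proof.
move=> uH e2 s; rewrite leqNgt; apply/card_gt1P => -[T [T' [To T'o TT']]].
move: To T'o; rewrite !inE => /andP[TH eT] /andP[T'H eT'].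
have [v] := s _ _ TH T'H TT'; case ve: (v \in e).
  by rewrite (subsetP eT _ ve) (subsetP eT' _ ve).
case vT: (v \in T); case vT': (v \in T') => // _.
have c R : R \in H -> #|R| = #|e|.+1 by move=> RH; rewrite e2 uH.
by move: TT'; rewrite (over_eq (c _ TH) (c _ T'H) eT eT' (negbT ve) vT vT') eqxx.
Qed.

Lemma star_split H e a (P : pred {set V}) : sf H -> uniform 3 H -> a \in e ->
  (forall T, T \in H -> P T -> a \in T) ->
  (forall T v, T \in H -> P T -> v \in e -> v != a -> v \notin T) ->
  (forall T T', T \in H -> T' \in H -> T != T' -> split3 e T T') ->
  forall T T', T \in [set T in H | P T] -> T' \in [set T in H | P T] -> T != T' ->
  exists2 u, u != a & (u \in T) && (u \in T').
Proof.
move=> sfH uH ae aP eP s T T'; rewrite !inE => /andP[TH PT] /andP[T'H PT'] TT'.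
have [v] := s _ _ TH T'H TT'; case: (eqVneq v a) => [->|va]; first by rewrite ae !aP.
case ve: (v \in e); first by rewrite (negbTE (eP _ _ TH PT ve va)) (negbTE (eP _ _ T'H PT' ve va)).
by case vT: (v \in T); case vT': (v \in T') => // _; exists v; rewrite // vT vT'.
Qed.

Definition tri G (t : {set V}) := forall u v, u \in t -> v \in t -> u != v -> [set u; v] \in G.

Lemma tri_D1 G (t : {set V}) u : tri G t -> #|t| = 3 -> u \in t -> t :\ u \in G.
Proof.
move=> T t3 ut; have t2 : #|t :\ u| = 2 by have := cardsD1 u t; rewrite ut t3; clear; lia.
have [a [b [ab E]]] := card2E t2.
have sub v : v \in [set a; b] -> v \in t by rewrite -E => /setD1P[].
by rewrite E; apply: T; rewrite // sub // !inE eqxx ?orbT.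
Qed.

Lemma subD1_or_miss (t : {set V}) S : t != set0 ->
  (exists2 u, u \in t & t :\ u \subset S) \/
  exists u v, [/\ u \in t, v \in t, u != v & (u \notin S) && (v \notin S)].
Proof.
move=> /set0Pn[w wt]; case: (boolP (t \subset S)) => [tS|/subsetPn[u ut uS]].
  by left; exists w => //; apply: subset_trans (subD1set _ _) tS.
case: (boolP (t :\ u \subset S)) => [|/subsetPn[v /setD1P[vu vt] vS]]; first by left; exists u.
by right; exists u, v; rewrite eq_sym uS vS.
Qed.

Section TwoTriangles.

(** The graphs stand for the outer parts of the triples meeting a fixed triple [Q] in one of its
    three points, and [H] for the triples disjoint from [Q]. In each combination below no point of
    [Q] lies in exactly two of the traces, so [sf] survives off [Q] as [split3]. *)
Variables H G1 G2 G3 : {set {set V}}.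
Hypotheses (sfH : sf H) (uH : uniform 3 H) (iH : intersecting H).
Hypotheses (u1 : uniform 2 G1) (u2 : uniform 2 G2) (u3 : uniform 2 G3).
Hypothesis i3 : intersecting G3.
Hypothesis s12 : forall e f T, e \in G1 -> f \in G2 -> T \in H -> split3 e f T.
Hypothesis s13 : forall e f T, e \in G1 -> f \in G3 -> T \in H -> split3 e f T.
Hypothesis s123 : forall e f g, e \in G1 -> f \in G2 -> g \in G3 -> split3 e f g.
Hypothesis s1 : forall e T T', e \in G1 -> T \in H -> T' \in H -> T != T' -> split3 e T T'.
Hypothesis s2 : forall e T T', e \in G2 -> T \in H -> T' \in H -> T != T' -> split3 e T T'.
Hypothesis s3 : forall e T T', e \in G3 -> T \in H -> T' \in H -> T != T' -> split3 e T T'.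

Let o1 e : e \in G1 -> #|over H e| <= 1.
Proof. by move=> eG; apply: over_le1_split (u1 eG) _ => // T T'; apply: s1. Qed.
Let o2 e : e \in G2 -> #|over H e| <= 1.
Proof. by move=> eG; apply: over_le1_split (u2 eG) _ => // T T'; apply: s2. Qed.
Let o3 e : e \in G3 -> #|over H e| <= 1.
Proof. by move=> eG; apply: over_le1_split (u3 eG) _ => // T T'; apply: s3. Qed.

Let star3 G e a (P : pred {set V}) : 
  (forall e T T', e \in G -> T \in H -> T' \in H -> T != T' -> split3 e T T') -> e \in G -> a \in e ->
  (forall T, T \in H -> P T -> a \in T) ->
  (forall T v, T \in H -> P T -> v \in e -> v != a -> v \notin T) -> #|[set T in H | P T]| <= 3.
Proof.
move=> s eG ae aP eP; apply: (star_le3 (a := a)).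
- exact: sf_filter sfH.
- exact: uniform_filter uH.
- by move=> T; rewrite inE => /andP[]; apply: aP.
- by apply: star_split sfH uH ae aP eP _ => T T'; apply: s.
Qed.

(** A set split by all pairs of sides of the common triangle avoids the triangle. So [H] and [G3]
    avoid it, and splitting against one fixed side makes every edge of [G3] meet every member of
    [H]. *)
Lemma same_triangle x y z : x != y -> x != z -> y != z ->
  tri G1 [set x; y; z] -> tri G2 [set x; y; z] -> 1 < #|G3| -> #|H| <= 7.
Proof.
move=> xy xz yz t1 t2 G3_1.
have N S p a b : p \in [set x; y; z] -> a \in [set x; y; z] -> b \in [set x; y; z] ->
  p != a -> p != b -> a != b -> (forall e f, e \in G1 -> f \in G2 -> split3 e f S) -> p \notin S.
  move=> pt a_t b_t pa pb ab s; apply/negP => pS.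
  have full u : u \in [set x; y; z] -> p != u -> u \notin S.
    move=> ut pu; have [v] := s _ _ (t1 _ _ pt ut pu) (t2 _ _ pt ut pu).
    by move/eqP; apply: contraTN => uS; pointwise v; case: (v \in S).
  have aS := full _ a_t pa; have bS := full _ b_t pb.
  have [v /eqP] := s _ _ (t1 _ _ pt a_t pa) (t2 _ _ pt b_t pb).
  by apply/negP; pointwise v; case: (v \in S).
have xyz S : (forall e f, e \in G1 -> f \in G2 -> split3 e f S) -> forall v, v \in [set x; y; z] -> v \notin S.
  move=> s v; rewrite !inE -orbA => /or3P[]/eqP->.
  - by apply: (N S x y z); rewrite ?inE ?eqxx ?orbT.
  - by apply: (N S y x z); rewrite ?inE ?eqxx ?orbT // eq_sym.
  - by apply: (N S z x y); rewrite ?inE ?eqxx ?orbT // eq_sym.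
have HT T : T \in H -> forall v, v \in [set x; y; z] -> v \notin T.
  by move=> TH; apply: xyz => e f eG fG; apply: s12.
have GT g : g \in G3 -> forall v, v \in [set x; y; z] -> v \notin g.
  by move=> gG; apply: xyz => e f eG fG; apply: s123.
have hit g T : g \in G3 -> T \in H -> exists2 v, v \in g & v \in T.
  move=> gG TH; have [xt yt] : x \in [set x; y; z] /\ y \in [set x; y; z] by rewrite !inE !eqxx orbT.
  have [v] := s13 (t1 _ _ xt yt xy) gG TH.
  have [xT yT] := (HT _ TH _ xt, HT _ TH _ yt); have [xg yg] := (GT _ gG _ xt, GT _ gG _ yt).
  rewrite !inE; case: (eqVneq v x) => [->|_]; first by rewrite (negbTE xT) (negbTE xg).
  case: (eqVneq v y) => [->|_]; first by rewrite (negbTE yT) (negbTE yg) orbT.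
  by case vg: (v \in g); case vT: (v \in T) => // _; exists v.
have /card_gt1P[g1 [g2 [g1G g2G g12]]] := G3_1.
have [u ug1 ug2] := i3 g1G g2G.
have [w [uw E1]] := card2E1 (u3 g1G) ug1; have [w' [uw' E2]] := card2E1 (u3 g2G) ug2.
have ww' : w != w' by apply: contraNneq g12 => ww'; rewrite E1 E2 ww'.
rewrite E1 in g1G; rewrite E2 in g2G.
(* Members of [H] hit [uw] and [uw'], so they contain [u] or both [w] and [w']: 3 through [u] alone,
   1 + 1 over the two edges, 2 over [{w, w'}]. *)
have S3 : #|[set T in H | [&& u \in T, w \notin T & w' \notin T]]| <= 3.
  apply: (star3 s3 g1G (a := u)); rewrite ?inE ?eqxx //.
    by move=> T _ /and3P[].
  by move=> T v _ /and3P[_ wT _]; rewrite !inE => /orP[]/eqP->; rewrite ?eqxx.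
have := o3 g1G; have := o3 g2G.
have : #|over H [set w; w']| <= 2 by apply: over_le2 sfH uH _; rewrite cards2 ww'.
have : #|H| <= #|[set T in H | [&& u \in T, w \notin T & w' \notin T]]| + (#|over H [set u; w]| +
   (#|over H [set u; w']| + #|over H [set w; w']|)).
  apply: leq_trans (cardU2 (X := [set T in H | [&& u \in T, w \notin T & w' \notin T]])
    (Y := over H [set u; w] :|: (over H [set u; w'] :|: over H [set w; w'])) _) _.
    apply/subsetP => T TH; rewrite !inE TH !sub2 /=.
    have [v] := hit _ _ g1G TH; have [v'] := hit _ _ g2G TH; rewrite !inE.
    case uT: (u \in T); case wT: (w \in T); case w'T: (w' \in T) => //=.
    - by case/orP=> /eqP->; rewrite ?uT ?w'T.
    - by move=> _ _; case/orP=> /eqP->; rewrite ?uT ?wT.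
    - by case/orP=> /eqP->; rewrite ?uT ?w'T.
  by rewrite leq_add2l; apply: leq_trans (card_setU_le _ _) _; rewrite leq_add2l; apply: cardU2.
by move: S3; clear; lia.
Qed.

(** Splitting against suitable sides shows that no member contains both [p] and [q], that a member
    containing one of them contains [a] and [b], and that every member contains [a] or [b]. *)
Lemma triangles_share2 p q a b : p != q -> p != a -> q != a -> p != b -> q != b -> a != b ->
  tri G1 [set p; q; a] -> tri G2 [set p; q; b] -> #|H| <= 6.
Proof.
move=> pq pa qa pb qb ab t1 t2.
have [pq1 pa1 qa1] : [/\ [set p; q] \in G1, [set p; a] \in G1 & [set q; a] \in G1].
  by split; apply: t1; rewrite ?inE ?eqxx ?orbT.
have [pq2 pb2 qb2] : [/\ [set p; q] \in G2, [set p; b] \in G2 & [set q; b] \in G2].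
  by split; apply: t2; rewrite ?inE ?eqxx ?orbT.
have npq T : T \in H -> ~~ ((p \in T) && (q \in T)).
  move=> TH; apply/negP => /andP[pT qT]; have [v /eqP] := s12 pq1 pq2 TH.
  by apply/negP; pointwise v; case: (v \in T).
have pab T : T \in H -> p \in T -> (a \in T) && (b \in T).
  move=> TH pT; have := npq _ TH; rewrite pT /= => qT; apply/andP; split; apply: contraT => nT; exfalso.
    have [v /eqP] := s12 pa1 pq2 TH.
    by apply/negP; pointwise v; case: (v \in T).
  have [v /eqP] := s12 pq1 pb2 TH.
  by apply/negP; pointwise v; case: (v \in T).
have qab T : T \in H -> q \in T -> (a \in T) && (b \in T).
  move=> TH qT; have := npq _ TH; rewrite qT andbT => pT; apply/andP; split; apply: contraT => nT; exfalso.
    have [v /eqP] := s12 qa1 pq2 TH.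
    by apply/negP; pointwise v; case: (v \in T).
  have [v /eqP] := s12 pq1 qb2 TH.
  by apply/negP; pointwise v; case: (v \in T).
have aob T : T \in H -> (a \in T) || (b \in T).
  move=> TH; apply: contraT; rewrite negb_or => /andP[aT bT].
  have pT : p \notin T by apply/negP => /(pab _ TH); rewrite (negbTE aT).
  have qT : q \notin T by apply/negP => /(qab _ TH); rewrite (negbTE aT).
  exfalso; have [v /eqP] := s12 pa1 qb2 TH.
  by apply/negP; pointwise v; case: (v \in T).
(* Once [{r, a, b}] is a member, splitting it against [sa] and [sb] forces both [a] and [b] into
   every member, and a pair lies in at most two. Without such members the stars at [a] and at [b]
   have at most 3 members each. *)
have all_ab T0 r s : T0 \in H -> (r = p /\ s = q) \/ (r = q /\ s = p) -> r \in T0 -> #|H| <= 6.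
  move=> T0H rs rT0.
  have [sa1 sb2] : [set s; a] \in G1 /\ [set s; b] \in G2 by case: rs => -[_ ->].
  have T0ab : (a \in T0) && (b \in T0) by case: rs rT0 => -[-> _]; [apply: pab|apply: qab].
  have [ra rb rs_] : [/\ r != a, r != b & r != s] by case: rs => -[-> ->]; split=> //; rewrite eq_sym.
  have [sa sb] : s != a /\ s != b by case: rs => -[_ ->].
  have rab T : T \in H -> r \in T -> (a \in T) && (b \in T) by case: rs => -[-> _]; [apply: pab|apply: qab].
  have sab T : T \in H -> s \in T -> (a \in T) && (b \in T) by case: rs => -[_ ->]; [apply: qab|apply: pab].
  have [aT0 bT0] := andP T0ab.
  have E0 := card3E3 (uH T0H) rT0 aT0 bT0 ra rb ab.
  have sT0 : s \notin T0 by rewrite E0; mem_simp.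
  have {}N T : T \in H -> (a \in T) && (b \in T).
    move=> TH; case: (eqVneq T0 T) => [<-//|T0T]; case rT: (r \in T); first exact: rab.
    case sT: (s \in T); first exact: sab.
    have [aT|bT] := orP (aob _ TH).
      rewrite aT /=; apply: contraT => bT; exfalso; have [v /eqP] := s1 sa1 T0H TH T0T.
      by apply/negP; rewrite E0; pointwise v; rewrite ?rT ?sT //; case: (v \in T).
    rewrite bT andbT; apply: contraT => aT; exfalso; have [v /eqP] := s2 sb2 T0H TH T0T.
    by apply/negP; rewrite E0; pointwise v; rewrite ?rT ?sT //; case: (v \in T).
  apply: leq_trans (_ : 2 <= 6) => //; apply: leq_trans (over_le2 (S := [set a; b]) sfH uH _).
    by apply/subset_leq_card/subsetP => T TH; rewrite inE TH sub2 N.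
  by rewrite cards2 ab.
case: (set_0Vmem [set T in H | p \in T]) => [Ep|[T0]]; last first.
  by rewrite inE => /andP[T0H pT0]; apply: all_ab T0H _ pT0; left.
case: (set_0Vmem [set T in H | q \in T]) => [Eq|[T0]]; last first.
  by rewrite inE => /andP[T0H qT0]; apply: all_ab T0H _ qT0; right.
have nS v T : [set T in H | v \in T] = set0 -> T \in H -> v \notin T.
  by move=> /setP/(_ T); rewrite !inE => + TH; rewrite TH => /negbT.
have Sa : #|[set T in H | a \in T]| <= 3.
  apply: (star3 s1 pa1 (a := a)); rewrite ?inE ?eqxx ?orbT // => T v TH _.
  by rewrite !inE => /orP[]/eqP->; rewrite ?eqxx // nS.
have Sb : #|[set T in H | b \in T]| <= 3.
  apply: (star3 s2 pb2 (a := b)); rewrite ?inE ?eqxx ?orbT // => T v TH _.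
  by rewrite !inE => /orP[]/eqP->; rewrite ?eqxx // nS.
have := card_cover2 (P := fun T => a \in T) (Q := fun T => b \in T) aob.
by move: Sa Sb; clear; lia.
Qed.

(** Each of the pairs [ab] and [cd] lies in at most one member. Any other member misses [p] and
    contains exactly one of [a] and [b]; [S2] allows two for each choice. *)
Lemma triangles_share1 p a b c d : p != a -> p != b -> a != b -> p != c -> p != d -> c != d ->
  a != c -> a != d -> b != c -> b != d ->
  tri G1 [set p; a; b] -> tri G2 [set p; c; d] -> #|H| <= 6.
Proof.
move=> pa pb ab pc pd cd ac ad bc bd t1 t2.
have [pa1 pb1 ab1] : [/\ [set p; a] \in G1, [set p; b] \in G1 & [set a; b] \in G1].
  by split; apply: t1; rewrite ?inE ?eqxx ?orbT.
have [pc2 pd2 cd2] : [/\ [set p; c] \in G2, [set p; d] \in G2 & [set c; d] \in G2].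
  by split; apply: t2; rewrite ?inE ?eqxx ?orbT.
have P al ga T : T \in H -> p \in T -> [set p; al] \in G1 -> [set p; ga] \in G2 ->
   p != al -> p != ga -> al != ga -> (al \in T) || (ga \in T).
  move=> TH pT e1 e2 pal pga alga; apply: contraT; rewrite negb_or => /andP[alT gaT].
  exfalso; have [v /eqP] := s12 e1 e2 TH.
  by apply/negP; pointwise v; case: (v \in T).
have pT_abcd T : T \in H -> p \in T -> ((a \in T) && (b \in T)) || ((c \in T) && (d \in T)).
  move=> TH pT; have := P a c T TH pT pa1 pc2 pa pc ac; have := P a d T TH pT pa1 pd2 pa pd ad.
  have := P b c T TH pT pb1 pc2 pb pc bc; have := P b d T TH pT pb1 pd2 pb pd bd.
  by case: (a \in T) (b \in T) (c \in T) (d \in T) => [] [] [] [].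
have far e f T : T \in H -> e \in G1 -> f \in G2 -> [disjoint e & f] -> exists2 v, v \in T & v \in e :|: f.
  move=> TH eG fG D; have [v] := s12 eG fG TH; case ve: (v \in e).
    by rewrite (disjointFr D ve); case vT: (v \in T) => // _; exists v; rewrite // inE ve.
  by case vf: (v \in f); case vT: (v \in T) => // _; exists v; rewrite // inE ve vf.
have Dj u v x y : u != x -> u != y -> v != x -> v != y -> [disjoint [set u; v] & [set x; y]].
  by move=> *; apply/pred0P => r /=; pointwise r.
have cdT T : T \in H -> p \notin T -> a \notin T -> b \notin T -> (c \in T) && (d \in T).
  move=> TH pT aT bT; apply/andP; split.
    have [|v] := far _ _ _ TH ab1 pc2; first by apply: Dj; rewrite // eq_sym.
    by rewrite !inE -!orbA => vT /or4P[]/eqP E; move: vT; rewrite E // ?(negbTE pT) ?(negbTE aT) ?(negbTE bT).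
  have [|v] := far _ _ _ TH ab1 pd2; first by apply: Dj; rewrite // eq_sym.
  by rewrite !inE -!orbA => vT /or4P[]/eqP E; move: vT; rewrite E // ?(negbTE pT) ?(negbTE aT) ?(negbTE bT).
(* Splitting against [{p, be}] and [{c, d}] puts exactly one of [c], [d] into each such member.
   Three of them would form a triangle in the link of [al] with exactly one of [c], [d] on every
   side, and no placement of [c] and [d] achieves this. *)
have S2 al be : al != be -> al != c -> al != d -> be != c -> be != d -> p != al -> p != be ->
  [set al; be] \in G1 -> [set p; be] \in G1 ->
  #|[set T in H | [&& al \in T, be \notin T, p \notin T & ~~ ((c \in T) && (d \in T))]]| <= 2.
  move=> albe alc ald bec bed pal pbe e1 e2; rewrite leqNgt; apply/negP => S3.
  set S := [set T in H | _] in S3.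
  have SP T : T \in S -> (c \in T) != (d \in T).
    rewrite inE => /and5P[TH alT beT pT ncd].
    have [|v] := far _ _ _ TH e2 cd2; first by apply: Dj.
    rewrite !inE -!orbA => vT /or4P[]/eqP E; move: vT ncd; rewrite E ?(negbTE pT) ?(negbTE beT) // => -> /=.
      by move/negbTE->.
    by rewrite andbT => /negbTE->.
  have [||||x [y [z [[xy xz yz [ax ay az]] [h1 h2 h3]]]]] := star_triangle (H := S) (a := al) _ _ _ _ S3.
  - exact: sf_filter sfH.
  - exact: uniform_filter uH.
  - by move=> T; rewrite inE => /and3P[].
  - apply: (star_split sfH uH (e := [set al; be])); rewrite ?inE ?eqxx // => T.
    + by move=> _ /andP[].
    + by move=> v _ /and3P[_ beT _]; rewrite !inE => /orP[]/eqP->; rewrite ?eqxx.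
    + by move=> T' TH T'H TT'; apply: s1.
  have nn (r s t : V) : s != t -> ~~ ((r == s) && (r == t)).
    by move=> st; apply/negP => /andP[/eqP rs /eqP rt]; rewrite -rs -rt eqxx in st.
  have nd (r s t : V) : s != t -> ~~ ((s == r) && (t == r)).
    by move=> st; apply/negP => /andP[/eqP sr /eqP tr_]; rewrite sr tr_ eqxx in st.
  move: (SP _ h1) (SP _ h2) (SP _ h3) (nn c _ _ xy) (nn c _ _ xz) (nn c _ _ yz)
    (nn d _ _ xy) (nn d _ _ xz) (nn d _ _ yz) (nd x _ _ cd) (nd y _ _ cd) (nd z _ _ cd).
  rewrite !inE ![c == al]eq_sym ![d == al]eq_sym (negbTE alc) (negbTE ald) /=.
  by case: (c == x) (c == y) (c == z) (d == x) (d == y) (d == z) => [] [] [] [] [] [].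
have Sa := S2 a b ab ac ad bc bd pa pb ab1 pb1.
have ba : b != a by rewrite eq_sym.
have ba1 : [set b; a] \in G1 by rewrite setUC.
have Sb := S2 b a ba bc bd ac ad pb pa ba1 pa1.
have Oab := o1 ab1; have Ocd := o2 cd2.
set Sa' := [set T in H | [&& a \in T, _, _ & _]] in Sa.
set Sb' := [set T in H | [&& b \in T, _, _ & _]] in Sb.
have : #|H| <= #|Sa'| + (#|Sb'| + (#|over H [set a; b]| + #|over H [set c; d]|)).
  apply: leq_trans (cardU2 (X := Sa') (Y := Sb' :|: (over H [set a; b] :|: over H [set c; d])) _) _.
    apply/subsetP => T TH; rewrite !inE TH !sub2 /=.
    move: (pT_abcd _ TH) (cdT _ TH).
    by case: (p \in T); case: (a \in T); case: (b \in T); case: (c \in T); case: (d \in T) => //= h1 h2;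
      try exact: h1; exact: h2.
  by rewrite leq_add2l; apply: leq_trans (card_setU_le _ _) _; rewrite leq_add2l; apply: cardU2.
by move: Sa Sb Oab Ocd; clear; lia.
Qed.

(** A member missing a side of [t] and a side of [t'] would form three disjoint sets with them, so
    it contains one of the six sides, each of which lies in at most one member. *)
Lemma triangles_disjoint (t t' : {set V}) : #|t| = 3 -> #|t'| = 3 -> [disjoint t & t'] ->
  tri G1 t -> tri G2 t' -> #|H| <= 6.
Proof.
move=> t3 t'3 D T1 T2; have [t0 t'0] : t != set0 /\ t' != set0 by rewrite -!card_gt0 t3 t'3.
pose P (s T : {set V}) := [exists u in s, s :\ u \subset T].
have le3 (s : {set V}) G : #|s| = 3 -> tri G s -> (forall e, e \in G -> #|over H e| <= 1) -> #|[set T in H | P s T]| <= 3.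
  move=> r3 Ts o.
  apply: leq_trans (cover_sum (K := [in s]) (r := fun u => [pred T : {set V} | s :\ u \subset T]) _) _.
    by move=> T; rewrite in_set => /andP[_ /exists_inP[u us sT]]; exists u.
  apply: (@leq_trans (\sum_(u in s) 1)); last by rewrite sum_nat_const r3.
  apply: leq_sum => u us; apply: leq_trans (o _ (tri_D1 Ts r3 us)).
  by apply/subset_leq_card/subsetP => T; rewrite !inE => /andP[/andP[->]].
have cov T : T \in H -> P t T || P t' T.
  move=> TH; apply/orP; case: (subD1_or_miss T t0) => [[u ut tT]|[u [v [ut vt uv /andP[uT vT]]]]].
    by left; apply/exists_inP; exists u.
  case: (subD1_or_miss T t'0) => [[x xt tT]|[x [y [xt yt xy /andP[xT yT]]]]].
    by right; apply/exists_inP; exists x.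
  exfalso; have [r] := s12 (T1 _ _ ut vt uv) (T2 _ _ xt yt xy) TH.
  have nn w w' : w \in t -> w' \in t' -> w != w'.
    by move=> wt; apply: contraTneq => <-; rewrite (disjointFr D wt).
  have [ux uy vx vy] : [/\ u != x, u != y, v != x & v != y] by rewrite !nn.
  by move/eqP; apply/negP; pointwise r; case: (r \in T).
have := card_cover2 cov; have := le3 _ _ t3 T1 o1; have := le3 _ _ t'3 T2 o2.
by clear; lia.
Qed.

Lemma two_triangles_le7 (t t' : {set V}) : #|t| = 3 -> #|t'| = 3 -> tri G1 t -> tri G2 t' -> 1 < #|G3| -> #|H| <= 7.
Proof.
move=> t3 t'3 T1 T2 G3_1.
have [D|/meets[p pt pt']] := boolP [disjoint t & t'].
  exact: leq_trans (triangles_disjoint t3 t'3 D T1 T2) _.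
have [[q [qt qt' pq]]|N] : (exists q, [/\ q \in t, q \in t' & p != q]) \/ (forall q, q \in t -> p != q -> q \notin t').
    case: (pickP (fun q => [&& q \in t, q \in t' & p != q])) => [q /and3P[]|N]; first by left; exists q.
    by right=> q qt pq; apply/negP => qt'; move: (N q); rewrite qt qt' pq.
  have [a [pa qa E]] := card3E2 t3 pt qt pq; have [b [pb qb E']] := card3E2 t'3 pt' qt' pq.
  rewrite E in T1; rewrite E' in T2; case: (eqVneq a b) => [ab|ab].
    by rewrite -ab in T2; apply: same_triangle pq pa qa T1 T2 G3_1.
  exact: leq_trans (triangles_share2 pq pa qa pb qb ab T1 T2) _.
have [a [b [pa pb ab E]]] := card3E1 t3 pt; have [c [d [pc pd cd E']]] := card3E1 t'3 pt'.
have [at_ bt] : a \in t /\ b \in t by rewrite E !inE !eqxx !orbT.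
have := N _ at_ pa; have := N _ bt pb; rewrite E' !inE !negb_or => /andP[/andP[_ bc] bd] /andP[/andP[_ ac] ad].
rewrite E in T1; rewrite E' in T2.
exact: leq_trans (triangles_share1 pa pb ab pc pd cd ac ad bc bd T1 T2) _.
Qed.

End TwoTriangles.

Lemma cls_split k F A S1 S2 S3 C1 C2 C3 : sf F -> uniform k F ->
  C1 \in cls F A S1 -> C2 \in cls F A S2 -> C3 \in cls F A S3 ->
  C1 != C2 -> C1 != C3 -> C2 != C3 ->
  (forall v, v \in A -> (v \in S1) + (v \in S2) + (v \in S3) != 2) ->
  exists2 v, v \notin A & (v \in C1) + (v \in C2) + (v \in C3) = 2.
Proof.
move=> sfF uF c1 c2 c3 n12 n13 n23 N.
have sub S C : C \in cls F A S -> C \in F by rewrite inE => /andP[].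
have [v E] := sfF _ _ _ (sub _ _ c1) (sub _ _ c2) (sub _ _ c3) n12 n13 n23.
exists v => //; apply/negP => vA; move: (N _ vA).
by rewrite -(clsE c1 vA) -(clsE c2 vA) -(clsE c3 vA) E.
Qed.

Lemma tr_cls F A a e : a \in A -> e \in tr F A [set a] -> a |: e \in cls F A [set a].
Proof.
move=> aA /tr1P[eF D]; rewrite inE eF /=; apply/eqP/setP => v; rewrite !inE.
case: (eqVneq v a) => [->|_] /=; first by rewrite aA.
by case: (boolP (v \in e)) => //= ve; rewrite (disjointFr D ve).
Qed.

Lemma graph_tri G : sf G -> uniform 2 G -> intersecting G -> 2 < #|G| ->
  exists t : {set V}, #|t| = 3 /\ tri G t.
Proof.
move=> sfG uG iG G3; have [a [b [c [ab ac bc E]]]] := graph_intersecting sfG uG iG G3.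
exists [set a; b; c]; split; first exact: cards3.
move=> u v; rewrite E !inE -!orbA => /or3P[]/eqP-> /or3P[]/eqP-> //; rewrite ?eqxx ?orbT //.
all: by rewrite 1?[[set b; a]]setUC 1?[[set c; b]]setUC 1?[[set c; a]]setUC ?eqxx ?orbT.
Qed.

Lemma cls0_intersecting k F A : sf F -> uniform k F -> A \in F -> A != set0 -> intersecting (cls F A set0).
Proof.
move=> sfF uF AF A0; have iT := tr_intersecting sfF uF AF (S := set0).
have m C : C \in cls F A set0 -> C \in tr F A set0.
  rewrite inE in_tr set0U disjoint_sym disjoints_subset sub0set => /andP[-> /eqP E] /=.
  by rewrite -setI_eq0 E.
move=> C C' /m Ct /m C't; apply: iT Ct C't.
by rewrite properE sub0set subset0.
Qed.

Lemma cls_uniform k F A S : uniform k F -> uniform k (cls F A S).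
Proof. by apply: uniformS; apply: setI_filter_sub. Qed.

Lemma cls_sf F A S : sf F -> sf (cls F A S).
Proof. by apply: sfS; apply: setI_filter_sub. Qed.

(** * The triples around a fixed triple of the system *)

Section Around.

Variables (L : {set {set V}}) (Q : {set V}).
Hypotheses (sfL : sf L) (uL : uniform 3 L) (QL : Q \in L).

Let H := cls L Q set0.
Let Gr v := tr L Q [set v].

Lemma around_iH : intersecting H.
Proof. by apply: cls0_intersecting sfL uL QL _; rewrite -card_gt0 (uL QL). Qed.

Let uG v : uniform 2 (Gr v).
Proof. by move=> e /(tr_uniform uL); rewrite cards1. Qed.
Let sfG v : sf (Gr v).
Proof. exact: tr_sf. Qed.
Let iG v : v \in Q -> intersecting (Gr v).
Proof.
move=> vQ; apply: tr_intersecting sfL uL QL _.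
by rewrite properEcard sub1set vQ cards1 (uL QL).
Qed.

Lemma around_le3 v : v \in Q -> #|Gr v| <= 3.
Proof. by move=> vQ; apply: graph_intersecting_le3; [exact: sfG|exact: uG|exact: iG]. Qed.

Let HQ T v : T \in H -> v \in Q -> v \notin T.
Proof. by move=> TH vQ; rewrite (clsE TH vQ) inE. Qed.

Let GQ a e v : e \in Gr a -> v \in Q -> v \notin e.
Proof. by move=> /tr1P[_ D] vQ; rewrite (disjointFl D vQ). Qed.

Let HL T : T \in H -> T \in L.
Proof. by rewrite inE => /andP[]. Qed.

Let memI (P : pred {set V}) G S : (S \in [set C in G | P C]) = (S \in G) && P S.
Proof. exact: in_set. Qed.

Let s2H a b e f T : a \in Q -> b \in Q -> a != b -> e \in Gr a -> f \in Gr b -> T \in H -> split3 e f T.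
Proof.
move=> aQ bQ ab ea fb TH.
have [||||v vQ E] := cls_split sfL uL (tr_cls aQ ea) (tr_cls bQ fb) TH.
- by apply/neqP; exists a; rewrite !inE eqxx (negbTE ab) (negbTE (GQ fb aQ)).
- by apply/neqP; exists a; rewrite !inE eqxx (negbTE (HQ TH aQ)).
- by apply/neqP; exists b; rewrite !inE eqxx (negbTE (HQ TH bQ)).
- by move=> v _; pointwise v.
exists v; move: E; rewrite !inE.
by case: (eqVneq v a) => [Ev|_]; [by rewrite Ev aQ in vQ|]; case: (eqVneq v b) => [Ev|_]; [by rewrite Ev bQ in vQ|].
Qed.

Let s1H a e T T' : a \in Q -> e \in Gr a -> T \in H -> T' \in H -> T != T' -> split3 e T T'.
Proof.
move=> aQ ea TH T'H TT'.
have [||||v vQ E] := cls_split sfL uL (tr_cls aQ ea) TH T'H.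
- by apply/neqP; exists a; rewrite !inE eqxx (negbTE (HQ TH aQ)).
- by apply/neqP; exists a; rewrite !inE eqxx (negbTE (HQ T'H aQ)).
- by [].
- by move=> v _; pointwise v.
exists v; move: E; rewrite !inE.
by case: (eqVneq v a) => [Ev|_]; [by rewrite Ev aQ in vQ|].
Qed.

Let s3G a b c e f g : a \in Q -> b \in Q -> c \in Q -> a != b -> a != c -> b != c ->
  e \in Gr a -> f \in Gr b -> g \in Gr c -> split3 e f g.
Proof.
move=> aQ bQ cQ ab ac bc ea fb gc.
have [||||v vQ E] := cls_split sfL uL (tr_cls aQ ea) (tr_cls bQ fb) (tr_cls cQ gc).
- by apply/neqP; exists a; rewrite !inE eqxx (negbTE ab) (negbTE (GQ fb aQ)).
- by apply/neqP; exists a; rewrite !inE eqxx (negbTE ac) (negbTE (GQ gc aQ)).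
- by apply/neqP; exists b; rewrite !inE eqxx (negbTE bc) (negbTE (GQ gc bQ)).
- by move=> v _; pointwise v.
exists v; move: E; rewrite !inE.
by case: (eqVneq v a) => [Ev|_]; [by rewrite Ev aQ in vQ|]; case: (eqVneq v b) => [Ev|_]; [by rewrite Ev bQ in vQ|];
  case: (eqVneq v c) => [Ev|_]; [by rewrite Ev cQ in vQ|].
Qed.

Let iH := around_iH.
Let uH : uniform 3 H := cls_uniform uL.
Let sfH : sf H := cls_sf sfL.

Lemma around_le7 a b c : a \in Q -> b \in Q -> c \in Q -> a != b -> a != c -> b != c ->
  2 < #|Gr a| -> 2 < #|Gr b| -> 1 < #|Gr c| -> #|H| <= 7.
Proof.
move=> aQ bQ cQ ab ac bc Ga Gb Gc.
have [t [t3 T]] := graph_tri (sfG (v := a)) (uG (v := a)) (iG aQ) Ga.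
have [t' [t'3 T']] := graph_tri (sfG (v := b)) (uG (v := b)) (iG bQ) Gb.
apply: (two_triangles_le7 (G1 := Gr a) (G2 := Gr b) (G3 := Gr c)) t3 t'3 T T' Gc => //;
  first [exact: uG | exact: iG | by move=> e f S; apply: s2H | by move=> e f g; apply: s3G
        | by move=> e S S'; apply: s1H].
Qed.

(** With at least 8 edges in total, two graphs have three and the last at least two, so [around_le7]
    gives 14 + 9; with at most 7 edges the sum is at most 16 + 7. *)
Lemma around_le23 a b c : Q = [set a; b; c] -> a != b -> a != c -> b != c -> #|H| <= 8 ->
  2 * #|H| + (#|Gr a| + #|Gr b| + #|Gr c|) <= 23.
Proof.
move=> EQ ab ac bc H8; have [aQ bQ cQ] : [/\ a \in Q, b \in Q & c \in Q] by rewrite EQ !inE !eqxx !orbT.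
have [ba ca cb] : [/\ b != a, c != a & c != b] by rewrite (eq_sym b) (eq_sym c) (eq_sym c).
have := around_le7 aQ bQ cQ ab ac bc; have := around_le7 aQ cQ bQ ac ab cb; have := around_le7 bQ cQ aQ bc ba ca.
move: (around_le3 aQ) (around_le3 bQ) (around_le3 cQ) H8; clear; lia.
Qed.

(** Two disjoint triples meeting [Q] would each have a point on [Q], hence missed by all of [H], and
    [disjoint_pair_le8] would apply. *)
Lemma around_intersecting : 9 <= #|H| -> intersecting [set C in L | ~~ [disjoint C & Q]].
Proof.
move=> H9 C C'; rewrite !inE => /andP[CL /meets[v vC vQ]] /andP[C'L /meets[v' v'C v'Q]].
apply/meets/negP => D; move: H9; rewrite ltnNge => /negP; apply.
apply: (disjoint_pair_le8 sfL uL _ iH CL C'L D vC v'C) => [|T TH|T TH]; try exact: HQ.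
by apply/subsetP => T /HL.
Qed.

Lemma triple_ext a b : a \in Q -> b \in Q -> a != b -> 0 < #|cls L Q [set a; b]| ->
  exists u, u \notin Q /\ [set a; b; u] \in L.
Proof.
move=> aQ bQ ab /card_gt0P[C Cc]; have CL : C \in L by move: Cc; rewrite inE => /andP[].
have aC : a \in C by rewrite (clsE Cc aQ) !inE eqxx.
have bC : b \in C by rewrite (clsE Cc bQ) !inE eqxx orbT.
have [u [au bu E]] := card3E2 (uL CL) aC bC ab; exists u; rewrite -E; split=> //.
apply/negP => uQ; have : u \in C by rewrite E !inE eqxx orbT.
by rewrite (clsE Cc uQ) !inE ![u == _]eq_sym (negbTE au) (negbTE bu).
Qed.

Let Grl a e : e \in Gr a -> e \in link L [set a].
Proof. exact/subsetP/tr_sub. Qed.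

(** The link of [a] contains [bu], [cv] and the triangle on [t]. If [u] or [v] were on [t] it would
    have degree 3; if they differed, [bu], [cv] and a side of [t] would be a matching. *)
Lemma triangle_ext a b c u v (t : {set V}) : a \in Q -> b \in Q -> c \in Q -> a != b -> a != c -> b != c ->
  u \notin Q -> v \notin Q -> [set a; b; u] \in L -> [set a; c; v] \in L -> #|t| = 3 -> tri (Gr a) t ->
  u = v /\ u \notin t.
Proof.
move=> aQ bQ cQ ab ac bc uQ vQ abu acv t3 T.
have sfl : sf (link L [set a]) by apply: link_sf.
have ul : uniform 2 (link L [set a]) by move=> e /(link_uniform uL); rewrite cards1.
have nQ w x : w \in Q -> x \notin Q -> w != x by move=> wQ; apply: contraNneq => <-.
have tQ x : x \in t -> x \notin Q.
  move=> xt; apply/negP => xQ; have [y [z [xy _ _ E]]] := card3E1 t3 xt.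
  have yt : y \in t by rewrite E !inE eqxx orbT.
  by have := GQ (T _ _ xt yt xy) xQ; rewrite !inE eqxx.
have bul : [set b; u] \in link L [set a] by apply: link1_set2; rewrite // nQ.
have cvl : [set c; v] \in link L [set a] by apply: link1_set2; rewrite // nQ.
have nt b' u' : b' \in Q -> [set b'; u'] \in link L [set a] -> u' \notin t.
  move=> b'Q b'l; apply/negP => ut; have [y [z [uy uz yz E]]] := card3E1 t3 ut.
  have yt : y \in t by rewrite E !inE eqxx orbT.
  have zt : z \in t by rewrite E !inE eqxx orbT.
  have := graph_star u' sfl ul; rewrite leqNgt => /negP; apply; apply/card_gt2P.
  exists [set b'; u'], [set u'; y], [set u'; z].
  have [l1 l2] : [set u'; y] \in link L [set a] /\ [set u'; z] \in link L [set a] by split; apply: Grl; apply: T.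
  have := nQ _ _ b'Q (tQ _ ut); have := nQ _ _ b'Q (tQ _ yt); have := nQ _ _ b'Q (tQ _ zt) => bz by_ bu.
  split; first by split; rewrite in_set ?b'l ?l1 ?l2 !inE eqxx ?orbT.
  split.
  - by apply/neqP; exists b'; mem_simp.
  - by apply/neqP; exists y; mem_simp.
  - by apply/neqP; exists b'; mem_simp.
have ut := nt _ _ bQ bul; have vt := nt _ _ cQ cvl; split=> //.
case: (eqVneq u v) => // uv; exfalso.
have [x [y [z [xy xz yz E]]]] := card3E t3.
have [xt yt] : x \in t /\ y \in t by rewrite E !inE !eqxx orbT.
have D p q r s : p \in Q -> r \in t -> s \in t -> q \notin t -> [disjoint [set p; q] & [set r; s]].
  move=> pQ rt st qt; have [pr ps] := (nQ _ _ pQ (tQ _ rt), nQ _ _ pQ (tQ _ st)).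
  have [qr qs] : q != r /\ q != s by split; apply: contraNneq qt => ->.
  by apply/pred0P => w /=; pointwise w.
apply: (no_matching3 sfl ul bul cvl (Grl (T _ _ xt yt xy))); try exact: D.
have [bv cu] := (nQ _ _ bQ vQ, nQ _ _ cQ uQ).
by apply/pred0P => w /=; pointwise w.
Qed.

(** By [triangle_ext], [ab] and [ac] extend by the same point [u] off the triangle [t] at [a]. What
    matters is whether the extension [w] of [bc] lies on [t]. *)
Lemma around_le22_aux a b c : Q = [set a; b; c] -> a != b -> a != c -> b != c -> #|H| <= 8 ->
  0 < #|cls L Q [set a; b]| -> 0 < #|cls L Q [set a; c]| -> 0 < #|cls L Q [set b; c]| -> 2 < #|Gr a| ->
  2 * #|H| + (#|Gr a| + #|Gr b| + #|Gr c|) <= 22.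
Proof.
move=> EQ ab ac bc H8 tab tac tbc Ga.
have [aQ bQ cQ] : [/\ a \in Q, b \in Q & c \in Q] by rewrite EQ !inE !eqxx !orbT.
have [ba ca cb] : [/\ b != a, c != a & c != b] by rewrite (eq_sym b) (eq_sym c) (eq_sym c).
have [u [uQ uL']] := triple_ext aQ bQ ab tab.
have [v [vQ vL']] := triple_ext aQ cQ ac tac.
have [w [wQ wL]] := triple_ext bQ cQ bc tbc.
have [t [t3 T]] := graph_tri (sfG (v := a)) (uG (v := a)) (iG aQ) Ga.
have [uv ut] := triangle_ext aQ bQ cQ ab ac bc uQ vQ uL' vL' t3 T.
have nQ r x : r \in Q -> x \notin Q -> r != x by move=> rQ; apply: contraNneq => <-.
have tQ x : x \in t -> x \notin Q.
  move=> xt; apply/negP => xQ; have [y [z [xy _ _ E]]] := card3E1 t3 xt.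
  have yt : y \in t by rewrite E !inE eqxx orbT.
  by have := GQ (T _ _ xt yt xy) xQ; rewrite !inE eqxx.
have [[aw bw] cw] := ((nQ _ _ aQ wQ, nQ _ _ bQ wQ), nQ _ _ cQ wQ).
(* If [w] is off [t], at most 3 members of [H] contain [w]. The others contain a side of [t]: a
   missed side with [a], the triple [bcw] and the member would be disjoint. So [H] has at most 3 + 3
   members, and 12 + 9 suffices. *)
case: (boolP (w \in t)) => wt; last first.
  suff : #|H| <= 6 by move: (around_le3 aQ) (around_le3 bQ) (around_le3 cQ); clear; lia.
  have Sw : #|[set S in H | w \in S]| <= 3.
    apply: (star_le3 (a := w)).
    - exact: sf_filter sfH.
    - exact: uniform_filter uH.
    - by move=> S; rewrite inE => /andP[].
    move=> S S'; rewrite in_set => /andP[SH wS]; rewrite in_set => /andP[S'H wS'] SS'.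
    apply: (star_petal sfL wL (HL SH) (HL S'H) _ _ SS') => //; rewrite ?inE ?eqxx ?orbT //.
    + by apply/neqP; exists b; rewrite !inE eqxx (negbTE (HQ SH bQ)).
    + by apply/neqP; exists b; rewrite !inE eqxx (negbTE (HQ S'H bQ)).
    + by move=> r; rewrite !inE -orbA => /or3P[]/eqP->; rewrite ?eqxx // !HQ.
  have meet S r s : S \in H -> w \notin S -> r \in t -> s \in t -> r != s -> (r \in S) || (s \in S).
    move=> SH wS rt st rs; apply: contraT; rewrite negb_or => /andP[rS sS]; exfalso.
    have [/tr1P[eL _]] := (T _ _ rt st rs).
    have [[ar br] cr] := ((nQ _ _ aQ (tQ _ rt), nQ _ _ bQ (tQ _ rt)), nQ _ _ cQ (tQ _ rt)).
    have [[as_ bs] cs] := ((nQ _ _ aQ (tQ _ st), nQ _ _ bQ (tQ _ st)), nQ _ _ cQ (tQ _ st)).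
    have [wr ws] : w != r /\ w != s by split; apply: contraNneq wt => ->.
    have [[aS bS] cS] := ((HQ SH aQ, HQ SH bQ), HQ SH cQ).
    apply: (sfP sfL wL eL (HL SH)).
    + by apply/neqP; exists b; mem_simp.
    + by apply/neqP; exists b; mem_simp.
    + by apply/neqP; exists a; mem_simp.
    + by move=> q; pointwise q; case: (q \in S).
  have : #|[set S in H | w \notin S]| <= \sum_(r in t) 1.
    apply: leq_trans (cover_sum (K := [in t]) (r := fun r => [pred S : {set V} | t :\ r \subset S]) _) _.
      move=> S; rewrite memI => /andP[SH wS]; have t0 : t != set0 by rewrite -card_gt0 t3.
      by case: (subD1_or_miss S t0) => [[r]|[r [s [rt st rs]]]]; [exists r|rewrite -negb_or meet].
    apply: leq_sum => r rt; have /tr1P[eL _] := tri_D1 T t3 rt.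
    have /card_gt1P[p [s [pt st ps]]] : 1 < #|t :\ r| by have := cardsD1 r t; rewrite rt t3; clear; lia.
    have aR x : x \in t :\ r -> x \in a |: t :\ r by rewrite in_setU1 => ->; rewrite orbT.
    apply: (pair_le1 sfL uL ps eL (aR _ pt) (aR _ st)) => S; rewrite memI memI.
    case/andP=> /andP[SH _] /subsetP tS; split; rewrite ?HL ?tS //.
    by apply/neqP; exists a; rewrite setU11 (negbTE (HQ SH aQ)).
  rewrite sum_nat_const t3 (card_split H (fun S => w \in S)).
  by move: Sw; clear; lia.
(* If [w] is on [t], it differs from [u], so [triangle_ext] forbids triangles at [b] and [c]. At
   most 3 + 2 + 2 edges are left, and it suffices that [H] has at most 7 members. *)
have uw : u != w by apply: contraNneq ut => ->.
have swap p q r : [set p; q; r] \in L -> [set q; p; r] \in L by rewrite set3C.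
have Gb : #|Gr b| <= 2.
  rewrite leqNgt; apply/negP => Gb3; have [t' [t'3 T']] := graph_tri (sfG (v := b)) (uG (v := b)) (iG bQ) Gb3.
  have [E _] := triangle_ext bQ aQ cQ ba bc ac uQ wQ (swap _ _ _ uL') wL t'3 T'.
  by rewrite E eqxx in uw.
have Gc : #|Gr c| <= 2.
  rewrite leqNgt; apply/negP => Gc3; have [t' [t'3 T']] := graph_tri (sfG (v := c)) (uG (v := c)) (iG cQ) Gc3.
  have [E _] := triangle_ext cQ aQ bQ ca cb ab vQ wQ (swap _ _ _ vL') (swap _ _ _ wL) t'3 T'.
  by rewrite uv E eqxx in uw.
suff : #|H| <= 7 by move: Gb Gc (around_le3 aQ); clear; lia.
have [q [r [wq wr qr Et]]] := card3E1 t3 wt.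
have [qt rt] : q \in t /\ r \in t by rewrite Et !inE !eqxx !orbT.
have aG p s : p \in t -> s \in t -> p != s -> [set a; p; s] \in L.
  by move=> pt st ps; have /tr1P[] := T _ _ pt st ps; rewrite setUA.
have [aq ar] := (nQ _ _ aQ (tQ _ qt), nQ _ _ aQ (tQ _ rt)).
have [bq br] := (nQ _ _ bQ (tQ _ qt), nQ _ _ bQ (tQ _ rt)).
have [cq cr] := (nQ _ _ cQ (tQ _ qt), nQ _ _ cQ (tQ _ rt)).
have [wqL qrL wrL] : [/\ [set a; w; q] \in L, [set a; q; r] \in L & [set a; w; r] \in L] by rewrite !aG.
(* A member missing [q] and [r] forms a sunflower with [bcw] and [awq] if it contains [w], and with
   [bcw] and [aqr] otherwise. *)
have hit S : S \in H -> (q \in S) || (r \in S).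
  move=> SH; apply: contraT; rewrite negb_or => /andP[qS rS]; exfalso.
  have [[aS bS] cS] := ((HQ SH aQ, HQ SH bQ), HQ SH cQ).
  case: (boolP (w \in S)) => wS.
    apply: (sfP sfL wL wqL (HL SH)).
    + by apply/neqP; exists b; mem_simp.
    + by apply/neqP; exists b; mem_simp.
    + by apply/neqP; exists a; mem_simp.
    + by move=> s; pointwise s; case: (s \in S).
  apply: (sfP sfL wL qrL (HL SH)).
  + by apply/neqP; exists b; mem_simp.
  + by apply/neqP; exists b; mem_simp.
  + by apply/neqP; exists a; mem_simp.
  + by move=> s; pointwise s; case: (s \in S).
have pairH p s : p != s -> [set a; p; s] \in L -> #|[set S in H | (p \in S) && (s \in S)]| <= 1.
  move=> ps eL; apply: (pair_le1 sfL uL ps eL); rewrite ?inE ?eqxx ?orbT // => S.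
  rewrite in_set => /and3P[SH pS sS]; split; rewrite ?HL //.
  by apply/neqP; exists a; rewrite !inE eqxx (negbTE (HQ SH aQ)).
(* Three members of such a half-star form a triangle in the link of [p]: at most 3 members miss [p],
   and at most 6 - 2 contain it, because [aps] and [apw] use two places. *)
have half p s : p != s -> p != w -> s != w -> a != p -> a != s -> [set a; p; s] \in L -> [set a; p; w] \in L ->
   #|[set S in H | [&& p \in S, s \notin S & w \notin S]]| <= 2 \/ #|H| <= 7.
  move=> ps pw sw ap as_ psL pwL; set X := [set S in H | _].
  case: (leqP #|X| 2) => X3; [by left|right].
  have XH : X \subset H by apply: setI_filter_sub.
  have pX S : S \in X -> p \in S by rewrite in_set => /and3P[].
  have sX S S' : S \in X -> S' \in X -> S != S' -> exists2 y, y != p & (y \in S) && (y \in S').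
    rewrite in_set => /and4P[SH pS sS wS]; rewrite in_set => /and4P[S'H pS' sS' wS'] SS'.
    apply: (star_petal sfL psL (HL SH) (HL S'H) _ _ SS') => //; rewrite ?inE ?eqxx ?orbT //.
    + by apply/neqP; exists a; rewrite !inE eqxx (negbTE (HQ SH aQ)).
    + by apply/neqP; exists a; rewrite !inE eqxx (negbTE (HQ S'H aQ)).
    + by move=> y; rewrite !inE -orbA => /or3P[]/eqP->; rewrite ?eqxx // ?sS ?sS' // !HQ.
  have [x [y [z [[xy xz yz [px py pz]] [h1 h2 h3]]]]] :=
    star_triangle (sfS XH sfH) (uniformS XH uH) pX sX X3.
  have := triangle_hit sfH uH iH xy xz yz px py pz (subsetP XH _ h1) (subsetP XH _ h2) (subsetP XH _ h3).
  rewrite (card_split H (fun S => p \in S)).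
  have : #|[set S in H | p \in S]| + #|[set [set a; p; s]; [set a; p; w]]| <= 6.
    apply: (over_disj6 (S := [set p]) sfL uL); rewrite ?cards1 //.
    - by apply/subsetP => S; rewrite in_set mem_over sub1set => /andP[SH ->]; rewrite HL.
    - by apply/subsetP => S; rewrite mem_over sub1set in_set2 => /orP[]/eqP->; rewrite ?psL ?pwL !inE eqxx orbT.
    - apply/pred0P => S /=; apply/negP; rewrite in_set => /andP[/andP[SH _]].
      by have := HQ SH aQ => aS; rewrite in_set2 => /orP[]/eqP ES; move: aS; rewrite ES !inE eqxx.
  have d : [set a; p; s] != [set a; p; w].
    by apply/neqP; exists s; mem_simp.
  by rewrite cards2 d; clear; lia.
have [rq qw rw] : [/\ r != q, q != w & r != w] by split; rewrite eq_sym.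
have [rqL qwL rwL] : [/\ [set a; r; q] \in L, [set a; q; w] \in L & [set a; r; w] \in L].
  by rewrite set3AC qrL set3AC wqL set3AC wrL.
case: (half q r qr qw rw aq ar qrL qwL) => [Sq|//].
case: (half r q rq rw qw ar aq rqL rwL) => [Sr|//].
have := pairH _ _ qr qrL; have := pairH _ _ qw qwL; have := pairH _ _ rw rwL.
set Xq := [set S in H | [&& q \in S, _ & _]] in Sq; set Xr := [set S in H | [&& r \in S, _ & _]] in Sr.
set Y1 := [set S in H | (r \in S) && (w \in S)]; set Y2 := [set S in H | (q \in S) && (w \in S)].
set Y3 := [set S in H | (q \in S) && (r \in S)].
have : #|H| <= #|Xq| + (#|Xr| + (#|Y1| + (#|Y2| + #|Y3|))).
  apply: leq_trans (cardU2 (X := Xq) (Y := Xr :|: (Y1 :|: (Y2 :|: Y3))) _) _.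
    apply/subsetP => S SH; have SH' : (S \in L) && (S :&: Q == set0) by move: SH; rewrite inE.
    rewrite !inE !SH' /=.
    by have := hit _ SH; case: (q \in S); case: (r \in S); case: (w \in S).
  by rewrite leq_add2l; apply: leq_trans (card_setU_le _ _) _; rewrite leq_add2l;
     apply: leq_trans (card_setU_le _ _) _; rewrite leq_add2l; apply: cardU2.
by move: Sq Sr; clear; lia.
Qed.

Lemma around_le22 a b c : Q = [set a; b; c] -> a != b -> a != c -> b != c -> #|H| <= 8 ->
  0 < #|cls L Q [set a; b]| -> 0 < #|cls L Q [set a; c]| -> 0 < #|cls L Q [set b; c]| ->
  2 * #|H| + (#|Gr a| + #|Gr b| + #|Gr c|) <= 22.
Proof.
move=> EQ ab ac bc H8 tab tac tbc.
have [ba ca cb] : [/\ b != a, c != a & c != b] by rewrite (eq_sym b) (eq_sym c) (eq_sym c).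
case: (leqP #|Gr a| 2) => [Ga|]; last exact: around_le22_aux.
have E2 : Q = [set b; a; c] by rewrite EQ set3C.
have E3 : Q = [set c; a; b] by rewrite EQ set3AC set3C.
have sw p q : [set p; q] = [set q; p] by rewrite setUC.
case: (leqP #|Gr b| 2) => [Gb|Gb]; last first.
  by have := around_le22_aux E2 ba bc ac H8; rewrite (sw b a) => /(_ tab tbc tac Gb); clear; lia.
case: (leqP #|Gr c| 2) => [Gc|Gc]; last first.
  by have := around_le22_aux E3 ca cb ab H8; rewrite !(sw c) => /(_ tac tbc tab Gc); clear; lia.
by move: Ga Gb Gc H8; clear; lia.
Qed.

End Around.

(** For a 4-set [A], [gsum] and [tsum] count the members meeting [A] in exactly two and exactly
    three points, one of which is [x]. *)
Definition gsum F A x := \sum_(y in A :\ x) #|cls F A [set x; y]|.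
Definition tsum F A x := \sum_(y in A :\ x) #|cls F A (A :\ y)|.

Lemma cls_link F A S x : x \in A -> x \notin S ->
  #|cls (link F [set x]) (A :\ x) S| = #|cls F A (x |: S)|.
Proof.
move=> xA xS; have aC C : C \in cls F A (x |: S) -> x \in C.
  by move=> Cc; rewrite (clsE Cc xA) !inE eqxx.
rewrite (card_star aC); apply: eq_card => B; rewrite !inE.
case: (boolP [disjoint B & [set x]]) => //= D; rewrite disjoint_sym disjoints1 in D.
case: (x |: B \in F) => //=; apply/eqP/eqP => [E|/setP E]; apply/setP => v.
  rewrite !inE; case: (eqVneq v x) => [->|vx]; first by rewrite xA.
  by move/setP/(_ v): E; rewrite !inE vx.
move: (E v); rewrite !inE; case: (eqVneq v x) => [->|vx] //=.
by rewrite (negbTE xS) andbF.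
Qed.

Lemma setD1_link F A x : A \in F -> x \in A -> A :\ x \in link F [set x].
Proof.
by move=> AF xA; rewrite in_link setD1K // AF andbT disjoint_sym disjoints1 !inE eqxx.
Qed.

Lemma gsum_link F A x : x \in A ->
  gsum F A x = \sum_(y in A :\ x) #|cls (link F [set x]) (A :\ x) [set y]|.
Proof.
move=> xA; apply: eq_bigr => y; rewrite !inE => /andP[yx _].
by have := @cls_link F A [set y] x xA; rewrite !inE eq_sym yx => /(_ isT)->.
Qed.

Lemma tsum_link F A x : x \in A ->
  tsum F A x = \sum_(y in A :\ x) #|cls (link F [set x]) (A :\ x) (A :\ x :\ y)|.
Proof.
move=> xA; apply: eq_bigr => y; rewrite !inE => /andP[yx _].
rewrite cls_link // ?inE ?eqxx ?andbF //; congr #|pred_of_set (cls _ _ _)|.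
apply/setP => v; rewrite !inE; case: (eqVneq v x) => [->|//] /=.
by rewrite eq_sym yx.
Qed.

Lemma sum3 (f : V -> nat) a b c : a != b -> a != c -> b != c ->
  \sum_(v in [set a; b; c]) f v = f a + f b + f c.
Proof.
move=> ab ac bc; rewrite setUC big_setU1 /=; last by rewrite !inE negb_or ![c == _]eq_sym ac.
by rewrite big_setU1 ?inE //= big_set1 addnC.
Qed.

(** * The weight of a point, computed in its link *)

Section Vertex.

Variables (L : {set {set V}}) (Q : {set V}).
Hypotheses (sfL : sf L) (uL : uniform 3 L) (QL : Q \in L).

Let h := #|cls L Q set0|.
Let g := \sum_(y in Q) #|cls L Q [set y]|.
Let t := \sum_(y in Q) #|cls L Q (Q :\ y)|.
Let J := [set C in L | ~~ [disjoint C & Q]].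

Lemma vertex_h : h <= 10.
Proof.
apply: intersecting_le10 (cls_sf sfL) (cls_uniform uL) _.
exact: around_iH.
Qed.

Lemma vertex_t1 y : y \in Q -> #|cls L Q (Q :\ y)| <= 1.
Proof.
move=> yQ; have [a [b [ya yb ab E]]] := card3E1 (uL QL) yQ.
have -> : Q :\ y = [set a; b] by rewrite E; apply/setP => v; pointwise v.
have [aQ bQ] : a \in Q /\ b \in Q by rewrite E !inE !eqxx !orbT.
apply: (pair_cls_le1 sfL uL QL) => //.
by rewrite properEcard sub2 aQ bQ cards2 ab (uL QL).
Qed.

Lemma vertex_t : t <= 3.
Proof.
rewrite -(uL QL) -sum1_card; apply: leq_sum => y yQ; exact: vertex_t1.
Qed.

(** For [t <= 2], three times [2 * h + g <= 23] gives 69 + 4. For [t = 3] all pairs of [Q] extend,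
    so [around_le22] gives 66 + 6. *)
Lemma vertex_val : h <= 8 -> 6 * h + 3 * g + 2 * t <= 73.
Proof.
move=> h8; have [a [b [c [ab ac bc E]]]] := card3E (uL QL).
have [aQ bQ cQ] : [/\ a \in Q, b \in Q & c \in Q] by rewrite E !inE !eqxx !orbT.
have := vertex_t; have := around_le23 sfL uL QL E ab ac bc h8.
have eg : g = #|tr L Q [set a]| + #|tr L Q [set b]| + #|tr L Q [set c]|.
  by rewrite /g [in X in \sum_(y in X) _]E sum3 // !card_tr ?sub1set.
rewrite -eg -/h; case: (leqP t 2) => [t2 h23 _|t3 _ t3']; first by move: t2 h23; clear; lia.
have : 2 * h + g <= 22; last by move: t3'; clear; lia.
have ea : Q :\ a = [set b; c] by rewrite E; apply/setP => v; pointwise v.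
have eb : Q :\ b = [set a; c] by rewrite E; apply/setP => v; pointwise v.
have ec : Q :\ c = [set a; b] by rewrite E; apply/setP => v; pointwise v.
have [[ta tb] tc] := (vertex_t1 aQ, vertex_t1 bQ, vertex_t1 cQ).
have et : t = #|cls L Q [set b; c]| + #|cls L Q [set a; c]| + #|cls L Q [set a; b]|.
  by rewrite /t [in X in \sum_(y in X) _]E sum3 // ea eb ec.
rewrite ea in ta; rewrite eb in tb; rewrite ec in tc.
rewrite eg; apply: (around_le22 sfL uL QL E ab ac bc h8); move: ta tb tc t3; rewrite et; clear; lia.
Qed.

Lemma sum_cls_le (f : V -> {set V}) n : {in Q &, injective f} -> (forall y, y \in Q -> #|f y| = n) ->
  \sum_(y in Q) #|cls L Q (f y)| <= #|[set C in L | #|C :&: Q| == n]|.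
Proof.
move=> inj fn; under eq_bigr => y yQ do rewrite -sum1_card.
rewrite -[leqRHS]sum1_card (exchange_big_dep (mem [set C in L | #|C :&: Q| == n])) /=.
  apply: leq_sum => C _; case: (pickP (fun y => (y \in Q) && (C \in cls L Q (f y)))) => [y /andP[yQ Cy]|N].
    rewrite (big_pred1 y) // => z; apply/andP/eqP => [[zQ Cz]|->//].
    apply: inj => //; move: Cy Cz; rewrite !inE => /andP[_ /eqP<-] /andP[_ /eqP<-] //.
  by rewrite big_pred0.
by move=> y C yQ; rewrite !inE => /andP[-> /eqP->]; rewrite fn // eqxx.
Qed.

Lemma vertex_J : 1 + g + t <= #|J|.
Proof.
have Q3 := uL QL.
have g_le : g <= #|[set C in L | #|C :&: Q| == 1]|.
  apply: sum_cls_le => [y z _ _ /setP/(_ y)|y _]; last exact: cards1.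
  by rewrite !inE eqxx => /esym/eqP.
have t_le : t <= #|[set C in L | #|C :&: Q| == 2]|.
  apply: sum_cls_le => [y z yQ zQ /setP/(_ y)|y yQ]; last by move: Q3; rewrite (cardsD1 y) yQ; lia.
  by rewrite !inE eqxx yQ andbT /= => E; apply/eqP; move: E; case: (y == z).
have q_le : 1 <= #|[set C in L | #|C :&: Q| == 3]|.
  by apply/card_gt0P; exists Q; rewrite inE QL setIid Q3.
have c3 (P1 P2 P3 : {set {set V}}) : [disjoint P1 & P2] -> [disjoint P1 & P3] -> [disjoint P2 & P3] ->
    P1 \subset J -> P2 \subset J -> P3 \subset J -> #|P1| + #|P2| + #|P3| <= #|J|.
  move=> d12 d13 d23 s1 s2 s3; apply: leq_trans (_ : _ <= #|P1 :|: P2 :|: P3|) _; last first.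
    by apply: subset_leq_card; rewrite !subUset s1 s2.
  by rewrite !cardsU setIUl !disjoint_setI0 // setU0 cards0 !subn0.
have dj m n : m != n -> [disjoint [set C in L | #|C :&: Q| == m] & [set C in L | #|C :&: Q| == n]].
  move=> mn; apply/pred0P => C /=; apply/negP; rewrite !inE => /andP[/andP[_ /eqP E] /andP[_ /eqP E']].
  by rewrite -E -E' eqxx in mn.
have sj m : 0 < m -> [set C in L | #|C :&: Q| == m] \subset J.
  move=> m0; apply/subsetP => C; rewrite !inE => /andP[-> /eqP E] /=.
  by rewrite -setI_eq0 -card_gt0 E.
have := c3 _ _ _ (dj 1 2 isT) (dj 1 3 isT) (dj 2 3 isT) (sj 1 isT) (sj 2 isT) (sj 3 isT).
move: g_le t_le q_le; clear; lia.
Qed.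

(** [around_intersecting] makes [J] intersecting, and [g] counts members of [J] meeting its member
    [Q] in one point, so [around3] applies. *)
Lemma vertex_ge9 : 9 <= h -> [/\ intersecting J, #|J| <= 10 & g <= 6].
Proof.
move=> h9; have iJ : intersecting J := around_intersecting sfL uL QL h9.
have sfJ : sf J by exact: sf_filter sfL.
have uJ : uniform 3 J by exact: uniform_filter uL.
split=> //; first exact: intersecting_le10.
have [a [b [c [ab ac bc E]]]] := card3E (uL QL).
have QJ : [set a; b; c] \in J by rewrite -E inE QL -setI_eq0 setIid -card_gt0 (uL QL).
have := around3 sfJ uJ iJ ab ac bc QJ; rewrite -E => J6.
rewrite /g [in X in \sum_(y in X) _]E sum3 //.
have m v : v \in Q -> #|cls L Q [set v]| <= #|cls J Q [set v]|.
  move=> vQ; apply/subset_leq_card/subsetP => C; rewrite !inE => /andP[-> /eqP E'].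
  by rewrite -setI_eq0 E' eqxx -card_gt0 cards1.
have [aQ bQ cQ] : [/\ a \in Q, b \in Q & c \in Q] by rewrite E !inE !eqxx !orbT.
by move: J6 (m _ aQ) (m _ bQ) (m _ cQ); clear; lia.
Qed.

End Vertex.

Lemma card_sum_ind F (P : pred {set V}) : #|[set C in F | P C]| = \sum_(C in F) P C.
Proof.
rewrite -sum1_card big_mkcond [RHS]big_mkcond /=; apply: eq_bigr => T _.
by rewrite inE; case: (T \in F); case: (P T).
Qed.

Lemma card_ind C R : #|C :&: R| = \sum_(u in R) (u \in C).
Proof.
rewrite -sum1_card big_mkcond [RHS]big_mkcond /=; apply: eq_bigr => u _.
by rewrite inE; case: (u \in C); case: (u \in R).
Qed.

(** Double counting of the members against the ordered pairs of distinct points of [R]. *)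
Lemma sum_card_pairs F R : \sum_(C in F) #|C :&: R| * (#|C :&: R| - 1) =
  \sum_(u in R) \sum_(v in R :\ u) #|[set C in F | (u \in C) && (v \in C)]|.
Proof.
under [RHS]eq_bigr => u _ do under eq_bigr => v _ do rewrite card_sum_ind.
under [RHS]eq_bigr => u _ do rewrite exchange_big.
rewrite [RHS]exchange_big /=; apply: eq_bigr => C CF.
rewrite {1}card_ind big_distrl /=; apply: eq_bigr => u uR.
case uC: (u \in C); last by rewrite big1.
rewrite mul1n -card_ind; have := cardsD1 u (C :&: R).
by rewrite inE uC uR setIDA /= => ->; rewrite add1n subn1.
Qed.

(** * Links of high degree *)

Section Design.

Variables (H : {set {set V}}) (W : {set V}).
Hypotheses (sfH : sf H) (uH : uniform 3 H) (iH : intersecting H).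
Hypotheses (W6 : #|W| = 6) (HW : forall T, T \in H -> T \subset W) (H9 : 9 <= #|H|).

Let deg p := #|[set T in H | p \in T]|.
Let deg2 u v := #|[set T in H | (u \in T) && (v \in T)]|.

Lemma deg2_le2 u v : u != v -> deg2 u v <= 2.
Proof.
move=> uv; apply: leq_trans (over_le2 (S := [set u; v]) sfH uH _); last by rewrite cards2 uv.
by apply/subset_leq_card/subsetP => T; rewrite inE => /and3P[TH uT vT]; rewrite inE TH sub2 uT.
Qed.

Lemma sum_pairs_le R : \sum_(T in H) #|T :&: R| * (#|T :&: R| - 1) <= 2 * (#|R| * (#|R| - 1)).
Proof.
rewrite sum_card_pairs; apply: leq_trans (_ : \sum_(u in R) (#|R| - 1) * 2 <= _).
  apply: leq_sum => u uR; apply: leq_trans (_ : \sum_(v in R :\ u) 2 <= _).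
    by apply: leq_sum => v; rewrite !inE => /andP[vu _]; apply: deg2_le2; rewrite eq_sym.
  by rewrite sum_nat_const; have := cardsD1 u R; rewrite uR; lia.
by rewrite sum_nat_const; lia.
Qed.

Lemma cardI_W T : T \in H -> T :&: W = T.
Proof. by move=> TH; apply/setIidPl; apply: HW. Qed.

Lemma card_HD1 T p : T \in H -> p \in W -> #|T :&: (W :\ p)| = 3 - (p \in T).
Proof.
move=> TH pW; rewrite setIDA cardI_W //.
by have := cardsD1 p T; rewrite (uH TH); case: (p \in T); lia.
Qed.

(** On the five points other than [p], a member through [p] holds 2 ordered pairs and any other
    member 6, while each of the 20 pairs lies in at most two members. *)
Lemma deg_ge p : p \in W -> 3 * #|H| <= 2 * deg p + 20.
Proof.
move=> pW; have := sum_pairs_le (W :\ p).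
have -> : #|W :\ p| = 5 by have := cardsD1 p W; rewrite pW W6; lia.
have : \sum_(T in H) (6 - 4 * (p \in T)) <= \sum_(T in H) #|T :&: (W :\ p)| * (#|T :&: (W :\ p)| - 1).
  by apply: leq_sum => T TH; rewrite card_HD1 //; case: (p \in T).
have : \sum_(T in H) 6 <= \sum_(T in H) (6 - 4 * (p \in T)) + 4 * \sum_(T in H) (p \in T).
  by rewrite big_distrr /= -big_split /=; apply: leq_sum => T _; case: (p \in T).
have -> : \sum_(T in H) (p \in T) = deg p.
  by rewrite /deg card_sum_ind.
rewrite sum_nat_const; clear; lia.
Qed.

Lemma deg_ge4 p : p \in W -> 4 <= deg p.
Proof. by move=> /deg_ge; move: H9; clear; lia. Qed.

Lemma star_sum_le p R : p \notin R -> \sum_(T in [set T in H | p \in T]) #|T :&: R| <= 2 * #|R|.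
Proof.
move=> pR; have -> : \sum_(T in [set T in H | p \in T]) #|T :&: R| = \sum_(u in R) deg2 p u.
  under eq_bigr => T _ do rewrite card_ind.
  rewrite exchange_big; apply: eq_bigr => u uR; rewrite -card_sum_ind.
  by apply: eq_card => T; rewrite !inE andbA.
rewrite mulnC -sum_nat_const; apply: leq_sum => u uR; apply: deg2_le2.
by apply: contraNneq pR => ->.
Qed.

Lemma deg_le5 p : p \in W -> deg p <= 5.
Proof.
move=> pW; have := @star_sum_le p (W :\ p).
have -> : #|W :\ p| = 5 by have := cardsD1 p W; rewrite pW W6; lia.
rewrite !inE eqxx => /(_ isT).
rewrite (eq_bigr (fun=> 2)) ?sum_nat_const; first by rewrite -/(deg p); lia.
by move=> T; rewrite inE => /andP[TH pT]; rewrite card_HD1 // pT.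
Qed.

Lemma card_HD2 T u v : T \in H -> u \in W -> v \in W -> u != v ->
  #|T :&: (W :\ u :\ v)| = 3 - (u \in T) - (v \in T).
Proof.
move=> TH uW vW uv; rewrite !setIDA cardI_W //.
have := cardsD1 u T; have := cardsD1 v (T :\ u); rewrite (uH TH) !inE (eq_sym v) uv /=.
by case: (u \in T); case: (v \in T); lia.
Qed.

Lemma miss1_le5 u : u \in W -> #|[set T in H | u \notin T]| <= #|H| - 4.
Proof.
by move=> /deg_ge4; have := card_split H (fun T => u \in T); rewrite -/(deg u); clear; lia.
Qed.

(** If every member met [{u, v}], each would add at least 2 to the pairs formed by [u] or [v] with
    the four other points. These are covered at most 8 + 8 times, so there would be at most 8
    members. *)
Lemma two_points_miss u v : u \in W -> v \in W -> u != v ->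
  exists T, [/\ T \in H, u \notin T & v \notin T].
Proof.
move=> uW vW uv; case: (set_0Vmem [set T in H | (u \notin T) && (v \notin T)]) => [E|[T]]; last first.
  by rewrite inE => /and3P[TH uT vT]; exists T.
exfalso; have hit T : T \in H -> (u \in T) || (v \in T).
  by move=> TH; move/setP/(_ T): E; rewrite !inE TH /=; case: (u \in T); case: (v \in T).
set R := W :\ u :\ v; have R4 : #|R| = 4.
  by rewrite /R; have := cardsD1 u W; have := cardsD1 v (W :\ u); rewrite uW W6 !inE vW (eq_sym v) uv /=; lia.
have [uR vR] : u \notin R /\ v \notin R by rewrite !inE !eqxx !andbF.
have := star_sum_le uR; have := star_sum_le vR; rewrite R4.
have e p : \sum_(T in [set T in H | p \in T]) #|T :&: R| = \sum_(T in H) (p \in T) * #|T :&: R|.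
  by rewrite big_mkcond [RHS]big_mkcond /=; apply: eq_bigr => T _; rewrite inE; case: (T \in H); case: (p \in T); rewrite ?mul1n.
rewrite !e; have : \sum_(T in H) 2 <= \sum_(T in H) (u \in T) * #|T :&: R| + \sum_(T in H) (v \in T) * #|T :&: R|.
  rewrite -big_split /=; apply: leq_sum => T TH; rewrite card_HD2 //.
  by have := hit _ TH; case: (u \in T); case: (v \in T).
rewrite sum_nat_const; move: H9; clear; lia.
Qed.

Lemma small_miss (X : {set V}) : #|X :&: W| <= 2 -> exists2 T, T \in H & [disjoint T & X].
Proof.
move=> X2; have [u [v [uW vW uv Xuv]]] : exists u v, [/\ u \in W, v \in W, u != v & X :&: W \subset [set u; v]].
  have pick (Y : {set V}) : #|Y| <= 5 -> exists2 w, w \in W & w \notin Y.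
    move=> Y5; have /subsetPn[w] : ~~ (W \subset Y) by apply: contraL Y5 => /subset_leq_card; rewrite W6 -ltnNge.
    by exists w.
  case: (leqP #|X :&: W| 0) => [/[!leqn0]/[!cards_eq0]/eqP->|X0].
    have [u uW _] := pick set0 (leq_trans (eq_leq (cards0 V)) isT).
    have [|v vW vu] := pick [set u]; first by rewrite cards1.
    by exists u, v; rewrite sub0set; split=> //; rewrite !inE in vu; rewrite eq_sym.
  case: (leqP #|X :&: W| 1) => X1.
    have /cards1P[u E] : #|X :&: W| == 1 by rewrite eqn_leq X1.
    have [|v vW vu] := pick [set u]; first by rewrite cards1.
    have : u \in X :&: W by rewrite E set11.
    rewrite inE => /andP[_ uW]; exists u, v; rewrite E sub1set !inE eqxx; split=> //.
    by rewrite !inE in vu; rewrite eq_sym.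
  have /card2E[u [v [uv E]]] : #|X :&: W| = 2 by apply/eqP; rewrite eqn_leq X2.
  have : u \in X :&: W by rewrite E !inE eqxx.
  have : v \in X :&: W by rewrite E !inE eqxx orbT.
  by rewrite !inE => /andP[_ vW] /andP[_ uW]; exists u, v; rewrite E.
have [T [TH uT vT]] := two_points_miss uW vW uv; exists T => //.
apply/pred0P => w /=; apply/negP => /andP[wT wX].
have : w \in X :&: W by rewrite inE wX (subsetP (HW TH)).
by move/(subsetP Xuv); rewrite !inE => /orP[]/eqP E; [move: uT|move: vT]; rewrite -E wT.
Qed.

(** The 20 triples of [W] form 10 complementary pairs. An intersecting [H] takes at most one triple
    from each; the pairs from which it takes none are special. *)
Definition special := [set R : {set V} | [&& R \subset W, #|R| == 3, R \notin H & W :\: R \notin H]].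

Lemma setDDW R : R \subset W -> W :\: (W :\: R) = R.
Proof. by move=> RW; rewrite setDDr setDv set0U; apply/setIidPr. Qed.

Lemma card_setDW R : R \subset W -> #|R| = 3 -> #|W :\: R| = 3.
Proof. by move=> RW R3; have := cardsID R W; rewrite (setIidPr RW) W6 R3; lia. Qed.

Lemma card_special : #|special| + 2 * #|H| = 20.
Proof.
have <- : #|[set R : {set V} | R \subset W & #|R| == 3]| = 20 by rewrite cards_draws W6.
set D := [set R | _ & _]; rewrite (card_split D (mem H)) (card_split [set R in D | R \notin H] (fun R => W :\: R \in H)).
have -> : [set R in D | R \in H] = H.
  apply/setP => R; rewrite !inE andbC; case RH: (R \in H) => //=.
  by rewrite HW ?uH.
have -> : [set R in [set R in D | R \notin H] | W :\: R \notin H] = special.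
  by apply/setP => R; rewrite !inE -!andbA.
have -> : #|[set R in [set R in D | R \notin H] | W :\: R \in H]| = #|H|.
  2: by rewrite mul2n -addnn addnC -addnA.
rewrite -[RHS](card_in_imset (f := fun T => W :\: T)) => [|T T' TH T'H E]; last first.
  by rewrite -(setDDW (HW TH)) E (setDDW (HW T'H)).
apply: eq_card => R; rewrite !inE; apply/andP/imsetP => [[/andP[/andP[RW _] _] RH]|[T TH ->]].
  by exists (W :\: R); rewrite ?setDDW.
split; last by rewrite (setDDW (HW TH)).
rewrite subsetDl (card_setDW (HW TH) (uH TH)) /=.
by apply/negP => DH; have [v vT] := iH TH DH; rewrite !inE vT.
Qed.

(** [special] is closed under complement in [W], so exactly half of it contains [p]. *)
Lemma card_special_at p : p \in W -> #|[set R in special | p \in R]| + #|H| = 10.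
Proof.
move=> pW; have := card_special; rewrite (card_split special (fun R => p \in R)).
have -> : #|[set R in special | p \in R]| = #|[set R in special | p \notin R]|.
  2: by move: #|_| #|H| => m n; clear; lia.
rewrite -(card_in_imset (f := fun T => W :\: T)) => [|T T']; last first.
  rewrite !inE => /andP[/and4P[TW _ _ _] _] /andP[/and4P[T'W _ _ _] _] E.
  by rewrite -(setDDW TW) E (setDDW T'W).
apply: eq_card => R; apply/imsetP/idP => [[T]|].
  rewrite !inE => /andP[/and4P[TW /eqP T3 TH DTH] pT] ->.
  by rewrite subsetDl card_setDW // setDDW // TH DTH !inE pT.
rewrite !inE => /andP[/and4P[TW /eqP T3 TH DTH] pT]; exists (W :\: R); rewrite ?setDDW //.
by rewrite !inE subsetDl card_setDW // setDDW // TH DTH pT pW.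
Qed.

(** The complement of [R] in [W] is disjoint from [X], so it cannot belong to [H]. *)
Lemma hit_special R (X : {set V}) : R \subset W -> #|R| = 3 -> R = X :&: W -> (forall T, T \in H -> ~~ [disjoint T & X]) ->
  (R \in H) || (R \in special).
Proof.
move=> RW R3 RX hit; case RH: (R \in H) => //=; rewrite inE RW R3 RH /=.
apply/negP => /hit/meets[v]; rewrite inE RX !inE => /andP[+ vW] vX.
by rewrite vX vW.
Qed.

(** Otherwise the complements of the triples [R :\ u] are at least three members of [H], all
    containing the pair [W :\: R]. *)
Lemma four_special R (P : {set V}) : R \subset W -> #|R| = 4 -> P \subset R -> 2 < #|P| ->
  exists2 u, u \in P & (R :\ u \in H) || (R :\ u \in special).
Proof.
move=> RW R4 PR P3; case: (boolP [exists u in P, (R :\ u \in H) || (R :\ u \in special)]).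
  by case/exists_inP => u; exists u.
rewrite negb_exists_in => /forall_inP no; exfalso; move: P3; rewrite ltnNge => /negP; apply.
have RuW u : R :\ u \subset W := subset_trans (subD1set R u) RW.
rewrite -(card_in_imset (f := fun u => W :\: (R :\ u))) => [|u v uP vP E]; last first.
  apply/eqP/negPn/negP => uv; have : v \in R :\ u by rewrite in_setD1 eq_sym uv (subsetP PR).
  by rewrite -(setDDW (RuW u)) E (setDDW (RuW v)) !inE eqxx.
apply: leq_trans (over_le2 (S := W :\: R) sfH uH _); last first.
  by have := cardsID R W; rewrite (setIidPr RW) W6 R4; clear; lia.
apply/subset_leq_card/subsetP => T /imsetP[u uP ->]; rewrite mem_over setDS ?subD1set // andbT.
have Ru3 : #|R :\ u| = 3 by have := cardsD1 u R; rewrite (subsetP PR) // R4; clear; lia.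
by have := no u uP; rewrite negb_or in_set RuW Ru3 => /andP[->] /=; rewrite negbK.
Qed.

End Design.

Lemma sum_setU_le (I : finType) (S1 S2 : {set I}) (f : I -> nat) :
  \sum_(i in S1 :|: S2) f i <= \sum_(i in S1) f i + \sum_(i in S2) f i.
Proof.
rewrite !(big_mkcond (fun i => i \in _)) -big_split; apply: leq_sum => i _.
by rewrite inE; case: (i \in S1); case: (i \in S2); rewrite //= ?leq_addr.
Qed.

Definition avoid F x := [set C in F | x \notin C].
Definition missed F C := [set T in F | [disjoint T & C]].

Lemma over_self X S : (forall A, A \in X -> S \subset A) -> over X S = X.
Proof. by move=> sub; apply/setP => A; rewrite inE; case AX: (A \in X) => //=; apply: sub. Qed.

Lemma card_missed_link F C x : x \notin C ->
  #|cls F C set0| = #|missed (link F [set x]) C| + #|missed (avoid F x) C|.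
Proof.
move=> xC; rewrite (card_split _ (fun A => x \in A)); congr (_ + _); last first.
  by apply: eq_card => A; rewrite !inE -setI_eq0 -andbA andbCA andbC -andbA andbC; case: (A \in F); rewrite ?andbF // andbC.
rewrite (card_star (a := x)) => [|A]; last by rewrite inE => /andP[].
apply: eq_card => T; rewrite !inE eqxx andbT -andbA; case: [disjoint T & _] => //=.
case: (_ \in F) => //=; rewrite -setI_eq0 setIUl (_ : [set x] :&: C = set0) ?set0U //.
by apply/setP => v; rewrite !inE; case: eqP => [->|//]; rewrite (negbTE xC).
Qed.

(** * A point whose link contains a large intersecting family *)

Section HighDegree.

Variables (F H J : {set {set V}}) (x : V) (W : {set V}).
Hypotheses (sfF : sf F) (uF : uniform 4 F).
Hypothesis HJ : link F [set x] = H :|: J.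
Hypothesis dHJ : [disjoint H & J].
Hypotheses (iH : intersecting H) (H9 : 9 <= #|H|).
Hypotheses (W6 : #|W| = 6) (HW : forall T, T \in H -> T \subset W).

Let L := link F [set x].
Let sfL : sf L := link_sf sfF.
Let uL : uniform 3 L.
Proof. by move=> T /(link_uniform uF); rewrite cards1. Qed.
Let HL : H \subset L.
Proof. by rewrite /L HJ subsetUl. Qed.
Let sfH : sf H := sfS HL sfL.
Let uH : uniform 3 H := uniformS HL uL.
Let h10 : #|H| <= 10 := intersecting_le10 sfH uH iH.
Let deg p := #|[set T in H | p \in T]|.
Let sp := special H W.

Let xT T : T \in H -> x \notin T /\ x |: T \in F.
Proof.
by move=> /(subsetP HL); rewrite in_link disjoint_sym disjoints1 => /andP[].
Qed.

Lemma card_avoid : #|avoid F x| + #|L| = #|F|.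
Proof.
rewrite (card_split F (fun C => x \in C)) addnC; congr (_ + _).
rewrite /L card_link; apply: eq_card => C; by rewrite !inE sub1set.
Qed.

(** Each of the 30 ordered pairs in [W] lies in at most 6 members of [F]. The members [x |: T] with
    [T] in [H] use 6 pairs each; if all members avoiding [x] met [W] twice, they would use at least
    2 each. *)
Lemma exists_low : 90 - 3 * #|H| < #|avoid F x| -> exists2 C, C \in avoid F x & #|C :&: W| <= 1.
Proof.
move=> big; case: (set_0Vmem [set C in avoid F x | #|C :&: W| <= 1]) => [E|[C]]; last first.
  by rewrite inE => /andP[CA CW]; exists C.
exfalso; have two C : C \in avoid F x -> 2 <= #|C :&: W|.
  by move=> CA; move/setP/(_ C): E; rewrite in_set CA in_set0 /= => /negbT; rewrite -ltnNge.
have up : \sum_(C in avoid F x) #|C :&: W| * (#|C :&: W| - 1) +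
    \sum_(T in H) #|T :&: W| * (#|T :&: W| - 1) <= 6 * 30.
  rewrite !sum_card_pairs -big_split /=.
  apply: leq_trans (_ : \sum_(u in W) 6 * 5 <= _); last by rewrite sum_nat_const W6.
  apply: leq_sum => u uW; rewrite -big_split /=.
  apply: leq_trans (_ : \sum_(v in W :\ u) 6 <= _); last first.
    by rewrite sum_nat_const; have := cardsD1 u W; rewrite uW W6; clear; lia.
  apply: leq_sum => v; rewrite !inE => /andP[vu vW].
  have inj : #|[set T in H | (u \in T) && (v \in T)]| = #|[set x |: T | T in [set T in H | (u \in T) && (v \in T)]]|.
    rewrite card_in_imset // => T T'; rewrite !inE => /andP[TH _] /andP[T'H _].
    by apply: (link_inj (F := F)); apply: (subsetP HL).
  rewrite inj; apply: (over_disj6 (S := [set u; v]) sfF uF).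
  - by rewrite cards2 eq_sym vu.
  - by apply/subsetP => C; rewrite !inE sub2 -andbA => /and4P[-> _ -> ->].
  - apply/subsetP => C /imsetP[T]; rewrite inE => /and3P[TH uT vT] ->.
    by rewrite inE (xT TH).2 sub2 !inE uT vT !orbT.
  - apply/pred0P => C /=; apply/negP => /andP[+ /imsetP[T _ E']].
    by rewrite E' !inE eqxx andbF.
have : \sum_(C in avoid F x) 2 <= \sum_(C in avoid F x) #|C :&: W| * (#|C :&: W| - 1).
  by apply: leq_sum => C /two; case: #|_| => [|[|n]] // _; rewrite subSS subn0; nia.
have : \sum_(T in H) 6 <= \sum_(T in H) #|T :&: W| * (#|T :&: W| - 1).
  by apply: leq_sum => T TH; rewrite (setIidPl (HW TH)) uH.
rewrite !sum_nat_const; move: up big h10; clear; lia.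
Qed.

Section Low.

Variable C : {set V}.
Hypotheses (CA : C \in avoid F x) (CW : #|C :&: W| <= 1).
Let P := missed (avoid F x) C.

Let PP C' : C' \in P -> [/\ C' \in F, x \notin C' & [disjoint C' & C]].
Proof. by rewrite !inE -andbA => /and3P[]. Qed.
Let CF : C \in F.
Proof. by move: CA; rewrite inE => /andP[]. Qed.
Let xC : x \notin C.
Proof. by move: CA; rewrite inE => /andP[]. Qed.

(** Otherwise [x |: T], [C] and [C'] would be three disjoint members. *)
Lemma partner_hits C' T : C' \in P -> T \in L -> ~~ [disjoint T & C :|: C'].
Proof.
move=> /PP[C'F xC' D]; rewrite in_link disjoint_sym disjoints1 => /andP[xnT xTF].
apply/negP => DT; have n (A : {set V}) : x \notin A -> x |: T != A.
  by apply: contraNneq => <-; rewrite !inE eqxx.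
apply: (sfP sfF xTF CF C'F (n _ xC) (n _ xC')).
  have : 0 < #|C| by rewrite uF.
  by case/card_gt0P => v vC; apply/neqP; exists v; rewrite vC (disjointFl D vC).
move=> v; rewrite !inE; case: (eqVneq v x) => [->|vx]; first by rewrite (negbTE xC) (negbTE xC').
case vT: (v \in T) => /=.
  by have := disjointFr DT vT; rewrite inE => /norP[/negbTE-> /negbTE->].
by case vC: (v \in C); rewrite ?(disjointFl D vC) //; case: (v \in C').
Qed.

Lemma partner_ge3 C' : C' \in P -> 3 <= #|(C :|: C') :&: W|.
Proof.
move=> C'P; rewrite ltnNge; apply/negP => le2.
have [T TH D] := small_miss sfH uH W6 HW H9 le2.
by have := partner_hits C'P (subsetP HL _ TH); rewrite D.
Qed.

Lemma partner_card C' : C' \in P -> 3 <= #|C :&: W| + #|C' :&: W|.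
Proof.
by move=> /partner_ge3 g3; apply: leq_trans g3 _; rewrite setIUl cardsU leq_subr.
Qed.

Let hitH C' T : C' \in P -> T \in H -> ~~ [disjoint T & C :|: C'].
Proof. by move=> C'P /(subsetP HL); apply: partner_hits. Qed.

(* A member disjoint from [C] and avoiding [x] contains, up to points of [C], a block or a special triple. *)
Lemma low0 : #|C :&: W| = 0 -> #|missed H C| + #|P| + 5 * #|H| <= 70.
Proof.
move=> /eqP; rewrite cards_eq0 => /eqP CW0.
have E C' : (C :|: C') :&: W = C' :&: W by rewrite setIUl CW0 set0U.
have cov C' : C' \in P -> exists2 R, R \in H :|: sp & R \subset C'.
  move=> C'P; have := partner_ge3 C'P; rewrite E => g3.
  have [C'F xC' D] := PP C'P.
  have le4 : #|C' :&: W| <= 4 by rewrite -(uF C'F); apply: subset_leq_card; apply: subsetIl.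
  case: (ltngtP #|C' :&: W| 3) => [|g4|e3]; first by rewrite ltnNge g3.
    have e4 : #|C' :&: W| = 4 by apply/eqP; rewrite eqn_leq le4.
    have [|u _ Hu] := four_special sfH uH W6 (subsetIr C' W) e4 (subxx _); first by rewrite e4.
    exists ((C' :&: W) :\ u); first by rewrite in_setU.
    by rewrite (subset_trans (subD1set _ _)) ?subsetIl.
  exists (C' :&: W); last exact: subsetIl.
  rewrite in_setU; apply: (hit_special (X := C')) => //; first exact: subsetIr.
  move=> T TH; have /meets[v vT] := hitH C'P TH; rewrite inE => /orP[vC|vC']; last by apply/meets; exists v.
  by have : v \in C :&: W; [rewrite inE vC (subsetP (HW TH))|rewrite CW0 inE].
(* [x |: R] takes one of the two places over [R]. *)
have H1 : \sum_(R in H) #|[set C' in P | R \subset C']| <= #|H| * 1.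
  rewrite -sum_nat_const; apply: leq_sum => R RH; have [xR xRF] := xT RH.
  suff : #|[set C' in P | R \subset C']| + #|[set x |: R]| <= 2 by rewrite cards1; clear; lia.
  apply: (over_disj2 (S := R) sfF uF); rewrite ?uH //.
  - by apply/subsetP => C'; rewrite in_set => /andP[/PP[C'F _ _] RC]; rewrite mem_over C'F.
  - by rewrite sub1set mem_over xRF subsetUr.
  - rewrite disjoint_sym disjoints1 in_set; apply/negP => /andP[/PP[_]].
    by rewrite !inE eqxx.
have S2 : \sum_(R in sp) #|[set C' in P | R \subset C']| <= #|sp| * 2.
  rewrite -sum_nat_const; apply: leq_sum => R; rewrite inE => /and4P[_ /eqP R3 _ _].
  apply: leq_trans (over_le2 (S := R) sfF uF _); last by rewrite R3.
  apply/subset_leq_card/subsetP => C'; rewrite in_set => /andP[/PP[C'F _ _] RC]; by rewrite mem_over C'F.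
(* There are [20 - 2 * #|H|] special triples, so [P] has at most [40 - 3 * #|H|] members, and the
   total is at most [40 + 3 * #|H|], hence at most 70. *)
have := card_special uH iH W6 HW H9; rewrite -/sp.
have : #|missed H C| <= #|H| by apply: subset_leq_card; apply: setI_filter_sub.
have := leq_trans (leq_trans (cover_sum cov) (sum_setU_le _ _ _)) (leq_add H1 S2).
by move: h10; clear; lia.
Qed.

(** Since [C] supplies [p], a partner need only contain [R :\ p] for some [R] through [p] in [H] or
    special; this allows 3 partners per member of [H] and 6 per special triple. With [10 - #|H|]
    special triples at [p] and at most [#|H| - deg p] members of [H] missed, the total is at most
    [60 + 2 * deg p], and [deg p <= 5]. *)
Lemma low1 p : C :&: W = [set p] -> #|missed H C| + #|P| + 5 * #|H| <= 70.
Proof.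
move=> CWp; have : p \in C :&: W by rewrite CWp set11.
rewrite inE => /andP[pC pW].
have pC' C' : C' \in P -> p \notin C' by move=> /PP[_ _ D]; rewrite (disjointFl D pC).
pose K := [set R in H | p \in R] :|: [set R in sp | p \in R].
have cov C' : C' \in P -> exists2 R, R \in K & R :\ p \subset C'.
  move=> C'P; have [C'F xC' D] := PP C'P; have npC' := pC' _ C'P.
  have inK R : p \in R -> (R \in H) || (R \in sp) -> R \in K.
    by move=> pR; rewrite !in_setU !in_set pR !andbT.
  have := partner_ge3 C'P; rewrite setIUl CWp => g3.
  have cU : #|p |: (C' :&: W)| = #|C' :&: W|.+1 by rewrite cardsU1 inE (negbTE npC').
  have sub4 : p |: (C' :&: W) \subset W by rewrite subUset sub1set pW subsetIr.
  case: (ltngtP #|p |: (C' :&: W)| 3) => [|g4|e3]; first by rewrite ltnNge g3.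
    have /card_gt2P[a [b [c [[aR bR cR] [ab bc ca]]]]] : 2 < #|C' :&: W| by move: g4; rewrite cU.
    (* Exactly three points are kept beside [p], so that [four_special] removes one of them and
       leaves [p] in the triple. *)
    pose P' := [set a; b; c]; have P'C : P' \subset C' :&: W by rewrite sub3 aR bR.
    have pP' : p \notin P' by apply: contra npC' => /(subsetP P'C); rewrite inE => /andP[].
    have P'3 : #|P'| = 3 by rewrite cards3 // eq_sym.
    have [||||u uP' Hu] := four_special sfH uH W6 (R := p |: P') (P := P').
    - by rewrite subUset sub1set pW (subset_trans P'C) ?subsetIr.
    - by rewrite cardsU1 pP' P'3.
    - exact: subsetUr.
    - by rewrite P'3.
    exists ((p |: P') :\ u).
      by apply: inK => //; rewrite !in_setD1 setU11 andbT; apply: contraNneq pP' => ->.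
    apply/subsetP => v; rewrite in_setD1 in_setD1 in_setU1 => /and3P[/negbTE-> _] /= /(subsetP P'C).
    by rewrite inE => /andP[].
  have EX : p |: (C' :&: W) = (C :|: C') :&: W by rewrite setIUl CWp.
  exists (p |: (C' :&: W)).
    apply: inK; first by rewrite !inE eqxx.
    by apply: (hit_special sub4 e3 EX) => T TH; apply: hitH C'P TH.
  by apply/subsetP => v; rewrite !inE => /andP[/negbTE->] /= /andP[].
have cRp R : p \in R -> #|R| = 3 -> #|R :\ p| = 2 by move=> pR R3; have := cardsD1 p R; rewrite pR R3; clear; lia.
have H1 : \sum_(R in [set R in H | p \in R]) #|[set C' in P | R :\ p \subset C']| <= deg p * 3.
  rewrite -sum_nat_const; apply: leq_sum => R; rewrite inE => /andP[RH pR]; have [xR xRF] := xT RH.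
  set X := [set C' in P | _].
  have XP C' : C' \in X -> [/\ C' \in F, x \notin C', p \notin C' & R :\ p \subset C'].
    by rewrite in_set => /andP[C'P RC]; have [C'F xC' _] := PP C'P; rewrite pC'.
  have XF : X \subset F by apply/subsetP => C' /XP[].
  have lX : link X (R :\ p) \subset link F (R :\ p).
    by apply/subsetP => e; rewrite !in_link => /andP[->] /(subsetP XF).
  have ul : uniform 2 (link F (R :\ p)) by move=> e /(link_uniform uF); rewrite cRp // uH.
  rewrite -(over_self (X := X) (S := R :\ p)); last by move=> C' /XP[].
  rewrite -card_link; apply: graph_intersecting_le3.
  - exact: sfS lX (link_sf sfF).
  - exact: uniformS lX ul.
  have xp : x != p by apply: contraNneq xR => ->.
  (* The edge [xp] comes from [x |: R] and is disjoint from all edges of the link of [X], so two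
     disjoint edges there would complete a matching of three. *)
  have xpl : [set x; p] \in link F (R :\ p).
    rewrite in_link disjoint_sym disjoints_subset; apply/andP; split.
      by apply/subsetP => v; rewrite !inE => /andP[vp vR]; rewrite negb_or vp andbT; apply: contraNneq xR => <-.
    rewrite (_ : _ :|: _ = x |: R) //; apply/setP => v; rewrite !inE.
    by case: (eqVneq v p) => [->|_]; rewrite ?pR ?orbT //= orbF orbC.
  move=> e f el fl; case: (eqVneq e f) => [<-|ef].
    by have [u [v [_ ->]]] := card2E (uniformS lX ul el); exists u; rewrite !inE eqxx.
  apply/meets/negP => D.
  have dxp (e' : {set V}) : e' \in link X (R :\ p) -> [disjoint [set x; p] & e'].
    rewrite in_link => /andP[_ /XP[_]]; rewrite !inE !negb_or => /andP[_ xe] /andP[_ pe] _.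
    by rewrite disjoints_subset sub2 !inE xe pe.
  apply: (no_matching3 (link_sf sfF) ul xpl (subsetP lX _ el) (subsetP lX _ fl)) => //; exact: dxp.
have S2 : \sum_(R in [set R in sp | p \in R]) #|[set C' in P | R :\ p \subset C']| <= #|[set R in sp | p \in R]| * 6.
  rewrite -sum_nat_const; apply: leq_sum => R; rewrite in_set => /andP[]; rewrite inE => /and4P[_ /eqP R3 _ _] pR.
  apply: leq_trans (over_le6 (S := R :\ p) sfF uF _); last by rewrite cRp.
  by apply/subset_leq_card/subsetP => C'; rewrite in_set => /andP[/PP[C'F _ _] RC]; rewrite mem_over C'F.
have := card_special_at uH iH W6 HW H9 pW; rewrite -/sp.
have := deg_le5 sfH uH W6 HW H9 pW; rewrite -/(deg p).
have : #|missed H C| + deg p <= #|H|.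
  rewrite (card_split H (fun T => p \in T)) addnC leq_add2l; apply/subset_leq_card/subsetP => T.
  by rewrite !inE => /andP[-> D]; rewrite (disjointFl D pC).
have := leq_trans (leq_trans (cover_sum cov) (sum_setU_le _ _ _)) (leq_add H1 S2).
by move: h10; clear; lia.
Qed.

Lemma low_bound : #|cls F C set0| + 5 * #|H| <= 70 + #|missed J C|.
Proof.
rewrite (card_missed_link F xC); rewrite -/P.
have -> : #|missed (link F [set x]) C| = #|missed H C| + #|missed J C|.
  rewrite HJ.
  have -> : missed (H :|: J) C = missed H C :|: missed J C.
    by apply/setP => T; rewrite !inE andb_orl.
  rewrite cardsU disjoint_setI0 ?cards0 ?subn0 //.
  apply/pred0P => T /=; apply/negP; rewrite !inE => /andP[/andP[TH _] /andP[TJ _]].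
  by rewrite (disjointFr dHJ TH) in TJ.
suff : #|missed H C| + #|P| + 5 * #|H| <= 70 by clear; lia.
case: (posnP #|C :&: W|) => [/low0//|W1].
have /cards1P[p E] : #|C :&: W| == 1 by rewrite eqn_leq CW.
exact: low1 E.
Qed.

End Low.

End HighDegree.

(** * The weight inequality and its bootstrap *)

Lemma card_meet_full F A : uniform 4 F -> A \in F -> #|[set C in F | #|C :&: A| == 4]| <= 1.
Proof.
move=> uF AF; apply: leq_trans (cls_full uF AF); apply/subset_leq_card/subsetP => C.
by rewrite mem_cls in_set => /andP[-> /eqP CA] /=; rewrite eqEcard subsetIr CA uF.
Qed.

Lemma card_meet1 F A : #|[set C in F | #|C :&: A| == 1]| <= \sum_(x in A) #|cls F A [set x]|.
Proof.
apply: leq_trans (cover_sum (K := [in A]) (r := fun x => [pred C | C :&: A == [set x]]) _) _.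
  move=> C; rewrite in_set => /andP[_ /cards1P[x E]]; exists x; last by rewrite /= E.
  by have := set11 x; rewrite -E inE => /andP[].
apply: leq_sum => x xA; apply/subset_leq_card/subsetP => C; rewrite mem_cls !in_set.
by case/andP => /andP[->].
Qed.

Lemma setI_card3 A C : #|A| = 4 -> #|C :&: A| = 3 -> exists y, [/\ y \in A, y \notin C & C :&: A = A :\ y].
Proof.
move=> A4 C3; have /card_gt0P[y] : 0 < #|A :\: C|.
  by have := cardsID C A; rewrite A4 setIC C3; clear; lia.
rewrite in_setD => /andP[yC yA]; exists y; split=> //; apply/eqP.
rewrite eqEcard C3 subsetD1 subsetIr inE (negbTE yC) /=.
by have := cardsD1 y A; rewrite yA A4; clear; lia.
Qed.

(* A member meeting [A] in one, two or three points gets weight 6, 3 + 3 or 2 + 2 + 2. *)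
Lemma weight_le F A : uniform 4 F -> A \in F ->
  6 * #|F| <= 6 * #|cls F A set0| + 6 +
    \sum_(x in A) (6 * #|cls F A [set x]| + 3 * gsum F A x + 2 * tsum F A x).
Proof.
move=> uF AF; pose K n := [set C in F | #|C :&: A| == n].
have cF : #|F| <= #|K 0| + #|K 1| + #|K 2| + #|K 3| + #|K 4|.
  apply: leq_trans (_ : #|K 0 :|: K 1 :|: K 2 :|: K 3 :|: K 4| <= _).
    apply/subset_leq_card/subsetP => C CF; rewrite !in_setU !in_set CF /=.
    have : #|C :&: A| <= 4 by rewrite -(uF _ AF) subset_leq_card ?subsetIr.
    by case: #|_| => [|[|[|[|[|n]]]]].
  by do 4 (apply: leq_trans (card_setU_le _ _) _; rewrite leq_add2r).
have K0 : #|K 0| <= #|cls F A set0|.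
  by apply/subset_leq_card/subsetP => C; rewrite mem_cls in_set cards_eq0.
have K4 := card_meet_full uF AF; have K1 := card_meet1 F A.
have K2 : 2 * #|K 2| <= \sum_(x in A) gsum F A x.
  rewrite mulnC -sum_nat_const.
  apply: leq_trans (_ : \sum_(C in K 2) #|C :&: A| * (#|C :&: A| - 1) <= _).
    by apply: leq_sum => C; rewrite in_set => /andP[_ /eqP->].
  rewrite sum_card_pairs; apply: leq_sum => x xA; apply: leq_sum => y.
  rewrite in_setD1 => /andP[yx yA]; apply/subset_leq_card/subsetP => C.
  rewrite mem_cls !in_set -!andbA => /and4P[-> /eqP CA xC yC] /=.
  by rewrite (@card2E2 (C :&: A) x y) // ?inE ?xC ?yC // eq_sym.
have K3 : 3 * #|K 3| <= \sum_(x in A) tsum F A x.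
  rewrite mulnC -sum_nat_const.
  apply: leq_trans (_ : \sum_(C in K 3) #|C :&: A| <= _).
    by apply: leq_sum => C; rewrite in_set => /andP[_ /eqP->].
  under eq_bigr do rewrite card_ind.
  rewrite exchange_big /=; apply: leq_sum => x xA; rewrite -card_sum_ind.
  apply: leq_trans (cover_sum (K := [in A :\ x]) (r := fun y => [pred C | C :&: A == A :\ y]) _) _.
    move=> C; rewrite !in_set => /andP[/andP[_ /eqP C3] xC].
    have [y [yA yC E]] := setI_card3 (uF _ AF) C3; exists y; last by rewrite /= E.
    by rewrite in_setD1 yA andbT; apply: contraNneq yC => ->.
  apply: leq_sum => y yA; apply/subset_leq_card/subsetP => C; rewrite mem_cls !in_set.
  by case/andP => /andP[/andP[->]].
have -> : \sum_(x in A) (6 * #|cls F A [set x]| + 3 * gsum F A x + 2 * tsum F A x) =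
    6 * (\sum_(x in A) #|cls F A [set x]|) + 3 * (\sum_(x in A) gsum F A x) + 2 * \sum_(x in A) tsum F A x.
  by rewrite !big_distrr -!big_split.
by move: cF K0 K1 K2 K3 K4; rewrite -/(K 1) -/(K 4); clear; lia.
Qed.

Section Stages.

Variable F : {set {set V}}.
Hypotheses (sfF : sf F) (uF : uniform 4 F) (F84 : #|F| = 84).

Let n0 A := #|cls F A set0|.
Let hv A x := #|cls F A [set x]|.
Let val A x := 6 * hv A x + 3 * gsum F A x + 2 * tsum F A x.

(** 498 is [6 * 84 - 6], where the subtracted 6 is the weight of [A] itself. *)
Lemma n0_ge (v : nat) A : A \in F -> (forall x, x \in A -> val A x <= v) -> 498 <= 6 * n0 A + 4 * v.
Proof.
move=> AF le_v; have := weight_le uF AF; rewrite F84.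
have : \sum_(x in A) val A x <= \sum_(x in A) v by apply: leq_sum.
by rewrite sum_nat_const (uF AF) /val /n0 /hv; clear; lia.
Qed.

Let uL x : uniform 3 (link F [set x]).
Proof. by move=> T /(link_uniform uF); rewrite cards1. Qed.

Lemma hv_link A x : x \in A -> hv A x = #|cls (link F [set x]) (A :\ x) set0|.
Proof. by move=> xA; rewrite cls_link ?inE // setU0. Qed.

Lemma val_le73 A x : A \in F -> x \in A -> hv A x <= 8 -> val A x <= 73.
Proof.
move=> AF xA; rewrite /val gsum_link // tsum_link // hv_link //.
by apply: vertex_val (link_sf sfF) (@uL x) (setD1_link AF xA).
Qed.

(** [J] consists of the triples of the link that meet [A :\ x]. The weight bound writes
    [3 * g + 2 * t] as [2 * (g + t) + g] and uses [g + t < #|J|] and [g <= 6]. *)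
Lemma link_parts A x : A \in F -> x \in A -> 8 < hv A x -> exists H J,
  [/\ link F [set x] = H :|: J, [disjoint H & J], intersecting H & intersecting J] /\
  [/\ #|H| = hv A x, #|H| <= 10, #|J| <= 10 & val A x <= 6 * #|H| + 2 * #|J| + 4].
Proof.
move=> AF xA h9; set L := link F [set x]; pose Q := A :\ x.
have sfL : sf L := link_sf sfF.
have QL : Q \in L := setD1_link AF xA.
have Q0 : Q != set0 by rewrite -card_gt0 (uL QL).
have h9' : 8 < #|cls L Q set0| by rewrite -hv_link.
have [iJ J10 g6] := vertex_ge9 sfL (@uL x) QL h9'.
exists (cls L Q set0), [set C in L | ~~ [disjoint C & Q]]; split.
  split=> //; last exact: cls0_intersecting sfL (@uL x) QL Q0.
    by apply/setP => C; rewrite in_setU mem_cls in_set -andb_orr -setI_eq0 orbN andbT.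
  rewrite disjoints_subset; apply/subsetP => C; rewrite mem_cls in_setC => /andP[_ CQ].
  by rewrite in_set -setI_eq0 CQ andbF.
split=> //; first by rewrite hv_link.
  exact: vertex_h sfL (@uL x) QL.
have := vertex_J (@uL x) QL; have := vertex_t sfL (@uL x) QL; move: g6.
rewrite /val gsum_link // tsum_link // hv_link // -/L -/Q.
move: (\sum_(_ in _) _) (\sum_(_ in _) _) #|_| #|_|; clear; lia.
Qed.

Section Parts.
Variables (H J : {set {set V}}) (x : V).
Hypotheses (HJ : link F [set x] = H :|: J) (dHJ : [disjoint H & J]) (iH : intersecting H).
Hypotheses (H9 : 8 < #|H|) (H10 : #|H| <= 10) (J10 : #|J| <= 10).

Let HL : H \subset link F [set x]. Proof. by rewrite HJ subsetUl. Qed.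
Let JL : J \subset link F [set x]. Proof. by rewrite HJ subsetUr. Qed.
Let sfL : sf (link F [set x]) := link_sf sfF.
Let sfH : sf H := sfS HL sfL.
Let uH : uniform 3 H := uniformS HL (@uL x).

(** At least [74 - #|H|] members avoid [x], which exceeds [90 - 3 * #|H|] as soon as [#|H|] is at
    least 9. *)
Lemma low_avoid (W : {set V}) : #|W| = 6 -> (forall T, T \in H -> T \subset W) ->
  exists2 C, C \in avoid F x & #|C :&: W| <= 1.
Proof.
move=> W6 HW; apply: (exists_low sfF uF HJ dHJ iH H9 W6 HW).
have LHJ : #|link F [set x]| <= #|H| + #|J| by rewrite HJ card_setU_le.
by have := card_avoid F x; rewrite F84; move: LHJ H9 H10 J10; clear; lia.
Qed.

Lemma low_n0 : exists2 C, C \in F & n0 C + 5 * #|H| <= 70 + #|J|.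
Proof.
have [W W6 HW] := intersecting_ge9_support sfH uH iH H9.
have [C CA CW] := low_avoid W6 HW; exists C; first by move: CA; rewrite inE => /andP[].
apply: leq_trans (low_bound sfF uF HJ dHJ iH H9 W6 HW CA CW) _.
by rewrite leq_add2l subset_leq_card // setI_filter_sub.
Qed.

Hypotheses (iJ : intersecting J) (J9 : 8 < #|J|).

(** The supports of [H] and [J] are disjoint, as a common point would have degree 4 + 4 in the link,
    above 6. The four points of a partner [C'] cannot serve both supports, so [C] meets [W'], and
    with it at least four members of [J]. *)
Lemma low_n0_both : exists2 C, C \in F & n0 C <= 20 \/ n0 C + 5 * #|H| <= 66 + #|J|.
Proof.
have sfJ : sf J := sfS JL sfL.
have uJ : uniform 3 J := uniformS JL (@uL x).
have JH : link F [set x] = J :|: H by rewrite HJ setUC.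
have [W W6 HW] := intersecting_ge9_support sfH uH iH H9.
have [W' W'6 JW'] := intersecting_ge9_support sfJ uJ iJ J9.
have dW : [disjoint W & W'].
  apply/negPn/negP => /meets[p pW pW'].
  have := deg_ge4 sfH uH W6 HW H9 pW; have := deg_ge4 sfJ uJ W'6 JW' J9 pW'.
  suff : #|[set T in H | p \in T]| + #|[set T in J | p \in T]| <= 6 by clear; lia.
  apply: (over_disj6 (S := [set p]) sfL (@uL x)); rewrite ?cards1 //.
  - by apply/subsetP => T; rewrite in_set mem_over sub1set => /andP[/(subsetP HL)->].
  - by apply/subsetP => T; rewrite in_set mem_over sub1set => /andP[/(subsetP JL)->].
  rewrite disjoints_subset; apply/subsetP => T; rewrite in_setC !in_set => /andP[TH _].
  by rewrite (disjointFr dHJ TH).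
have [C CA CW] := low_avoid W6 HW; exists C; first by move: CA; rewrite inE => /andP[].
have [CF xC] : C \in F /\ x \notin C by move: CA; rewrite inE => /andP[].
(* Without a partner, only members through [x] are disjoint from [C], and the link has at most 10 +
   10 triples. *)
case: (set_0Vmem (missed (avoid F x) C)) => [P0|[C' C'P]].
  left; rewrite /n0 (card_missed_link F xC) P0 cards0 addn0.
  apply: leq_trans (subset_leq_card (setI_filter_sub _ _)) _.
  by rewrite HJ; apply: leq_trans (card_setU_le _ _) _; move: H10 J10; clear; lia.
right; have := low_bound sfF uF HJ dHJ iH H9 W6 HW CA CW; rewrite -/(n0 C).
have p1 := partner_card sfF uF HJ H9 W6 HW CA C'P.
have p2 := partner_card sfF uF JH J9 W'6 JW' CA C'P.
have C'4 : #|C' :&: W| + #|C' :&: W'| <= 4.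
  have C'F : C' \in F by move: C'P; rewrite in_set => /andP[]; rewrite inE => /andP[].
  rewrite -(uF C'F) -cardsUI (_ : _ :&: (_ :&: _) = set0) ?cards0 ?addn0.
    by rewrite -setIUr subset_leq_card ?subsetIl.
  by rewrite setIACA setIid (disjoint_setI0 dW) setI0.
have /card_gt0P[u] : 0 < #|C :&: W'| by move: p1 p2 C'4 CW; clear; lia.
rewrite inE => /andP[uC uW'].
have : #|missed J C| <= #|J| - 4.
  apply: leq_trans (miss1_le5 sfJ uJ W'6 JW' J9 uW'); apply: leq_filter => T _ D.
  by rewrite (disjointFl D uC).
by move: J9; clear; lia.
Qed.

End Parts.

(** For [#|J| <= 8] the extremes are [#|H| = 10], with weight at most 80 and [N <= 28], and
    [#|H| = 9], with weight at most 74 and [N <= 33]. For larger [J] only [#|H| = #|J| = 9]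
    survives, with weight at most 76 and [N <= 30]. *)
Lemma high_degree N A x : 27 <= N -> (forall C, C \in F -> N <= n0 C) -> A \in F -> x \in A ->
  8 < hv A x -> [/\ N <= 33, val A x <= 80, 30 <= N -> val A x <= 76 & 33 <= N -> val A x <= 74].
Proof.
move=> N27 geN AF xA h9; have [H [J [[HJ dHJ iH iJ] [Hh H10 J10 vle]]]] := link_parts AF xA h9.
rewrite -Hh in h9.
have [C CF le0] := low_n0 HJ dHJ iH h9 H10 J10; have NC := geN _ CF.
case: (ltnP 8 #|J|) => J9; last by split; move: N27 NC le0 vle h9 H10 J9; clear; lia.
have [C1 /geN NC1 le1] := low_n0_both HJ dHJ iH h9 H10 J10 iJ J9.
have JH : link F [set x] = J :|: H by rewrite HJ setUC.
have dJH : [disjoint J & H] by rewrite disjoint_sym.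
have [C2 /geN NC2 le2] := low_n0_both JH dJH iJ J9 J10 H10 iH h9.
by split; move: N27 NC le0 NC1 le1 NC2 le2 vle h9 H10 J9 J10; clear; lia.
Qed.

(* Bootstrapping: excluding the largest values of [val] raises the lower bound on [n0], which excludes the next ones. *)
Lemma degree_le8 A x : A \in F -> x \in A -> hv A x <= 8.
Proof.
(* 503 is 498 + 5; the slack of 5 rounds the quotient by 6 up. *)
have step N (v : nat) M : 27 <= N -> 6 * M + 4 * v <= 503 ->
    (forall C, C \in F -> N <= n0 C) ->
    (forall A x, A \in F -> x \in A -> 8 < hv A x -> val A x <= v) -> 73 <= v ->
    forall C, C \in F -> M <= n0 C.
  move=> N27 Mv geN le_v v73 C CF.
  have : 498 <= 6 * n0 C + 4 * v.
    apply: (n0_ge CF) => y yC; case: (leqP (hv C y) 8) => [/(val_le73 CF yC)|/(le_v _ _ CF yC)//].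
    by move/leq_trans; apply.
  by move: Mv; clear; lia.
have n27 C : C \in F -> 27 <= n0 C.
  (* 84 is [6 * 10 + 2 * 10 + 4], the largest weight left by [link_parts]. *)
  move=> CF; have : 498 <= 6 * n0 C + 4 * 84; last by clear; lia.
  apply: (n0_ge CF) => y yC; case: (leqP (hv C y) 8) => [/(val_le73 CF yC)|h9].
    by move/leq_trans; apply.
  have [H [J [_ [_ H10 J10]]]] := link_parts CF yC h9.
  by move/leq_trans; apply; move: H10 J10; clear; lia.
have n30 : forall C, C \in F -> 30 <= n0 C.
  apply: (step 27 80) => // A' y A'F yA' h9.
  by have [] := high_degree (leqnn 27) n27 A'F yA' h9.
have n33 : forall C, C \in F -> 33 <= n0 C.
  apply: (step 30 76) => // A' y A'F yA' h9.
  by have [_ _ /(_ isT)] := high_degree (isT : 27 <= 30) n30 A'F yA' h9.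
have n34 : forall C, C \in F -> 34 <= n0 C.
  apply: (step 33 74) => // A' y A'F yA' h9.
  by have [_ _ _ /(_ isT)] := high_degree (isT : 27 <= 33) n33 A'F yA' h9.
move=> AF xA; rewrite leqNgt; apply/negP => h9.
by have [] := high_degree (isT : 27 <= 34) n34 AF xA h9.
Qed.

Lemma n0_ge35 A : A \in F -> 35 <= n0 A.
Proof.
move=> AF; have : 498 <= 6 * n0 A + 4 * 73; last by clear; lia.
by apply: (n0_ge AF) => x xA; apply: val_le73 (degree_le8 AF xA).
Qed.

End Stages.

(** * Reduction to an intersecting subfamily *)

Section Bipartite.

Variable F : {set {set V}}.
Hypotheses (sfF : sf F) (uF : uniform 4 F) (F84 : #|F| = 84).

Let N A := cls F A set0.
Let N35 A : A \in F -> 35 <= #|N A|.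
Proof. exact: n0_ge35. Qed.

Let mem_N A C : (C \in N A) = (C \in F) && [disjoint C & A].
Proof. by rewrite mem_cls -setI_eq0. Qed.

Let N_disjoint A B C : A \in F -> B \in F -> [disjoint A & B] -> C \in N A -> C \in N B -> False.
Proof.
move=> AF BF dAB; rewrite !mem_N => /andP[CF dCA] /andP[_ dCB].
have A0 : A != set0 by rewrite -card_gt0 uF.
have iN : intersecting (N A) := cls0_intersecting sfF uF AF A0.
have [||v vB vC] := iN B C; rewrite ?mem_N ?BF ?CF ?dCA //; first by rewrite disjoint_sym dAB.
by rewrite (disjointFr dCB vC) in vB.
Qed.

(** Among any three sets of a 5-cycle two are consecutive, so by [N_disjoint] no member is disjoint
    from three of them. *)
Let five_cycle A B C D E : A \in F -> B \in F -> C \in F -> D \in F -> E \in F ->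
  [disjoint A & B] -> [disjoint B & C] -> [disjoint C & D] -> [disjoint D & E] -> [disjoint E & A] -> False.
Proof.
move=> AF BF CF DF EF dAB dBC dCD dDE dEA.
have cN Q : #|N Q| = \sum_(S in F) (S \in N Q).
  rewrite -card_sum_ind; congr #|pred_of_set _|; apply/setP => S.
  by rewrite [RHS]in_set mem_N andbA andbb.
have : #|N A| + #|N B| + #|N C| + #|N D| + #|N E| <= \sum_(S in F) 2.
  rewrite !cN -!big_split /=; apply: leq_sum => S SF.
  have := N_disjoint AF BF dAB (C := S); have := N_disjoint BF CF dBC (C := S).
  have := N_disjoint CF DF dCD (C := S); have := N_disjoint DF EF dDE (C := S).
  have := N_disjoint EF AF dEA (C := S).
  by (do 5 case: (S \in N _)); move=> //= h1 h2 h3 h4 h5; exfalso; auto.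
rewrite sum_nat_const F84.
by move: (N35 AF) (N35 BF) (N35 CF) (N35 DF) (N35 EF); clear; lia.
Qed.

(** The members having no common neighbour with [Q] in the disjointness graph. For an edge [AB] of
    this graph, [far A] and [far B] serve as the two colour classes. *)
Let far Q := [set C in F | [forall (S | S \in N Q), ~~ [disjoint S & C]]].

(** For disjoint [C] and [C'] in [far Q] the neighbourhoods of [Q], [C] and [C'] would be disjoint,
    and [3 * 35] exceeds 84. *)
Let far_intersecting Q : Q \in F -> intersecting (far Q).
Proof.
move=> QF C C'; rewrite !in_set => /andP[CF /forall_inP fC] /andP[C'F /forall_inP fC'].
apply/meets/negP => dCC'.
have dN : [disjoint N C & N C'].
  by apply/pred0P => S; apply/negP => /andP[SC SC']; apply: (N_disjoint CF C'F dCC' SC SC').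
have dN' : [disjoint N Q & N C :|: N C'].
  rewrite disjoints_subset; apply/subsetP => S SQ; rewrite !inE negb_or.
  by move: (fC _ SQ) (fC' _ SQ); rewrite -!setI_eq0 => /negbTE-> /negbTE->; rewrite !andbF.
have : #|N Q :|: (N C :|: N C')| <= 84.
  by rewrite -F84; apply/subset_leq_card; rewrite !subUset !setI_filter_sub.
rewrite cardsU (disjoint_setI0 dN') cards0 subn0 cardsU (disjoint_setI0 dN) cards0 subn0.
by move: (N35 CF) (N35 C'F) (N35 QF); clear; lia.
Qed.

Lemma large_intersecting : exists G : {set {set V}}, [/\ G \subset F, intersecting G & 42 <= #|G|].
Proof.
have /card_gt0P[A AF] : 0 < #|F| by rewrite F84.
have /card_gt0P[B] : 0 < #|N A| by have := N35 AF; case: #|_|.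
rewrite mem_N => /andP[BF dBA].
have cov : #|F| <= #|far A| + #|far B|.
  apply: cardU2; apply/subsetP => C CF; rewrite in_setU !in_set CF /=.
  (* A member [C] in neither part has a common neighbour [S] with [A] and [R] with [B], closing the
     5-cycle [A], [S], [C], [R], [B]. *)
  apply/norP => -[]; rewrite !negb_forall_in => /exists_inP[S + /negPn dS] /exists_inP[R + /negPn dR].
  rewrite !mem_N => /andP[SF dSA] /andP[RF dRB].
  apply: (five_cycle AF SF CF RF BF) => //; by rewrite disjoint_sym.
have sub Q : far Q \subset F by apply: setI_filter_sub.
case: (leqP 42 #|far A|) => [big|small].
  by exists (far A); split=> //; apply: far_intersecting.
exists (far B); split=> //; first exact: far_intersecting.
by move: cov small; rewrite F84; clear; lia.
Qed.

End Bipartite.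

(** * Intersecting families of 4-sets *)

Section Petal.

Variable X : {set {set V}}.
Hypotheses (sfX : sf X) (uX : uniform 4 X) (iX : intersecting X).
Variables A C0 : {set V}.
Hypotheses (AX : A \in X) (C0X : C0 \in X) (C0A : #|C0 :&: A| = 1).

(** Members meeting [A] in one point are sorted by the size of their trace on [T], which
    [petal_meets] shows to be nonempty. The target is 14 for size 1 and 10 for sizes 2 and 3
    together. *)
Let T := C0 :\: A.
Let D := A :|: C0.
Let M k := [set C in X | (#|C :&: A| == 1) && (#|C :&: T| == k)].

Let T3 : #|T| = 3.
Proof. by have := cardsID A C0; rewrite (uX C0X) C0A -/T; clear; lia. Qed.

Let DE v : (v \in D) = (v \in A) || (v \in T).
Proof. by rewrite !inE; case: (v \in A). Qed.

Let T_A v : v \in T -> v \notin A.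
Proof. by rewrite inE => /andP[]. Qed.

Lemma card1_eq (S : {set V}) u v : #|S| = 1 -> u \in S -> v \in S -> u = v.
Proof. by move=> /eqP/cards1P[w ->]; rewrite !inE => /eqP-> /eqP->. Qed.

(** Over [S] these members become edges with exactly one end in [A], a bipartite graph. *)
Lemma pair_le4 (S : {set V}) : #|S| = 2 -> [disjoint S & A] ->
  #|[set C in X | (#|C :&: A| == 1) && (S \subset C)]| <= 4.
Proof.
move=> S2 dSA; set Y := [set C in X | _].
have YX : Y \subset X := setI_filter_sub _ _.
have lY : link Y S \subset link X S.
  by apply/subsetP => e; rewrite !in_link => /andP[->] /(subsetP YX).
rewrite -(over_self (X := Y) (S := S)); last by move=> C; rewrite in_set => /and3P[].
rewrite -card_link; apply: (@bipartite_le4 (link Y S) A).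
- exact: sfS lY (link_sf sfX).
- by apply: uniformS lY _ => e /(link_uniform uX); rewrite S2.
move=> e; rewrite in_link in_set => /and4P[_ _ /eqP SeA _].
by rewrite -SeA setIUl (disjoint_setI0 dSA) set0U.
Qed.

(** If distinct [C] and [C'] share their point of [A], the point in exactly two of [A], [C], [C'] is
    off [A]; if their points of [A] differ, their common point is off [A]. *)
Lemma meet_off_A C C' : C \in X -> C' \in X -> #|C :&: A| = 1 -> #|C' :&: A| = 1 ->
  exists v, [/\ v \notin A, v \in C & v \in C'].
Proof.
move=> CX C'X CA C'A; case: (eqVneq C C') => [<-|CC'].
  have /card_gt0P[v] : 0 < #|C :\: A| by have := cardsID A C; rewrite (uX CX) CA; clear; lia.
  by rewrite inE => /andP[vA vC]; exists v.
have nA (S : {set V}) : #|S :&: A| = 1 -> A != S.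
  by apply: contra_eq_neq => <-; rewrite setIid uX.
have /cards1P[y Ey] : #|C :&: A| == 1 by rewrite CA.
have /cards1P[y' Ey'] : #|C' :&: A| == 1 by rewrite C'A.
have inC v : v \in A -> (v \in C) = (v == y) by move=> vA; move/setP/(_ v): Ey; rewrite !inE vA andbT.
have inC' v : v \in A -> (v \in C') = (v == y') by move=> vA; move/setP/(_ v): Ey'; rewrite !inE vA andbT.
case: (eqVneq y y') => [yy'|yy'].
  have [v E] := sfX AX CX C'X (nA _ CA) (nA _ C'A) CC'; exists v; move: E.
  case: (boolP (v \in A)) => vA; first by rewrite inC // inC' // yy'; case: (_ == _).
  by case: (v \in C); case: (v \in C').
have [v vC vC'] := iX CX C'X; exists v; split=> //.
apply/negP => vA; move: vC vC'; rewrite inC // inC' // => /eqP->.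
by rewrite (negbTE yy').
Qed.

Lemma petal_meets C : C \in X -> #|C :&: A| = 1 -> 0 < #|C :&: T|.
Proof.
move=> CX CA; have [v [vA vC v0]] := meet_off_A CX C0X CA C0A.
by apply/card_gt0P; exists v; rewrite !inE vC v0 vA.
Qed.

(** At most four members lie over each pair in [T], those of [M 3] included, so
    [#|M 2| <= 3 * (4 - #|M 3|)]. The sum is at most [12 - 2 * #|M 3|], and [C0] belongs to
    [M 3]. *)
Lemma petal_M23 : #|M 2| + #|M 3| <= 10.
Proof.
have Z4 t : t \in T -> #|[set C in X | (#|C :&: A| == 1) && (T :\ t \subset C)]| <= 4.
  move=> tT; apply: pair_le4; first by have := cardsD1 t T; rewrite tT T3; clear; lia.
  by rewrite disjoints_subset; apply/subsetP => v; rewrite !inE => /andP[_ /andP[]].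
have sT C : C \in M 3 -> T \subset C.
  by rewrite in_set => /and3P[_ _ /eqP C3]; apply/setIidPr/eqP; rewrite eqEcard subsetIr C3 T3.
have E t : t \in T -> #|[set C in M 2 | T :\ t \subset C]| + #|M 3| <= 4.
  move=> /Z4; apply: leq_trans.
  have d : [disjoint [set C in M 2 | T :\ t \subset C] & M 3].
    rewrite disjoints_subset; apply/subsetP => C; rewrite in_setC !in_set.
    by case/andP => /and3P[-> -> /eqP->].
  rewrite -cardsUI (disjoint_setI0 d) cards0 addn0; apply/subset_leq_card/subsetP => C.
  rewrite in_setU => /orP[|C3].
    by rewrite !in_set => /andP[/and3P[-> ->]].
  have := sT _ C3; move: C3; rewrite !in_set => /and3P[-> -> _] /= /(subset_trans _); apply.
  exact: subD1set.
have M3 : 0 < #|M 3|.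
  apply/card_gt0P; exists C0; rewrite in_set C0X C0A eqxx /=.
  by rewrite (setIidPr (subsetDl _ _)) T3.
have /card_gt0P[t0 /E M34] : 0 < #|T| by rewrite T3.
have : #|M 2| <= \sum_(t in T) (4 - #|M 3|).
  apply: leq_trans (cover_sum (K := [in T]) (r := fun t => [pred C : {set V} | T :\ t \subset C]) _) _.
    move=> C; rewrite in_set => /and3P[_ _ /eqP C2].
    have /card_gt0P[t] : 0 < #|T :\: C| by have := cardsID C T; rewrite T3 setIC C2; clear; lia.
    rewrite inE => /andP[tC tT]; exists t => //=.
    rewrite (_ : T :\ t = C :&: T) ?subsetIl //; apply/esym/eqP.
    rewrite eqEcard C2 subsetD1 subsetIr inE (negbTE tC) /=.
    by have := cardsD1 t T; rewrite tT T3; clear; lia.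
  by apply: leq_sum => t /E tE; rewrite leq_subRL 1?addnC // (leq_trans (leq_addl _ _) M34).
rewrite sum_nat_const T3; move: M3 M34; clear; lia.
Qed.

(** For [C] in [M 1] this is an edge; the count of [M 1] depends on whether these edges meet
    pairwise. *)
Let r C := C :\: D.

Let MX C : C \in M 1 -> [/\ C \in X, #|C :&: A| = 1 & #|C :&: T| = 1].
Proof. by rewrite in_set => /and3P[-> /eqP-> /eqP->]. Qed.

Let r2 C : C \in M 1 -> #|r C| = 2.
Proof.
move=> /MX[CX CA CT]; have := cardsID D C; rewrite (uX CX).
have -> : C :&: D = (C :&: A) :|: (C :&: T).
  by apply/setP => v; rewrite in_setI DE !in_setU !in_setI andb_orr.
have := cardsUI (C :&: A) (C :&: T); rewrite CA CT.
rewrite (_ : _ :&: _ :&: _ = set0) ?cards0; first by rewrite /r; clear; lia.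
apply/setP => v; rewrite !in_setI in_set0; apply/negP => /andP[/andP[_ vA] /andP[_ /T_A]].
by rewrite vA.
Qed.

Let T_uniq C u v : C \in M 1 -> u \in T -> v \in T -> u \in C -> v \in C -> u = v.
Proof. by move=> /MX[_ _ CT] uT vT uC vC; apply: (card1_eq CT); rewrite inE ?uC ?vC. Qed.

Let tP C : C \in M 1 -> exists2 t, t \in T & t \in C.
Proof.
move=> /MX[_ _ CT]; have /card_gt0P[t] : 0 < #|C :&: T| by rewrite CT.
by rewrite inE => /andP[tC tT]; exists t.
Qed.

Let cross C C' t : C \in M 1 -> C' \in M 1 -> t \in T -> t \in C -> t \notin C' ->
  exists2 v, v \in r C & v \in r C'.
Proof.
move=> CM C'M tT tC tC'; have [CX CA _] := MX CM; have [C'X C'A _] := MX C'M.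
have [v [vA vC vC']] := meet_off_A CX C'X CA C'A.
have vT : v \notin T.
  by apply/negP => vT; rewrite (T_uniq CM tT vT tC vC) vC' in tC'.
by exists v; rewrite in_setD DE negb_or vA vT.
Qed.

(** The point in exactly two of [C], [C'], [C0] is off [A] by hypothesis and off [T] because [t]
    lies in all three and the other points of [T] in [C0] only. *)
Let same C C' t : C \in M 1 -> C' \in M 1 -> t \in T -> t \in C -> t \in C' ->
  (forall v, v \in A -> (v \in C) + (v \in C') + (v \in C0) != 2) ->
  exists2 v, v \in r C & v \in r C'.
Proof.
move=> CM C'M tT tC tC' off; case: (eqVneq C C') => [<-|CC'].
  by have /card_gt0P[v vr] : 0 < #|r C|; [rewrite r2|exists v].
have [CX CA CT] := MX CM; have [C'X C'A C'T] := MX C'M.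
have n0 (S : {set V}) : #|S :&: T| = 1 -> S != C0.
  by apply: contra_eq_neq => ->; rewrite (setIidPr (subsetDl _ _)) T3.
have [v E] := sfX CX C'X C0X CC' (n0 _ CT) (n0 _ C'T).
have vA : v \notin A by apply/negP => /off; rewrite E.
have vT : v \notin T.
  apply/negP => vT; have v0 : v \in C0 by move: vT; rewrite inE => /andP[].
  case: (eqVneq v t) => [vt|vt]; first by rewrite vt in E v0; rewrite tC tC' v0 in E.
  have vC : v \notin C by apply: contra vt => vC; rewrite (T_uniq CM vT tT vC tC).
  have vC' : v \notin C' by apply: contra vt => vC'; rewrite (T_uniq C'M vT tT vC' tC').
  by rewrite (negbTE vC) (negbTE vC') v0 in E.
have v0 : v \notin C0 by apply: contra vT => v0; rewrite inE vA.
exists v; rewrite in_setD DE negb_or vA vT /=; move: E; rewrite (negbTE v0).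
  by case: (v \in C) => //; case: (v \in C').
by case: (v \in C') => //; case: (v \in C).
Qed.

Let E (S : {set V}) := [set C in M 1 | S \subset C].

Let EE S C : (C \in E S) = (C \in M 1) && (S \subset C).
Proof. exact: in_set. Qed.

Let E_le4 (S : {set V}) : #|S| = 2 -> [disjoint S & A] -> #|E S| <= 4.
Proof.
move=> S2 dSA; apply: leq_trans (pair_le4 S2 dSA); apply/subset_leq_card/subsetP => C.
by rewrite !in_set => /andP[/and3P[-> ->]].
Qed.

Let E_le2 (S : {set V}) : #|S| = 3 -> #|E S| <= 2.
Proof.
move=> S3; apply: leq_trans (over_le2 (S := S) sfX uX _); last by rewrite S3.
by apply/subset_leq_card/subsetP => C; rewrite !in_set => /andP[/and3P[-> _ _]].
Qed.

Let notA v : v \notin D -> v \notin A.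
Proof. by rewrite DE negb_or => /andP[]. Qed.

Let E_pair u v : u != v -> u \notin A -> v \notin A -> #|E [set u; v]| <= 4.
Proof.
move=> uv uA vA; apply: E_le4; first by rewrite cards2 uv.
by rewrite disjoints_subset sub2 !in_setC uA.
Qed.

Let T_neq t v : t \in T -> v \notin D -> t != v.
Proof. by move=> tT; rewrite DE negb_or => /andP[_]; apply: contraNneq => <-. Qed.

Let E_Tpair t v : t \in T -> v \notin D -> #|E [set t; v]| <= 4.
Proof. by move=> tT vD; apply: E_pair; [apply: T_neq|apply: T_A|apply: notA]. Qed.

Let E_Ttriple t u v : t \in T -> u \notin D -> v \notin D -> u != v -> #|E [set t; u; v]| <= 2.
Proof. by move=> tT uD vD uv; apply: E_le2; rewrite cards3 // T_neq. Qed.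

Let rE C u v : C \in M 1 -> u \notin D -> v \notin D -> u != v -> u \in C -> v \in C -> r C = [set u; v].
Proof. by move=> CM uD vD uv uC vC; apply: (card2E2 (r2 CM)); rewrite ?in_setD ?uD ?vD. Qed.

Let r_C C v : v \in r C -> v \in C /\ v \notin D.
Proof. by rewrite in_setD => /andP[]. Qed.

(** If the edges form a star at [w], there are at most four members for each of the three pairs [tw]
    with [t] in [T]; if they form a triangle, at most four for each side. *)
Let all_meet : (forall C C', C \in M 1 -> C' \in M 1 -> exists2 v, v \in r C & v \in r C') -> #|M 1| <= 12.
Proof.
move=> meet; case: (set_0Vmem (M 1)) => [->|[C1 C1M]]; first by rewrite cards0.
pose G := [set r C | C in M 1].
have rG C : C \in M 1 -> r C \in G by move=> CM; apply/imsetP; exists C.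
have [| | |[w wG]|[a [b [c [ab ac bc EG]]]]] := @star_or_triangle G.
- by move=> e /imsetP[C CM ->]; apply: r2.
- by move=> e f /imsetP[C CM ->] /imsetP[C' C'M ->]; apply: meet.
- by apply/set0Pn; exists (r C1); apply: rG.
- have [wC1 wD] := r_C (wG _ (rG _ C1M)).
  apply: leq_trans (_ : \sum_(t in T) 4 <= _); last by rewrite sum_nat_const T3.
  apply: leq_trans (cover_sum (K := [in T]) (r := fun t => [pred C : {set V} | [set t; w] \subset C]) _) _.
    move=> C CM; have [t tT tC] := tP CM; exists t => //=; rewrite sub2 tC.
    by case: (r_C (wG _ (rG _ CM))).
  by apply: leq_sum => t tT; apply: E_Tpair.
have inD e v : e \in G -> v \in e -> v \notin D by case/imsetP => C _ -> /r_C[].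
have [abG bcG] : [set a; b] \in G /\ [set b; c] \in G by rewrite EG !inE !eqxx !orbT.
have aD : a \notin D by apply: inD abG _; rewrite !inE eqxx.
have bD : b \notin D by apply: inD abG _; rewrite !inE eqxx orbT.
have cD : c \notin D by apply: inD bcG _; rewrite !inE eqxx orbT.
have : #|M 1| <= #|E [set a; b]| + #|E [set b; c]| + #|E [set a; c]|.
  apply: leq_trans (_ : #|E [set a; b] :|: E [set b; c] :|: E [set a; c]| <= _); last first.
    by apply: leq_trans (card_setU_le _ _) _; rewrite leq_add2r card_setU_le.
  apply/subset_leq_card/subsetP => C CM.
  have sr : r C \subset C := subsetDl _ _.
  have := rG _ CM; rewrite EG !in_setU !in_set1 !EE CM /=.
  by case/orP => [/orP[]|] /eqP <-; rewrite sr ?orbT.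
have := E_pair ab (notA aD) (notA bD); have := E_pair bc (notA bD) (notA cD).
have := E_pair ac (notA aD) (notA cD); clear; lia.
Qed.

Section DisjointPair.

Variables (C1 C2 : {set V}) (t : V).
Hypotheses (C1M : C1 \in M 1) (C2M : C2 \in M 1) (dr : [disjoint r C1 & r C2]).
Hypotheses (tT : t \in T) (tC1 : t \in C1) (tC2 : t \in C2).

Let M' := [set C in M 1 | t \notin C].

Let M'E C : (C \in M') = (C \in M 1) && (t \notin C).
Proof. exact: in_set. Qed.

Let M_split : #|M 1| = #|E [set t]| + #|M'|.
Proof.
rewrite (card_split (M 1) (fun C => t \in C)); congr (_ + _); apply: eq_card => C.
by rewrite !inE sub1set.
Qed.

Let hit C C' x y : C \in M 1 -> C' \in M 1 -> t \in C -> t \notin C' -> r C' = [set x; y] ->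
  (x \in C) || (y \in C).
Proof.
move=> CM C'M tC tC' rC'; have [v /r_C[vC _]] := cross CM C'M tT tC tC'.
by rewrite rC' !inE => /orP[]/eqP<-; rewrite vC ?orbT.
Qed.

Let hit' C C' x y : C \in M 1 -> C' \in M 1 -> t \in C -> t \notin C' -> r C = [set x; y] ->
  (x \in C') || (y \in C').
Proof.
move=> CM C'M tC tC' rC; have [v + /r_C[vC' _]] := cross CM C'M tT tC tC'.
by rewrite rC !inE => /orP[]/eqP<-; rewrite vC' ?orbT.
Qed.

Let same_t C C' s : C \in M 1 -> C' \in M 1 -> s \in T -> s \in C -> [disjoint r C & r C'] -> s \in C'.
Proof.
move=> CM C'M sT sC d; apply/negPn/negP => sC'.
by have [v vC vC'] := cross CM C'M sT sC sC'; rewrite (disjointFr d vC) in vC'.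
Qed.

(** All of [M 1] contains [t]. With [a0] the point of [C0] on [A], the members through [a0] have an
    intersecting link over [{a0, t}] and the others an intersecting link over [t]: 3 + 10. *)
Let one_point : M' = set0 -> #|M 1| <= 13.
Proof.
move=> M'0; have inT C : C \in M 1 -> t \in C.
  by move=> CM; apply/negPn/negP => tC; move/setP/(_ C): M'0; rewrite M'E CM in_set0 tC.
have /cards1P[a0 Ea0] : #|C0 :&: A| == 1 by rewrite C0A.
have /setIP[a00 a0A] : a0 \in C0 :&: A by rewrite Ea0 set11.
have C0E v : v \in A -> (v \in C0) = (v == a0).
  by move=> vA; move/setP/(_ v): Ea0; rewrite !inE vA andbT.
have ta : a0 != t by apply: contraTneq tT => <-; rewrite inE a0A.
have M1X : M 1 \subset X := setI_filter_sub _ _.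
pose N := [set C in M 1 | a0 \in C]; pose K := [set C in M 1 | a0 \notin C].
have memI (P : pred {set V}) C : (C \in [set C' in M 1 | P C']) = (C \in M 1) && P C by apply: in_set.
have lsub Y S : Y \subset X -> link Y S \subset link X S.
  by move=> YX; apply/subsetP => e; rewrite !in_link => /andP[->] /(subsetP YX).
have NX : N \subset X := subset_trans (setI_filter_sub _ _) M1X.
have KX : K \subset X := subset_trans (setI_filter_sub _ _) M1X.
have N3 : #|N| <= 3.
  rewrite -(over_self (X := N) (S := [set a0; t])); last first.
    by move=> C; rewrite memI => /andP[CM aC]; rewrite sub2 aC inT.
  rewrite -card_link; apply: graph_intersecting_le3.
  - exact: sfS (lsub _ _ NX) (link_sf sfX).
  - by apply: uniformS (lsub _ _ NX) _ => e /(link_uniform uX); rewrite cards2 ta.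
  move=> e e'; rewrite !in_link !memI => /andP[_ /andP[CM aC]] /andP[_ /andP[C'M aC']].
  have [v vA|v /r_C[vC vD] /r_C[vC' _]] := same CM C'M tT (inT _ CM) (inT _ C'M).
    have [_ CA _] := MX CM; have [_ C'A _] := MX C'M; rewrite C0E //.
    have one (S : {set V}) : #|S :&: A| = 1 -> a0 \in S -> (v \in S) = (v == a0).
      by move=> SA aS; apply/idP/eqP => [vS|->//]; apply: (card1_eq SA); rewrite inE ?vS ?aS.
    by rewrite (one _ CA) // (one _ C'A) //; case: (v == a0).
  exists v; [move: vC|move: vC']; rewrite !in_setU !in_set1 => /orP[] // /orP[]/eqP E0; move: vD;
    by rewrite E0 DE ?tT ?a0A ?orbT.
have K10 : #|K| <= 10.
  rewrite -(over_self (X := K) (S := [set t])); last first.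
    by move=> C; rewrite memI => /andP[CM _]; rewrite sub1set inT.
  rewrite -card_link; apply: intersecting_le10.
  - exact: sfS (lsub _ _ KX) (link_sf sfX).
  - by apply: uniformS (lsub _ _ KX) _ => e /(link_uniform uX); rewrite cards1.
  move=> e e'; rewrite !in_link !memI => /andP[_ /andP[CM aC]] /andP[_ /andP[C'M aC']].
  suff [v [vt vC vC']] : exists v, [/\ v != t, v \in t |: e & v \in t |: e'].
    by exists v; [move: vC|move: vC']; rewrite in_setU1 (negbTE vt).
  set C := t |: e in CM aC *; set C' := t |: e' in C'M aC' *.
  case: (boolP [exists v in A, (v \in C) && (v \in C')]) => [/exists_inP[v vA /andP[vC vC']]|].
    by exists v; split=> //; apply: contraTneq vA => ->; apply: T_A.
  rewrite negb_exists_in => /forall_inP none.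
  have [v vA|v /r_C[vC vD] /r_C[vC' _]] := same CM C'M tT (inT _ CM) (inT _ C'M).
    have := none v vA; rewrite C0E //; case: (eqVneq v a0) => [->|_]; first by rewrite (negbTE aC) (negbTE aC').
    by case: (v \in C); case: (v \in C').
  by exists v; split=> //; rewrite eq_sym T_neq.
rewrite (card_split (M 1) (fun C => a0 \in C)) -/N -/K.
by move: N3 K10; clear; lia.
Qed.

(** A member through [t] meets [wu] and [wv], so it contains [w] or both [u] and [v]: 4 + 2. The
    members missing [t] add 4 + 4. *)
Let two_adjacent C3 C4 w u v : C3 \in M' -> C4 \in M' -> w \notin D -> u \notin D -> v \notin D ->
  w != u -> w != v -> u != v ->
  r C3 = [set w; u] -> r C4 = [set w; v] ->
  (forall C, C \in M' -> [set w; u] \subset C \/ [set w; v] \subset C) -> #|M 1| <= 14.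
Proof.
rewrite !M'E => /andP[C3M t3] /andP[C4M t4] wD uD vD wu wv uv r3 r4 cov.
have M'8 : #|M'| <= #|E [set w; u]| + #|E [set w; v]|.
  apply: cardU2; apply/subsetP => C CM'; have CM : C \in M 1 by move: CM'; rewrite M'E => /andP[].
  by rewrite in_setU !EE CM /=; apply/orP/cov.
have Mt : #|E [set t]| <= #|E [set t; w]| + #|E [set t; u; v]|.
  apply: cardU2; apply/subsetP => C; rewrite in_setU !EE sub1set => /andP[CM tC].
  rewrite CM sub2 sub3 tC /=.
  by have := hit CM C3M tC t3 r3; have := hit CM C4M tC t4 r4; case: (w \in C) => //= -> ->.
rewrite M_split; move: M'8 Mt (E_pair wu (notA wD) (notA uD)) (E_pair wv (notA wD) (notA vD)).
by move: (E_Tpair tT wD) (E_Ttriple tT uD vD uv); clear; lia.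
Qed.

(** Members with disjoint edges share their point of [T]. So [ab] and [cd] go with [t], while [ac]
    and [bd] go with a common point [s], two members each; [ad] and [bc] carry at most 4
    together. *)
Let opposite C3 C4 a b c d : C3 \in M' -> C4 \in M' -> a != b -> c != d ->
  a \notin D -> b \notin D -> c \notin D -> d \notin D ->
  r C1 = [set a; b] -> r C2 = [set c; d] -> r C3 = [set a; c] -> r C4 = [set b; d] -> #|M 1| <= 14.
Proof.
rewrite !M'E => /andP[C3M t3] /andP[C4M t4] ab cd aD bD cD dD r1E r2E r3E r4E.
have ne x y : x \in r C1 -> y \in r C2 -> x != y.
  by move=> x1 y2; apply: contraTneq y2 => <-; rewrite (disjointFr dr x1).
have [a1 [b1 [c2 d2]]] : a \in r C1 /\ b \in r C1 /\ c \in r C2 /\ d \in r C2.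
  by rewrite r1E r2E !inE !eqxx !orbT.
have ac := ne _ _ a1 c2; have ad := ne _ _ a1 d2; have bc := ne _ _ b1 c2; have bd := ne _ _ b1 d2.
have M'P C : C \in M 1 -> t \notin C -> ((a \in C) || (b \in C)) && ((c \in C) || (d \in C)).
  by move=> CM tC; rewrite (hit' C1M CM tC1 tC r1E) (hit' C2M CM tC2 tC r2E).
have [s sT s4] := tP C4M.
have dacbd : [disjoint [set a; c] & [set b; d]].
  by rewrite disjoints_subset sub2 !inE !negb_or ab ad cd (eq_sym c) bc.
have s3 : s \in C3 by apply: (same_t C4M C3M sT s4); rewrite r4E r3E disjoint_sym.
have dadbc : [disjoint [set a; d] & [set b; c]].
  by rewrite disjoints_subset sub2 !inE !negb_or ab ac (eq_sym d) bd (eq_sym d) cd.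
have adbc : #|E [set a; d]| + #|E [set b; c]| <= 4.
  case: (set_0Vmem (E [set a; d])) => [->|[Cx]].
    by rewrite cards0; apply: E_pair => //; apply: notA.
  case: (set_0Vmem (E [set b; c])) => [->|[Cy]].
    by rewrite cards0 addn0 => _; apply: E_pair => //; apply: notA.
  rewrite !EE !sub2 => /and3P[yM yb yc] /and3P[xM xa xd].
  have rx : r Cx = [set a; d] by apply: rE.
  have ry : r Cy = [set b; c] by apply: rE.
  have [p pT px] := tP xM.
  have py : p \in Cy by apply: (same_t xM yM pT px); rewrite rx ry.
  have e1 : #|E [set a; d]| <= #|E [set p; a; d]|.
    apply/subset_leq_card/subsetP => C; rewrite !EE sub2 sub3.
    case/and3P=> CM aC dC; rewrite CM aC dC !andbT /=.
    by apply: (same_t yM CM pT py); rewrite ry (rE CM aD dD ad aC dC) disjoint_sym.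
  have e2 : #|E [set b; c]| <= #|E [set p; b; c]|.
    apply/subset_leq_card/subsetP => C; rewrite !EE sub2 sub3.
    case/and3P=> CM bC cC; rewrite CM bC cC !andbT /=.
    by apply: (same_t xM CM pT px); rewrite rx (rE CM bD cD bc bC cC).
  by move: e1 e2 (E_Ttriple pT aD dD ad) (E_Ttriple pT bD cD bc); clear; lia.
have cov : #|M 1| <= #|E [set t; a; b]| + #|E [set t; c; d]| + #|E [set s; a; c]| + #|E [set s; b; d]| +
    (#|E [set a; d]| + #|E [set b; c]|).
  apply: leq_trans (_ : #|E [set t; a; b] :|: E [set t; c; d] :|: E [set s; a; c] :|: E [set s; b; d] :|:
    (E [set a; d] :|: E [set b; c])| <= _); last first.
    apply: leq_trans (card_setU_le _ _) (leq_add _ (card_setU_le _ _)).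
    by do 2 (apply: leq_trans (card_setU_le _ _) _; rewrite leq_add2r); apply: card_setU_le.
  apply/subset_leq_card/subsetP => C CM; rewrite !in_setU !EE CM !sub2 !sub3 /=.
  case: (boolP (t \in C)) => tC /=.
    have := hit CM C3M tC t3 r3E; have := hit CM C4M tC t4 r4E.
    by case: (a \in C); case: (b \in C); case: (c \in C); case: (d \in C); rewrite ?orbT.
  have /andP[h1 h2] := M'P C CM tC.
  have hac : a \in C -> c \in C -> s \in C.
    by move=> aC cC; apply: (same_t C4M CM sT s4); rewrite r4E (rE CM aD cD ac aC cC) disjoint_sym.
  have hbd : b \in C -> d \in C -> s \in C.
    by move=> bC dC; apply: (same_t C3M CM sT s3); rewrite r3E (rE CM bD dD bd bC dC).
  move: h1 h2 hac hbd; case: (a \in C); case: (b \in C); case: (c \in C); case: (d \in C);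
    case: (s \in C) => //= _ _ h1 h2; by move: (h1 isT isT) || move: (h2 isT isT).
move: cov adbc (E_Ttriple tT aD bD ab) (E_Ttriple tT cD dD cd) (E_Ttriple sT aD cD ac) (E_Ttriple sT bD dD bd).
by clear; lia.
Qed.

(** The edge of a member missing [t] joins [ab] to [cd], so it is a side of the 4-cycle [ac], [cb],
    [bd], [da]. Two opposite sides, two adjacent sides or only one may occur; in the last case at
    most 4 members miss [t] and 4 + 4 contain it. *)
Lemma disjoint_pair_le14 : #|M 1| <= 14.
Proof.
case: (set_0Vmem M') => [/one_point/leq_trans->//|[C3 C3M']].
have [a0 [b0 [_ r1]]] := card2E (r2 C1M); have [c0 [d0 [_ r2']]] := card2E (r2 C2M).
have C3M : C3 \in M 1 by move: C3M'; rewrite M'E => /andP[].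
have t3 : t \notin C3 by move: C3M'; rewrite M'E => /andP[].
have [a aC1 a3] := cross C1M C3M tT tC1 t3; have [c cC2 c3] := cross C2M C3M tT tC2 t3.
have [b [ab r1E]] := card2E1 (r2 C1M) aC1; have [d [cd r2E]] := card2E1 (r2 C2M) cC2.
have [_ aD] := r_C aC1; have [_ cD] := r_C cC2.
have bC1 : b \in r C1 by rewrite r1E !inE eqxx orbT.
have dC2 : d \in r C2 by rewrite r2E !inE eqxx orbT.
have [_ bD] := r_C bC1; have [_ dD] := r_C dC2.
have ne x y : x \in r C1 -> y \in r C2 -> x != y.
  by move=> x1 y2; apply: contraTneq y2 => <-; rewrite (disjointFr dr x1).
have ac := ne _ _ aC1 cC2; have ad := ne _ _ aC1 dC2; have bc := ne _ _ bC1 cC2; have bd := ne _ _ bC1 dC2.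
have r3E : r C3 = [set a; c] by apply: card2E2 (r2 C3M) a3 c3 ac.
have M'P C : C \in M' -> [/\ C \in M 1, t \notin C, (a \in C) || (b \in C) & (c \in C) || (d \in C)].
  rewrite M'E => /andP[CM tC]; split=> //; first exact: hit' C1M CM tC1 tC r1E.
  exact: hit' C2M CM tC2 tC r2E.
case: (boolP [exists C in M', (b \in C) && (d \in C)]) => [/exists_inP[C4 C4M' /andP[b4 d4]]|].
  have [C4M t4 _ _] := M'P _ C4M'.
  have r4E : r C4 = [set b; d] by apply: rE.
  exact: (opposite C3M' C4M' ab cd aD bD cD dD r1E r2E r3E r4E).
rewrite negb_exists_in => /forall_inP nobd.
have no_opp : ~ (exists2 C4, C4 \in M' & (a \in C4) && (d \in C4)) ->
    ~ (exists2 C4, C4 \in M' & (b \in C4) && (c \in C4)) -> #|M 1| <= 14.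
  move=> noad nobc.
  have M'4 : #|M'| <= #|E [set a; c]|.
    apply/subset_leq_card/subsetP => C CM'; have [CM _ h1 h2] := M'P _ CM'.
    rewrite EE CM sub2 /=; move: h1 h2 (nobd _ CM').
    have := fun h => noad (ex_intro2 _ _ C CM' h); have := fun h => nobc (ex_intro2 _ _ C CM' h).
    by case: (a \in C); case: (b \in C); case: (c \in C); case: (d \in C) => //= h1 h2; case: (h1 isT) || case: (h2 isT).
  have Mt : #|E [set t]| <= #|E [set t; a]| + #|E [set t; c]|.
    apply: cardU2; apply/subsetP => C; rewrite in_setU !EE sub1set => /andP[CM tC].
    by rewrite CM !sub2 tC /=; apply: hit CM C3M tC t3 r3E.
  rewrite M_split; move: M'4 Mt (E_pair ac (notA aD) (notA cD)) (E_Tpair tT aD) (E_Tpair tT cD).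
  by clear; lia.
case: (boolP [exists C in M', (a \in C) && (d \in C)]) => [/exists_inP[C4 C4M' /andP[a4 d4]]|noad].
  have [C4M t4 _ _] := M'P _ C4M'.
  case: (boolP [exists C in M', (b \in C) && (c \in C)]) => [/exists_inP[C5 C5M' /andP[b5 c5]]|nobc].
    have [C5M t5 _ _] := M'P _ C5M'.
    apply: (opposite C4M' C5M' ab _ aD bD dD cD r1E); first by rewrite eq_sym.
    - by rewrite r2E; apply/setP => v; rewrite !inE orbC.
    - exact: rE.
    - exact: rE.
  apply: (two_adjacent C3M' C4M' aD cD dD ac ad cd r3E); first exact: rE.
  move=> C CM'; have [_ _ h1 h2] := M'P _ CM'; have h3 := nobd _ CM'.
  have : ~~ ((b \in C) && (c \in C)) by apply: contra nobc => h; apply/exists_inP; exists C.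
  rewrite !sub2; move: h1 h2 h3.
  by case: (a \in C); case: (b \in C); case: (c \in C); case: (d \in C) => //=; auto.
case: (boolP [exists C in M', (b \in C) && (c \in C)]) => [/exists_inP[C5 C5M' /andP[b5 c5]]|nobc].
  have [C5M t5 _ _] := M'P _ C5M'.
  apply: (two_adjacent C3M' C5M' cD aD bD _ _ ab); rewrite 1?eq_sym //.
  - by rewrite r3E; apply/setP => v; rewrite !inE orbC.
  - by apply: rE => //; rewrite eq_sym.
  move=> C CM'; have [_ _ h1 h2] := M'P _ CM'; have h3 := nobd _ CM'.
  have : ~~ ((a \in C) && (d \in C)) by apply: contra noad => h; apply/exists_inP; exists C.
  rewrite !sub2; move: h1 h2 h3.
  by case: (a \in C); case: (b \in C); case: (c \in C); case: (d \in C) => //=; auto.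
by apply: no_opp => -[C CM' h]; [move/negP: noad|move/negP: nobc]; apply; apply/exists_inP; exists C.
Qed.

End DisjointPair.

Lemma petal_M1 : #|M 1| <= 14.
Proof.
case: (boolP [exists C in M 1, [exists C' in M 1, [disjoint r C & r C']]]).
  case/exists_inP => C1 C1M /exists_inP[C2 C2M d]; have [t tT t1] := tP C1M.
  apply: (disjoint_pair_le14 C1M C2M d tT t1).
  apply/negPn/negP => t2; have [v v1 v2] := cross C1M C2M tT t1 t2.
  by rewrite (disjointFr d v1) in v2.
rewrite negb_exists_in => /forall_inP no; apply: leq_trans (all_meet _) _ => // C C' CM C'M.
apply/meets; have := no _ CM; rewrite negb_exists_in => /forall_inP; exact.
Qed.

End Petal.

Lemma meet1_le24 X A : sf X -> uniform 4 X -> intersecting X -> A \in X ->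
  #|[set C in X | #|C :&: A| == 1]| <= 24.
Proof.
move=> sfX uX iX AX; set X1 := [set C in X | _].
case: (set_0Vmem X1) => [->|[C0]]; first by rewrite cards0.
rewrite in_set => /andP[C0X /eqP C0A].
have := petal_M23 sfX uX C0X C0A; have := petal_M1 sfX uX iX AX C0X C0A.
pose M k := [set C in X | (#|C :&: A| == 1) && (#|C :&: (C0 :\: A)| == k)].
rewrite -/(M 1) -/(M 2) -/(M 3).
suff : #|X1| <= #|M 1| + (#|M 2| + #|M 3|) by clear; lia.
apply: leq_trans (_ : #|M 1 :|: (M 2 :|: M 3)| <= _); last first.
  by apply: leq_trans (card_setU_le _ _) _; rewrite leq_add2l card_setU_le.
apply/subset_leq_card/subsetP => C; rewrite in_set => /andP[CX /eqP CA].
rewrite !in_setU !in_set CX CA eqxx /=.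
have := petal_meets sfX uX iX AX C0X C0A CX CA.
have : #|C :&: (C0 :\: A)| <= 3.
  have := cardsID A C; rewrite (uX _ CX) CA => E.
  have := subset_leq_card (_ : C :&: (C0 :\: A) \subset C :\: A).
  move=> /(_ _)/leq_trans; apply; last by move: E; clear; lia.
  by apply/subsetP => v; rewrite !inE => /and3P[-> -> _].
by case: #|_| => [|[|[|[|n]]]].
Qed.

(** * Trading two-point traces against one-point traces *)

Section Intersecting4.

Variable X : {set {set V}}.
Hypotheses (sfX : sf X) (uX : uniform 4 X) (iX : intersecting X).

Lemma cls_pair_le3 A u v : A \in X -> u \in A -> v \in A -> u != v -> #|cls X A [set u; v]| <= 3.
Proof.
move=> AX uA vA uv; rewrite -card_tr ?sub2 ?uA //; apply: graph_intersecting_le3.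
- exact: tr_sf.
- by move=> e /(tr_uniform uX); rewrite cards2 uv.
apply: (tr_intersecting sfX uX AX).
by rewrite properEcard sub2 uA vA cards2 uv (uX AX).
Qed.

Lemma cls_D1_le1 A u : A \in X -> u \in A -> #|cls X A (A :\ u)| <= 1.
Proof.
move=> AX uA; suff : #|cls X A (A :\ u)| + #|[set A]| <= 2 by rewrite cards1; clear; lia.
have S3 : #|A :\ u| = 3 by have := cardsD1 u A; rewrite uA (uX AX); clear; lia.
apply: (over_disj2 (S := A :\ u) sfX uX); first by rewrite S3.
- by apply/subsetP => C; rewrite mem_cls mem_over => /andP[-> /eqP <-]; apply: subsetIl.
- by rewrite sub1set mem_over AX subD1set.
rewrite disjoint_sym disjoints1 mem_cls setIid negb_and; apply/orP; right.
by apply/neqP; exists u; rewrite !inE eqxx uA.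
Qed.

Lemma card_edge1 (S : {set V}) u v : u != v -> #|[set u; v] :&: S| = (u \in S) + (v \in S).
Proof.
by move=> uv; rewrite setIC card_ind big_setU1 ?inE // big_set1.
Qed.

(** Three members over [{x, y}] have a triangle [t] as outer parts. A member with trace [{z}] or
    [{w}] meets its sides, hence contains one of them; at most two members do so for each side. *)
Lemma pair_triangle A x y z w : A \in X -> x \in A -> y \in A -> z \in A -> w \in A ->
  x != y -> x != z -> x != w -> y != z -> y != w -> z != w ->
  2 < #|cls X A [set x; y]| -> #|cls X A [set z]| + #|cls X A [set w]| <= 6.
Proof.
move=> AX xA yA zA wA xy xz xw yz yw zw.
rewrite -card_tr ?sub2 ?xA //; set G := tr _ _ _ => G3.
have pr : [set x; y] \proper A by rewrite properEcard sub2 xA yA cards2 xy (uX AX).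
have uG : uniform 2 G by move=> e /(tr_uniform uX); rewrite cards2 xy.
have [t [t3 tG]] := graph_tri (tr_sf sfX) uG (tr_intersecting sfX uX AX pr) G3.
have d : [disjoint cls X A [set z] & cls X A [set w]].
  by apply: cls_disjoint; apply/neqP; exists z; rewrite !inE eqxx (negbTE zw).
pose Y := cls X A [set z] :|: cls X A [set w].
rewrite (_ : _ + _ = #|Y|); last by rewrite -cardsUI (disjoint_setI0 d) cards0 addn0.
have YP C : C \in Y -> [/\ C \in X, x \notin C, y \notin C & #|C :&: A| = 1].
  rewrite in_setU => /orP[] Cc; rewrite (clsE Cc xA) (clsE Cc yA) !in_set1;
  move: Cc; rewrite mem_cls => /andP[-> /eqP->]; by rewrite cards1.
have tA u : u \in t -> u \notin A.
  move=> ut; have /card_gt0P[v] : 0 < #|t :\ u| by have := cardsD1 u t; rewrite ut t3; clear; lia.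
  rewrite in_setD1 => /andP[vu vt]; have : [set u; v] \in G by apply: tG; rewrite // eq_sym.
  by rewrite in_tr => /and3P[_ _]; rewrite disjoints_subset sub2 !inE => /andP[].
have hit C u v : C \in Y -> u \in t -> v \in t -> u != v -> (u \in C) || (v \in C).
  move=> CY ut vt uv; have [CX xC yC _] := YP _ CY.
  have := tG u v ut vt uv; rewrite in_tr => /and3P[_ xyuv _].
  have [a + aC] := iX xyuv CX; rewrite !inE -!orbA => /or4P[]/eqP E; move: aC; rewrite E.
  - by rewrite (negbTE xC).
  - by rewrite (negbTE yC).
  - by move=> ->.
  - by move=> ->; rewrite orbT.
apply: leq_trans (cover_sum (K := [in t]) (r := fun u => [pred C : {set V} | t :\ u \subset C]) _) _.
  move=> C CY; have t0 : t != set0 by rewrite -card_gt0 t3.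
  case: (subD1_or_miss C t0) => [[u ut tC]|[u [v [ut vt uv]]]]; first by exists u.
  by rewrite -negb_or hit.
apply: (@leq_trans (\sum_(u in t) 2)); last by rewrite sum_nat_const t3.
apply: leq_sum => u ut; set Y' := [set C in Y | _]; set S := t :\ u.
have S2 : #|S| = 2 by have := cardsD1 u t; rewrite ut t3 -/S; clear; lia.
have Y'P C : C \in Y' -> C \in Y /\ S \subset C by rewrite (in_set (fun _ => _ && _)) => /andP[].
have SA : [disjoint S & A].
  by rewrite disjoints_subset; apply/subsetP => v /setD1P[_ /tA]; rewrite inE.
rewrite -(over_self (X := Y') (S := S)); last by move=> C /Y'P[].
rewrite -card_link leqNgt; apply/negP => l3.
have lX : link Y' S \subset link X S.
  by apply/subsetP => e; rewrite !in_link => /andP[->] /Y'P[/YP[]].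
have uS : uniform 2 (link X S) by move=> e /(link_uniform uX); rewrite S2.
have xyS : [set x; y] \in link X S.
  have := tri_D1 tG t3 ut; rewrite -/S in_tr in_link (setUC S) => /and3P[dS -> _].
  by rewrite disjoint_sym dS.
have dxy e : e \in link Y' S -> [disjoint [set x; y] & e].
  rewrite in_link => /andP[_ /Y'P[/YP[_ xe ye _] _]].
  by rewrite disjoints_subset sub2 !in_setC; move: xe ye; rewrite !in_setU !negb_or => /andP[_ ->] /andP[_ ->].
have iS : intersecting (link Y' S).
  move=> e f el fl; case: (eqVneq e f) => [<-|ef].
    have /card_gt0P[v ve] : 0 < #|e| by rewrite (uS _ (subsetP lX _ el)).
    by exists v.
  apply/meets/negP => ef0.
  exact: (no_matching3 (link_sf sfX) uS xyS (subsetP lX _ el) (subsetP lX _ fl) (dxy _ el) (dxy _ fl)).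
(* Three members over one side would form a triangle each of whose sides has exactly one end in [A],
   which parity forbids. *)
have [a [b [c [ab ac bc E]]]] := graph_intersecting (sfS lX (link_sf sfX)) (uniformS lX uS) iS l3.
have odd1 p q : p != q -> [set p; q] \in link Y' S -> (p \in A) + (q \in A) = 1.
  move=> pq; rewrite in_link => /andP[_ /Y'P[/YP[_ _ _ <-] _]].
  by rewrite -card_edge1 // (setIUl S) (disjoint_setI0 SA) set0U.
have := odd1 a b ab; have := odd1 b c bc; have := odd1 a c ac; rewrite E !inE !eqxx !orbT /=.
by case: (a \in A); case: (b \in A); case: (c \in A) => // h1 h2 h3; (have := h1 isT) || idtac; (have := h2 isT) || idtac; have := h3 isT.
Qed.

Hypothesis X8 : forall A x, A \in X -> x \in A -> #|cls X A [set x]| <= 8.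

(** A class of a pair may have 3 members rather than 2. By [pair_triangle] the classes of the two
    other points then have at most 6 members together instead of the 8 + 8 from [X8], and this loss
    covers the excess, so one-point and two-point traces stay within 24 + 12. *)
Lemma intersecting_le41 : #|X| <= 41.
Proof.
case: (set_0Vmem X) => [->|[A AX]]; first by rewrite cards0.
pose K n := [set C in X | #|C :&: A| == n].
have cX : #|X| <= #|K 1| + #|K 2| + #|K 3| + #|K 4|.
  apply: leq_trans (_ : #|K 1 :|: K 2 :|: K 3 :|: K 4| <= _).
    apply/subset_leq_card/subsetP => C CX; rewrite !in_setU !in_set CX /=.
    have : #|C :&: A| <= 4 by rewrite -(uX AX) subset_leq_card ?subsetIr.
    have : 0 < #|C :&: A|.
      by have [v vC vA] := iX CX AX; apply/card_gt0P; exists v; rewrite inE vC.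
    by case: #|_| => [|[|[|[|[|n]]]]].
  by do 3 (apply: leq_trans (card_setU_le _ _) _; rewrite leq_add2r).
have K4 := card_meet_full uX AX; have K1 := card_meet1 X A; rewrite -/(K 4) in K4; rewrite -/(K 1) in K1.
have K3 : #|K 3| <= 4.
  apply: (@leq_trans (\sum_(y in A) 1)); last by rewrite sum_nat_const uX.
  apply: leq_trans (cover_sum (K := [in A]) (r := fun y => [pred C | C :&: A == A :\ y]) _) _.
    move=> C; rewrite in_set => /andP[_ /eqP C3].
    by have [y [yA _ E]] := setI_card3 (uX AX) C3; exists y => //=; rewrite E.
  apply: leq_sum => y yA; apply: leq_trans (cls_D1_le1 AX yA).
  by apply/subset_leq_card/subsetP => C; rewrite mem_cls !in_set => /andP[/andP[->]].
have K1' : #|K 1| <= 24 := meet1_le24 sfX uX iX AX.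
have /card_gt0P[p pA] : 0 < #|A| by rewrite uX.
have A'3 : #|A :\ p| = 3 by have := cardsD1 p A; rewrite pA (uX AX); clear; lia.
have [q [r [s [qr qs rs EA']]]] := card3E A'3.
have mem v : v \in [set q; r; s] -> v != p /\ v \in A by rewrite -EA' => /setD1P.
have [qp qA] : q != p /\ q \in A by apply: mem; rewrite !inE eqxx.
have [rp rA] : r != p /\ r \in A by apply: mem; rewrite !inE eqxx orbT.
have [sp sA] : s != p /\ s \in A by apply: mem; rewrite !inE eqxx !orbT.
rewrite eq_sym in qp; rewrite eq_sym in rp; rewrite eq_sym in sp.
have EA v : (v \in A) = [|| v == p, v == q, v == r | v == s].
  case: (eqVneq v p) => [->|vp]; first by rewrite pA.
  by have := in_setD1 v A p; rewrite EA' vp /= => <-; rewrite !inE -orbA.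
have sumA (f : V -> nat) : \sum_(x in A) f x = f p + (f q + f r + f s).
  by rewrite (big_setD1 p) // EA' sum3.
have K2 : #|K 2| <= #|cls X A [set p; q]| + #|cls X A [set p; r]| + #|cls X A [set p; s]| +
    #|cls X A [set q; r]| + #|cls X A [set q; s]| + #|cls X A [set r; s]|.
  apply: leq_trans (_ : #|cls X A [set p; q] :|: cls X A [set p; r] :|: cls X A [set p; s] :|:
    cls X A [set q; r] :|: cls X A [set q; s] :|: cls X A [set r; s]| <= _); last first.
    by do 5 (apply: leq_trans (card_setU_le _ _) _; rewrite leq_add2r).
  apply/subset_leq_card/subsetP => C; rewrite in_set => /andP[CX /eqP/card2E[u [v [uv E]]]].
  rewrite !in_setU !mem_cls CX E /=.
  have /setIP[_] : u \in C :&: A by rewrite E !inE eqxx.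
  have /setIP[_] : v \in C :&: A by rewrite E !inE eqxx orbT.
  rewrite !EA => /or4P[]/eqP Ev /or4P[]/eqP Eu; move: uv; rewrite Ev Eu ?eqxx // => _;
    by rewrite ?eqxx ?orbT // (setUC [set _]) ?eqxx ?orbT.
rewrite sumA in K1.
have g x y := cls_pair_le3 AX (u := x) (v := y).
have tr x y z w := pair_triangle AX (x := x) (y := y) (z := z) (w := w).
have [qp' [rp' [sp' [rq [sq sr]]]]] : q != p /\ r != p /\ s != p /\ r != q /\ s != q /\ s != r.
  by do 5 (split; first by rewrite eq_sym); rewrite eq_sym.
have := tr p q r s pA qA rA sA qp rp sp qr qs rs.
have := tr p r q s pA rA qA sA rp qp sp rq rs qs.
have := tr p s q r pA sA qA rA sp qp rp sq sr qr.
have := tr q r p s qA rA pA sA qr qp' qs rp' rs sp.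
have := tr q s p r qA sA pA rA qs qp' qr sp' sr rp.
have := tr r s p q rA sA pA qA rs rp' rq sp' sq qp.
have := X8 AX pA; have := X8 AX qA; have := X8 AX rA; have := X8 AX sA.
have := g _ _ pA qA qp; have := g _ _ pA rA rp; have := g _ _ pA sA sp.
have := g _ _ qA rA qr; have := g _ _ qA sA qs; have := g _ _ rA sA rs.
move: cX K1 K1' K2 K3 K4.
move: #|K 1| #|K 2| #|K 3| #|K 4| #|X| => k1 k2 k3 k4 n.
move: #|cls X A [set p]| #|cls X A [set q]| #|cls X A [set r]| #|cls X A [set s]| => hp hq hr hs.
move: #|cls X A [set p; q]| #|cls X A [set p; r]| #|cls X A [set p; s]| => g1 g2 g3.
move: #|cls X A [set q; r]| #|cls X A [set q; s]| #|cls X A [set r; s]| => g4 g5 g6.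
clear; lia.
Qed.

End Intersecting4.

End Families.

(** * The upper bound for sunflower-free families *)

Section UpperBound.

Variable V : finType.
Implicit Types (F : {set {set V}}) (A B C : {set V}) (v : V).

(** If no point lies in exactly two of the sets, any two of them meet in the points common to all
    three, which form a core. *)
Lemma sunflower_free_sf F : sunflower_free 3 F -> sf F.
Proof.
move=> free A B C AF BF CF AB AC BC.
case: (boolP [exists v, (v \in A) + (v \in B) + (v \in C) == 2]) => [/existsP[v /eqP E]|]; first by exists v.
rewrite negb_exists => /forallP none; exfalso; apply: (free [set A; B; C]).
  by apply/subsetP => S; rewrite !inE -orbA => /or3P[]/eqP->.
split; first exact: cards3.
exists (A :&: B) => S S'; rewrite !inE -!orbA => SE S'E SS'.
apply/setP => v; rewrite !inE; have := none v; move: SS'.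
by case/or3P: SE => /eqP->; case/or3P: S'E => /eqP->; rewrite ?eqxx //;
  case: (v \in A); case: (v \in B); case: (v \in C).
Qed.

Lemma sub_card n F : n <= #|F| -> exists2 G : {set {set V}}, G \subset F & #|G| = n.
Proof.
move=> nF; exists [set A in take n (enum F)].
  by apply/subsetP => A; rewrite inE => /mem_take; rewrite mem_enum.
by rewrite cardsE (card_uniqP (take_uniq _ (enum_uniq _))) size_takel // -cardE.
Qed.

Lemma sf4_le83 F : sf F -> uniform 4 F -> #|F| <= 83.
Proof.
move=> sfF uF; rewrite leqNgt; apply/negP => /sub_card[F' sub F'84].
have sfF' := sfS sub sfF; have uF' := uniformS sub uF.
have [G [GF iG G42]] := large_intersecting sfF' uF' F'84.
have : #|G| <= 41.
  apply: intersecting_le41 => //; [exact: sfS GF sfF'|exact: uniformS GF uF'|].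
  move=> A x AG xA; apply: leq_trans (degree_le8 sfF' uF' F'84 (subsetP GF _ AG) xA).
  by apply/subset_leq_card/subsetP => C; rewrite !mem_cls => /andP[/(subsetP GF)->].
by move: G42; clear; lia.
Qed.

End UpperBound.

(** * The lower bound *)

Section LowerBound.

Let I := option bool.

Let next (i : I) : I :=
  match i with None => Some true | Some true => Some false | Some false => None end.

Let next3 i : [/\ next i != i, next (next i) != i & next i != next (next i)].
Proof. by case: i => [[]|]. Qed.

(** The witness is a value taken exactly once among [x], [y], [z]. *)
Let two_of_three (x y z : I) : ~~ ((x == y) && (y == z)) -> exists j, (j != x) + (j != y) + (j != z) = 2.
Proof.
move=> ne; exists (if x == y then z else if x == z then y else x).
by move: x y z ne => [[]|] [[]|] [[]|].
Qed.

Let common (x y : I) : exists2 j, j != x & j != y.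
Proof.
exists (if x == y then next x else if next x == y then next (next x) else next x);
by move: x y => [[]|] [[]|].
Qed.

Let P := (bool * (I * (I * I)))%type.

Let edge (t : I * (I * I)) (i : I) : I := if i == next t.1 then t.2.1 else t.2.2.

Let inner (t : I * (I * I)) : pred (I * I) := fun v => (v.1 != t.1) && (v.2 != edge t v.1).

(* [(b, (k, (x, y)))]: in copy [b] omit group [k], the point [x] of group [next k] and the point [y] of the third group. *)
Let block (p : P) : {set bool * (I * I)} := [set v | (v.1 == p.1) && inner p.2 v.2].

Let card_block p : #|block p| = 4.
Proof.
case: p => b [k [x y]].
pose s := [:: (b, (next k, next x)); (b, (next k, next (next x)));
  (b, (next (next k), next y)); (b, (next (next k), next (next y)))].
have us : uniq s by rewrite /s {s}; move: b k x y => [] [[]|] [[]|] [[]|].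
rewrite -[4]/(size s) -(card_uniqP us); apply: eq_card => -[c [i j]].
rewrite in_set /inner /edge /s /= {us s}.
by move: b c k i x y j => [] [] [[]|] [[]|] [[]|] [[]|] [[]|].
Qed.

Let inner_common t t' : exists v, inner t v && inner t' v.
Proof.
have [i it it'] := common t.1 t'.1; have [j jt jt'] := common (edge t i) (edge t' i).
by exists (i, j); rewrite /inner /= it it' jt jt'.
Qed.

(** If the omitted groups are not all equal, some group is omitted by exactly one of the three sets,
    and the other two share a point there, each missing only one of three. If they agree, the
    omitted points of some group are not all equal. *)
Let inner_split t1 t2 t3 : ~~ ((t1 == t2) && (t2 == t3)) ->
  exists v, inner t1 v + inner t2 v + inner t3 v = 2.
Proof.
move=> ne; case: (boolP ((t1.1 == t2.1) && (t2.1 == t3.1))) => [/andP[/eqP k12 /eqP k23]|/two_of_three[i]].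
  have [n1 n2 n3] := next3 t1.1.
  have split i : i != t1.1 -> ~~ ((edge t1 i == edge t2 i) && (edge t2 i == edge t3 i)) ->
      exists v, inner t1 v + inner t2 v + inner t3 v = 2.
    by move=> ik /two_of_three[j E]; exists (i, j); rewrite /inner /= -k23 -k12 ik.
  case: (boolP ((t1.2.1 == t2.2.1) && (t2.2.1 == t3.2.1))) => [/andP[/eqP x12 /eqP x23]|nx]; last first.
    by apply: (split (next t1.1)) => //; rewrite /edge -k23 -k12 eqxx.
  apply: (split (next (next t1.1))) => //; rewrite /edge -k23 -k12 [_ == next t1.1]eq_sym (negbTE n3).
  move: t1 t2 t3 ne k12 k23 x12 x23 {n1 n2 n3 split} => [k [x y]] [k' [x' y']] [k'' [x'' y'']] /=.
  by move=> + k12 k23 x12 x23; rewrite -k12 -k23 -k12 -x23 -x12 !xpair_eqE !eqxx.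
have J (t t' t'' : I * (I * I)) : i != t.1 -> i != t'.1 -> i == t''.1 ->
    exists j, [/\ inner t (i, j), inner t' (i, j) & inner t'' (i, j) = false].
  move=> it it' it''; have [j jt jt'] := common (edge t i) (edge t' i).
  by exists j; rewrite /inner /= it it' jt jt' it''.
case: (eqVneq i t1.1) => i1; case: (eqVneq i t2.1) => i2; case: (eqVneq i t3.1) => i3 //= _.
- have [//|//||j [E2 E3 E1]] := J t2 t3 t1; first by apply/eqP.
  by exists (i, j); rewrite E1 E2 E3.
- have [//|//||j [E1 E3 E2]] := J t1 t3 t2; first by apply/eqP.
  by exists (i, j); rewrite E1 E2 E3.
have [//|//||j [E1 E2 E3]] := J t1 t2 t3; first by apply/eqP.
by exists (i, j); rewrite E1 E2 E3.
Qed.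

(** If both copies occur, the two sets in the same copy share a point by [inner_common], and the
    third set lies in the other copy. *)
Let block_split p q r : ~~ ((p == q) && (q == r)) ->
  exists v, (v \in block p) + (v \in block q) + (v \in block r) = 2.
Proof.
move: p q r => [b t] [b' t'] [b'' t''] ne.
have E v c w : (v \in block (c, w)) = (v.1 == c) && inner w v.2 by rewrite in_set.
case: (boolP ((b == b') && (b' == b''))) => [/andP[/eqP bb' /eqP bb'']|nb].
  subst b' b''; have [|v Ev] := inner_split (t1 := t) (t2 := t') (t3 := t'').
    by move: ne; rewrite !xpair_eqE eqxx.
  by exists (b, v); rewrite !E /= eqxx.
have [v1 /andP[]] := inner_common t t'; have [v2 /andP[]] := inner_common t t''.
have [v3 /andP[]] := inner_common t' t'' => h1 h2 h3 h4 h5 h6.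
by move: b b' b'' nb {ne} => [] [] [] // _;
  [exists (true, v1)|exists (true, v2)|exists (false, v3)|exists (true, v3)|exists (false, v2)|exists (false, v1)];
  rewrite !E /= ?h1 ?h2 ?h3 ?h4 ?h5 ?h6.
Qed.

Let F := [set block p | p : P].

Let block_inj : injective block.
Proof.
move=> p q E; apply/eqP/negPn/negP => pq.
have [|v] := @block_split p p q; first by rewrite eqxx.
by rewrite E; case: (v \in block q).
Qed.

Lemma block_family : [/\ uniform 4 F, sunflower_free 3 F & #|F| = 54].
Proof.
split.
- by move=> A /imsetP[p _ ->]; apply: card_block.
- move=> S SF [S3 [C core]].
  have /card_gt2P[A1 [A2 [A3 [[S1 S2 S3'] [n12 n23 n31]]]]] : 2 < #|S| by rewrite S3.
  have /imsetP[p _ E1] := subsetP SF _ S1; have /imsetP[q _ E2] := subsetP SF _ S2.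
  have /imsetP[r _ E3] := subsetP SF _ S3'.
  have [|v] := @block_split p q r.
    by apply: contraNN n12 => /andP[/eqP pq _]; rewrite E1 E2 pq.
  rewrite -E1 -E2 -E3.
  have := core _ _ S1 S2 n12; have := core _ _ S2 S3' n23; have := core _ _ S3' S1 n31.
  move=> /setP/(_ v) + /setP/(_ v) + /setP/(_ v); rewrite !inE => <-.
  by case: (v \in A1); case: (v \in A2); case: (v \in A3).
rewrite card_imset; last exact: block_inj.
by rewrite !card_prod card_bool !card_option card_bool.
Qed.

End LowerBound.

(** [f_eq] gives the value of [f] only from an attained maximum, so one has to be produced. [P] is
    an arbitrary proposition, hence the classical case distinction. *)
Lemma bounded_max (P : nat -> Prop) m n : P m -> (forall k, P k -> k <= n) ->
  exists k, [/\ P k, m <= k & forall j, P j -> j <= k].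
Proof.
move=> Pm bP; have [d le_d] : exists d, n - m <= d by exists (n - m).
elim: d m Pm le_d => [|d IH] m Pm le_d.
  by exists m; split=> // j /bP jn; move: le_d jn; clear; lia.
case: (classic (exists2 j, P j & m < j)) => [[j Pj mj]|no].
  have [|k [Pk jk maxk]] := IH j Pj; first by move: mj (bP _ Pj) le_d; clear; lia.
  by exists k; split=> //; apply: leq_trans (ltnW mj) jk.
by exists m; split=> // j Pj; rewrite leqNgt; apply/negP => mj; apply: no; exists j.
Qed.

Theorem theorem6p9 : 54 <= f 4 3 <= 83.
Proof.
pose P m := exists (T : finType) (F : {set {set T}}), [/\ uniform 4 F, sunflower_free 3 F & #|F| = m].
have P54 : P 54 by do 2 eexists; apply: block_family.
have P83 k : P k -> k <= 83.
  by move=> [T [F [uF /sunflower_free_sf sfF <-]]]; apply: sf4_le83.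
have [m [Pm m54 maxm]] := bounded_max P54 P83.
rewrite (f_eq (m := m)) ?m54 ?P83 //; split=> // T F uF sfF.
by apply: maxm; exists T, F.
Qed.
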